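(* a) The space of non-equilateral triangles $\{z_1,z_2,z_3\}$ in the complex plane is a $K(F(2)\rtimes F(1),1)$ space. b) The complement in $\mathbb{C}^3$ of the hypersurface $$S:\ (z_1-z_2)(z_1-z_3)(z_2-z_3)(z_1^2+z_2^2+z_3^2-z_1z_2-z_1z_3-z_2z_3)=0$$ is a $K(F(4)\times F(1),1)$ space.
   Context: $F(n)$ is the free group with $n$ generators. A triangle $\{z_1,z_2,z_3\}$ is an unordered configuration of three distinct complex numbers (collinear triples allowed), i.e. a point of $\mathcal{C}_3=\mathcal{F}_3/\Sigma_3$, where $\mathcal{F}_3\subset\mathbb{C}^3$ is the space of triples of distinct points; the space in a) has the subspace topology from $\mathcal{C}_3$. The semidirect product in a) is $F\langle\alpha,\beta\rangle\rtimes F\langle\gamma\rangle$ with $\gamma\alpha\gamma^{-1}=\beta$, $\gamma\beta\gamma^{-1}=\alpha$. *)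

(* Defs.v *)
From HB Require Import structures.
From mathcomp Require Import all_boot all_order all_algebra all_fingroup.
From mathcomp Require Import generic_quotient.
From mathcomp Require Import all_classical all_reals.
From mathcomp Require Import topology normedtype homotopy.
From mathcomp Require Import complex ring lra.

Set Implicit Arguments.
Unset Strict Implicit.
Unset Printing Implicit Defensive.

Import Order.TTheory GRing.Theory Num.Theory.
Import numFieldNormedType.Exports.

Local Open Scope classical_set_scope.
Local Open Scope ring_scope.
Local Open Scope complex_scope.
Local Open Scope quotient_scope.

Definition isomorphic_groups (G H : groupType) : Prop :=
  exists2 f : G -> H, {morph f : x y / (x * y)%g} & bijective f.

Section Automorphisms.
Variable G : groupType.

Record aut := Aut {
  aut_fun :> G -> G;
  aut_inv : G -> G;
  autM : {morph aut_fun : x y / (x * y)%g};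
  aut_funK : cancel aut_fun aut_inv;
  aut_invK : cancel aut_inv aut_fun
}.

HB.instance Definition _ := gen_eqMixin aut.
HB.instance Definition _ := gen_choiceMixin aut.

Lemma autP (f g : aut) : f =1 g -> f = g.
Proof.
case: f g => [f f' fM fK f'K] [g g' gM gK g'K] /= /funext fg.
subst g; have fg' : f' = g'.
  by apply/funext => x; rewrite -[x in LHS]g'K fK.
subst g'.
by rewrite (Prop_irrelevance fM gM) (Prop_irrelevance fK gK)
           (Prop_irrelevance f'K g'K).
Qed.

Lemma aut_invM (f : aut) : {morph aut_inv f : x y / (x * y)%g}.
Proof.
move=> x y.
by rewrite -[x in LHS](aut_invK f) -[y in LHS](aut_invK f) -autM aut_funK.
Qed.

Definition aut_id := @Aut id id (fun _ _ => erefl) (frefl _) (frefl _).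

Lemma aut_compM (f g : aut) : {morph f \o g : x y / (x * y)%g}.
Proof. by move=> x y /=; rewrite !autM. Qed.

(* Product of automorphisms is composition, (f * g) x = f (g x). *)
Definition aut_comp (f g : aut) : aut :=
  Aut (@aut_compM f g) (can_comp (aut_funK f) (aut_funK g))
      (can_comp (aut_invK g) (aut_invK f)).

Definition aut_opp (f : aut) : aut :=
  Aut (@aut_invM f) (aut_invK f) (aut_funK f).

Lemma aut_mulA : associative aut_comp.
Proof. by move=> f g h; apply: autP. Qed.
Lemma aut_mul1 : left_id aut_id aut_comp.
Proof. by move=> f; apply: autP. Qed.
Lemma aut_1mul : right_id aut_id aut_comp.
Proof. by move=> f; apply: autP. Qed.
Lemma aut_mulV : left_inverse aut_id aut_opp aut_comp.
Proof. by move=> f; apply: autP => x /=; rewrite aut_funK. Qed.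
Lemma aut_Vmul : right_inverse aut_id aut_opp aut_comp.
Proof. by move=> f; apply: autP => x /=; rewrite aut_invK. Qed.

HB.instance Definition _ :=
  isGroup.Build aut aut_mulA aut_mul1 aut_1mul aut_mulV aut_Vmul.

End Automorphisms.

Section FreeGroup.
Variable X : choiceType.

(* A letter is a generator (true) or the inverse of a generator (false). *)
Definition letter := (X * bool)%type.
Definition letter_inv (a : letter) : letter := (a.1, ~~ a.2).
Definition word := seq letter.
Definition word_inv (w : word) : word := rev (map letter_inv w).

Inductive word_eqv : word -> word -> Prop :=
| word_eqv_cancel u v a : word_eqv (u ++ a :: letter_inv a :: v) (u ++ v)
| word_eqv_refl w : word_eqv w w
| word_eqv_sym w1 w2 : word_eqv w1 w2 -> word_eqv w2 w1
| word_eqv_trans w2 w1 w3 :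
    word_eqv w1 w2 -> word_eqv w2 w3 -> word_eqv w1 w3.

Lemma letter_invK : involutive letter_inv.
Proof. by case=> x b; rewrite /letter_inv /= negbK. Qed.

Lemma word_eqv_catl u w1 w2 : word_eqv w1 w2 -> word_eqv (u ++ w1) (u ++ w2).
Proof.
elim=> {w1 w2} [u' v a|w|w1 w2 _|w2 w1 w3 _ + _].
- by rewrite !catA; exact: word_eqv_cancel.
- exact: word_eqv_refl.
- exact: word_eqv_sym.
- exact: word_eqv_trans.
Qed.

Lemma word_eqv_catr u w1 w2 : word_eqv w1 w2 -> word_eqv (w1 ++ u) (w2 ++ u).
Proof.
elim=> {w1 w2} [u' v a|w|w1 w2 _|w2 w1 w3 _ + _].
- by rewrite -!catA !cat_cons; exact: word_eqv_cancel.
- exact: word_eqv_refl.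
- exact: word_eqv_sym.
- exact: word_eqv_trans.
Qed.

Lemma word_inv_cat u v : word_inv (u ++ v) = word_inv v ++ word_inv u.
Proof. by rewrite /word_inv map_cat rev_cat. Qed.

Lemma word_eqv_inv w1 w2 :
  word_eqv w1 w2 -> word_eqv (word_inv w1) (word_inv w2).
Proof.
elim=> {w1 w2} [u v a|w|w1 w2 _|w2 w1 w3 _ + _].
- rewrite -[a :: _]/([:: a; letter_inv a] ++ v) !word_inv_cat -catA.
  rewrite [X in _ ++ X ++ _](_ : _ = [:: a; letter_inv a]).
    exact: word_eqv_cancel.
  by rewrite /word_inv /= letter_invK.
- exact: word_eqv_refl.
- exact: word_eqv_sym.
- exact: word_eqv_trans.
Qed.

Lemma word_eqvV w : word_eqv (word_inv w ++ w) [::].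
Proof.
elim: w => [|a w IH]; first exact: word_eqv_refl.
rewrite -cat1s word_inv_cat -catA /=; apply: word_eqv_trans IH.
rewrite -{2}[a]letter_invK; exact: word_eqv_cancel.
Qed.

Lemma word_invK : involutive word_inv.
Proof.
by move=> w; rewrite /word_inv map_rev revK mapK //; exact: letter_invK.
Qed.

Lemma word_Veqv w : word_eqv (w ++ word_inv w) [::].
Proof. by rewrite -{1}[w]word_invK; exact: word_eqvV. Qed.

Definition word_eqvb (u v : word) : bool := `[< word_eqv u v >].

Lemma word_eqvb_refl : reflexive word_eqvb.
Proof. by move=> w; apply/asboolP; exact: word_eqv_refl. Qed.
Lemma word_eqvb_sym : symmetric word_eqvb.
Proof.
by move=> u v; apply/idP/idP => /asboolP uv; apply/asboolP/word_eqv_sym.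
Qed.
Lemma word_eqvb_trans : transitive word_eqvb.
Proof.
move=> v u w /asboolP uv /asboolP vw; apply/asboolP; exact: word_eqv_trans vw.
Qed.

Definition word_equiv :=
  EquivRel word_eqvb word_eqvb_refl word_eqvb_sym word_eqvb_trans.

Definition free_group : Type := {eq_quot word_equiv}.
HB.instance Definition _ := EqQuotient.on free_group.
HB.instance Definition _ := Choice.on free_group.

Lemma free_groupP (u v : word) :
  \pi_free_group u = \pi_free_group v <-> word_eqv u v.
Proof.
split=> [/eqP|uv]; first by rewrite piE => /asboolP.
by apply/eqP; rewrite piE; apply/asboolP.
Qed.

Definition fg_mul (x y : free_group) : free_group :=
  \pi_free_group (repr x ++ repr y).
Definition fg_one : free_group := \pi_free_group [::].
Definition fg_inv (x : free_group) : free_group :=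
  \pi_free_group (word_inv (repr x)).

Lemma fg_ind (P : free_group -> Prop) :
  (forall w, P (\pi_free_group w)) -> forall x, P x.
Proof. by move=> piP x; rewrite -[x]reprK. Qed.

Lemma repr_eqv u : word_eqv (repr (\pi_free_group u)) u.
Proof. by apply/free_groupP; rewrite reprK. Qed.

Lemma fg_mul_pi u v :
  fg_mul (\pi_free_group u) (\pi_free_group v) = \pi_free_group (u ++ v).
Proof.
apply/free_groupP.
apply: (word_eqv_trans (w2 := u ++ repr (\pi_free_group v))).
  by apply: word_eqv_catr; exact: repr_eqv.
by apply: word_eqv_catl; exact: repr_eqv.
Qed.

Lemma fg_inv_pi u : fg_inv (\pi_free_group u) = \pi_free_group (word_inv u).
Proof. by apply/free_groupP; apply: word_eqv_inv; exact: repr_eqv. Qed.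

Lemma fg_mulA : associative fg_mul.
Proof.
by elim/fg_ind=> x; elim/fg_ind=> y; elim/fg_ind=> z; rewrite !fg_mul_pi catA.
Qed.
Lemma fg_mul1 : left_id fg_one fg_mul.
Proof. by elim/fg_ind=> x; rewrite fg_mul_pi. Qed.
Lemma fg_1mul : right_id fg_one fg_mul.
Proof. by elim/fg_ind=> x; rewrite fg_mul_pi cats0. Qed.
Lemma fg_mulV : left_inverse fg_one fg_inv fg_mul.
Proof.
elim/fg_ind=> x; rewrite fg_inv_pi fg_mul_pi; apply/free_groupP.
exact: word_eqvV.
Qed.
Lemma fg_Vmul : right_inverse fg_one fg_inv fg_mul.
Proof.
elim/fg_ind=> x; rewrite fg_inv_pi fg_mul_pi; apply/free_groupP.
exact: word_Veqv.
Qed.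

HB.instance Definition _ :=
  isGroup.Build free_group fg_mulA fg_mul1 fg_1mul fg_mulV fg_Vmul.

Definition fg_gen (x : X) : free_group := \pi_free_group [:: (x, true)].

Section Lift.
Variables (G : groupType) (f : X -> G).

Definition word_eval (w : word) : G :=
  (\prod_(a <- w) (if a.2 then f a.1 else (f a.1)^-1))%g.

Definition fg_lift (x : free_group) : G := word_eval (repr x).

Lemma word_eval_eqv u v : word_eqv u v -> word_eval u = word_eval v.
Proof.
elim=> {u v} // [u v [x b]|u w v _ -> _ -> //].
rewrite /word_eval !big_cat !big_cons /=; congr (_ * _)%g.
by case: b; rewrite mulgA ?mulgV ?mulVg mul1g.
Qed.

Lemma fg_lift_pi u : fg_lift (\pi_free_group u) = word_eval u.
Proof. by apply: word_eval_eqv; exact: repr_eqv. Qed.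

Lemma fg_liftM : {morph fg_lift : x y / (x * y)%g}.
Proof.
elim/fg_ind=> x; elim/fg_ind=> y.
have -> : (\pi_free_group x * \pi_free_group y)%g = \pi_free_group (x ++ y).
  exact: fg_mul_pi.
by rewrite !fg_lift_pi /word_eval big_cat.
Qed.

Lemma fg_lift_gen x : fg_lift (fg_gen x) = f x.
Proof. by rewrite fg_lift_pi /word_eval big_cons big_nil mulg1. Qed.

End Lift.

Lemma fg_morph_ext (G : groupType) (f g : free_group -> G) :
  {morph f : x y / (x * y)%g} -> {morph g : x y / (x * y)%g} ->
  (forall x, f (fg_gen x) = g (fg_gen x)) -> f =1 g.
Proof.
move=> fM gM fg; elim/fg_ind.
have f1 (h : free_group -> G) : {morph h : x y / (x * y)%g} -> h 1%g = 1%g.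
  by move=> hM; apply: (mulgI (h 1%g)); rewrite -hM !mulg1.
have fV (h : free_group -> G) x : {morph h : x y / (x * y)%g} ->
    h (x^-1)%g = (h x)^-1%g.
  by move=> hM; apply: (mulgI (h x)); rewrite -hM !mulgV f1.
elim=> [|[x b] w IH].
  have -> : \pi_free_group [::] = 1%g by [].
  by rewrite !f1.
rewrite -cat1s.
have -> : \pi_free_group ([:: (x, b)] ++ w) =
          (\pi_free_group [:: (x, b)] * \pi_free_group w)%g.
  by rewrite -[RHS]/(fg_mul _ _) fg_mul_pi.
rewrite fM gM IH; congr (_ * _)%g; case: b; first exact: fg.
have -> : \pi_free_group [:: (x, false)] = ((fg_gen x)^-1)%g.
  by rewrite -[RHS]/(fg_inv _) fg_inv_pi.
by rewrite !fV // fg.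
Qed.

End FreeGroup.

Notation Free n := (free_group 'I_n).

Section Semidirect.
Variables (N H : groupType) (phi : H -> aut N).
Hypothesis phiM : {morph phi : x y / (x * y)%g}.

Definition semidirect & {morph phi : x y / (x * y)%g} : Type := (N * H)%type.
Local Notation S := (semidirect phiM).
HB.instance Definition _ := Choice.copy S (N * H)%type.

Definition sd_mul (x y : S) : S := ((x.1 * phi x.2 y.1)%g, (x.2 * y.2)%g).
Definition sd_one : S := (1%g, 1%g).
Definition sd_inv (x : S) : S := (phi x.2^-1%g (x.1^-1)%g, (x.2^-1)%g).

Lemma aut1g (f : aut N) : f 1%g = 1%g.
Proof. by apply: (mulgI (f 1%g)); rewrite -autM !mulg1. Qed.
Lemma sd_phi1 : phi 1%g = 1%g.
Proof. by apply: (mulgI (phi 1%g)); rewrite -phiM !mulg1. Qed.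

Lemma sd_mulA : associative sd_mul.
Proof. by move=> [a b] [c d] [e f]; rewrite /sd_mul /= autM phiM !mulgA. Qed.
Lemma sd_mul1 : left_id sd_one sd_mul.
Proof. by move=> [a b]; rewrite /sd_mul /= sd_phi1 !mul1g. Qed.
Lemma sd_1mul : right_id sd_one sd_mul.
Proof. by move=> [a b]; rewrite /sd_mul /= aut1g !mulg1. Qed.
Lemma sd_mulV : left_inverse sd_one sd_inv sd_mul.
Proof.
by move=> [a b]; rewrite /sd_mul /sd_inv /= -autM !mulVg aut1g.
Qed.
Lemma sd_Vmul : right_inverse sd_one sd_inv sd_mul.
Proof.
move=> [a b]; rewrite /sd_mul /sd_inv /=.
have -> : phi b (phi b^-1%g a^-1%g) = (phi b * phi b^-1)%g a^-1%g by [].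
by rewrite -phiM !mulgV sd_phi1 /= mulgV.
Qed.

HB.instance Definition _ :=
  isGroup.Build S sd_mulA sd_mul1 sd_1mul sd_mulV sd_Vmul.

End Semidirect.

Section SwapProduct.

Definition swap_fun : Free 2 -> Free 2 := fg_lift (fun i => fg_gen (rev_ord i)).

Lemma swap_funK : involutive swap_fun.
Proof.
apply: (@fg_morph_ext _ _ (swap_fun \o swap_fun) id) => //.
  by move=> x y /=; rewrite /swap_fun !fg_liftM.
by move=> i /=; rewrite /swap_fun !fg_lift_gen rev_ordK.
Qed.

Definition swap_aut : aut (Free 2) := Aut (@fg_liftM _ _ _) swap_funK swap_funK.

Definition swap_action : Free 1 -> aut (Free 2) := fg_lift (fun=> swap_aut).

Definition swap_actionM : {morph swap_action : x y / (x * y)%g} :=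
  @fg_liftM _ _ _.

Definition F2_rtimes_F1 : groupType := semidirect swap_actionM.

Definition alpha : F2_rtimes_F1 := (fg_gen ord0, 1%g).
Definition beta : F2_rtimes_F1 := (fg_gen ord_max, 1%g).
Definition gamma : F2_rtimes_F1 := (1%g, fg_gen ord0).

Lemma gamma_alpha : (gamma * alpha * gamma^-1 = beta)%g.
Proof.
rewrite -[LHS]/(sd_mul (sd_mul gamma alpha) (sd_inv gamma)) /sd_mul /=.
rewrite mul1g mulg1 mulgV invg1 !aut1g mulg1 /swap_action fg_lift_gen /=.
rewrite /swap_fun fg_lift_gen; congr (fg_gen _, _); exact: val_inj.
Qed.

Lemma gamma_beta : (gamma * beta * gamma^-1 = alpha)%g.
Proof.
rewrite -[LHS]/(sd_mul (sd_mul gamma beta) (sd_inv gamma)) /sd_mul /=.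
rewrite mul1g mulg1 mulgV invg1 !aut1g mulg1 /swap_action fg_lift_gen /=.
rewrite /swap_fun fg_lift_gen; congr (fg_gen _, _); exact: val_inj.
Qed.

End SwapProduct.

Section UnitInterval.
Variable R : realType.

Definition unit_interval : Type := set_type `[0 : R, 1]%classic.
HB.instance Definition _ := Topological.on unit_interval.
Local Notation I := unit_interval.

Lemma clamp_subproof (r : R) :
  Num.max 0 (Num.min 1 r) \in `[0 : R, 1]%classic.
Proof. by rewrite inE /= in_itv /= le_max lexx ge_max ler01 ge_min lexx. Qed.

Definition clamp (r : R) : I :=
  @exist _ (fun x => x \in `[0 : R, 1]%classic) _ (clamp_subproof r).

Definition ival (t : I) : R := set_val t.

Lemma ival_ge0 t : 0 <= ival t.
Proof.
by case: t => r /[dup] /set_mem /=; rewrite /ival set_valE in_itv /= => /andP[].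
Qed.

Lemma ival_le1 t : ival t <= 1.
Proof.
by case: t => r /[dup] /set_mem /=; rewrite /ival set_valE in_itv /= => /andP[].
Qed.

Lemma ival_inj : injective ival.
Proof. by rewrite /ival set_valE; exact: val_inj. Qed.

Lemma clampE r : 0 <= r -> r <= 1 -> ival (clamp r) = r.
Proof. by move=> r0 r1; rewrite /ival set_valE /= (min_r r1) max_r. Qed.

Lemma clamp_le0 r : r <= 0 -> ival (clamp r) = 0.
Proof.
by move=> r0; rewrite /ival set_valE /= max_l // ge_min r0 orbT.
Qed.

Lemma clamp_ge1 r : 1 <= r -> ival (clamp r) = 1.
Proof. by move=> r1; rewrite /ival set_valE /= min_l // max_r. Qed.

Lemma clampK : cancel ival clamp.
Proof. by move=> t; apply: ival_inj; rewrite clampE ?ival_ge0 ?ival_le1. Qed.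

Lemma clamp_neq : clamp 0 != clamp 1.
Proof.
by apply/eqP => /(congr1 ival); rewrite !clampE // => /eqP; rewrite eq_sym oner_eq0.
Qed.

HB.instance Definition _ := isBiPointed.Build unit_interval clamp_neq.

Lemma ival0 : ival zero = 0. Proof. exact: clampE. Qed.
Lemma ival1 : ival one = 1. Proof. exact: clampE. Qed.
Lemma clamp0 r : r <= 0 -> clamp r = zero.
Proof. by move=> r0; apply: ival_inj; rewrite clamp_le0 // ival0. Qed.
Lemma clamp1 r : 1 <= r -> clamp r = one.
Proof. by move=> r0; apply: ival_inj; rewrite clamp_ge1 // ival1. Qed.

Lemma ival_continuous : continuous ival.
Proof. exact: initial_continuous. Qed.

Lemma clamp_continuous : continuous clamp.
Proof.
apply: (@continuous_comp_initial _ _ _ (set_val : I -> R)) => r.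
have -> : (set_val \o clamp) = (cst (0 : R) \max (cst (1 : R) \min id)).
  by apply/funext => x; rewrite set_valE.
apply: (@continuous_max R R^o); first exact: cvg_cst.
by apply: (@continuous_min R R^o); [exact: cvg_cst|exact: cvg_id].
Qed.

Lemma paste_continuous (Y Z : topologicalType) (u : Y -> R) (c : R)
    (f g : Y -> Z) :
  continuous u -> continuous f -> continuous g ->
  (forall y, u y = c -> f y = g y) ->
  continuous (fun y => if u y <= c then f y else g y).
Proof.
move=> cu cf cg fg; apply/continuous_subspace_setT.
have -> : [set: Y] =
    u @^-1` [set r | r <= c] `|` u @^-1` [set r | c <= r].
  by apply/esym; rewrite -subTset => y _ /=; apply/orP; exact: le_total.
apply: withinU_continuous.
- by apply: closed_comp (@closed_le _ _) => y _; exact: cu.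
- by apply: closed_comp (@closed_ge _ _) => y _; exact: cu.
- apply: (@subspace_eq_continuous _ _ _ f); last exact: continuous_subspaceT.
  by move=> y /set_mem /= yc; rewrite /from_subspace yc.
- apply: (@subspace_eq_continuous _ _ _ g); last exact: continuous_subspaceT.
  move=> y /set_mem /= cy; rewrite /from_subspace; case: ifPn => // yc.
  by rewrite fg //; apply/eqP; rewrite eq_le yc cy.
Qed.

End UnitInterval.

Section Homotopy.
Variables (R : realType) (X Y : topologicalType).
Local Notation I := (unit_interval R).

Definition homotopic_rel (A : set X) (f g : X -> Y) : Prop :=
  exists H : X * I -> Y,
    [/\ continuous H,
        forall x, H (x, zero) = f x,
        forall x, H (x, one) = g x &
        forall x t, A x -> H (x, t) = f x].

Lemma homotopic_rel_refl A f : continuous f -> homotopic_rel A f f.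
Proof.
move=> cf; exists (f \o fst); split=> // x.
by apply: continuous_comp; [exact: cvg_fst|exact: cf].
Qed.

Lemma continuous_to_pair (W Y1 Y2 : topologicalType) (f : W -> Y1)
    (g : W -> Y2) :
  continuous f -> continuous g -> continuous (fun w => (f w, g w)).
Proof. by move=> cf cg w; apply: cvg_pair; [exact: cf|exact: cg]. Qed.

Lemma continuous_o (W Y1 Y2 : topologicalType) (f : W -> Y1) (g : Y1 -> Y2) :
  continuous f -> continuous g -> continuous (g \o f).
Proof. by move=> cf cg w; apply: continuous_comp; [exact: cf|exact: cg]. Qed.

Lemma fst_cts (W Y1 : topologicalType) : continuous (@fst W Y1).
Proof. by move=> ?; exact: cvg_fst. Qed.

Lemma snd_cts (W Y1 : topologicalType) : continuous (@snd W Y1).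
Proof. by move=> ?; exact: cvg_snd. Qed.

Lemma affine_ival_cts (W : topologicalType) (a b : R) (f : W -> I) :
  continuous f -> continuous (fun w => a * ival (f w) + b).
Proof.
move=> cf w; apply: cvgD; last exact: cvg_cst.
apply: cvgM; first exact: cvg_cst.
exact: (continuous_o cf (@ival_continuous R)).
Qed.

Lemma affine_cts (W : topologicalType) (a b : R) (f : W -> I) :
  continuous f -> continuous (fun w => clamp (a * ival (f w) + b)).
Proof.
move=> cf; apply: (@continuous_o _ _ _ (fun w => a * ival (f w) + b)).
  exact: affine_ival_cts.
exact: clamp_continuous.
Qed.

Lemma homotopic_rel_sym A f g : homotopic_rel A f g -> homotopic_rel A g f.
Proof.
case=> H [cH H0 H1 HA].
exists (fun w => H (w.1, clamp (-1 * ival w.2 + 1))); split.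
- apply: (continuous_o _ cH); apply: continuous_to_pair; first exact: fst_cts.
  exact/affine_cts/snd_cts.
- by move=> x /=; rewrite ival0 mulr0 add0r clamp1.
- by move=> x /=; rewrite ival1 mulr1 addNr clamp0.
- by move=> x t Ax /=; rewrite HA // -H1 HA.
Qed.

Lemma homotopic_rel_trans A f g h :
  homotopic_rel A f g -> homotopic_rel A g h -> homotopic_rel A f h.
Proof.
case=> H [cH H0 H1 HA] [K [cK K0 K1 KA]].
pose H' (w : X * I) := H (w.1, clamp (2 * ival w.2 + 0)).
pose K' (w : X * I) := K (w.1, clamp (2 * ival w.2 + -1)).
exists (fun w => if ival w.2 <= 2^-1 then H' w else K' w); split.
- apply: (@paste_continuous _ _ _ (fun w => ival w.2)).
  + exact: (continuous_o (@snd_cts _ _) (@ival_continuous R)).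
  + apply: (continuous_o _ cH); apply: continuous_to_pair; first exact: fst_cts.
    exact/affine_cts/snd_cts.
  + apply: (continuous_o _ cK); apply: continuous_to_pair; first exact: fst_cts.
    exact/affine_cts/snd_cts.
  + move=> [x t] /= te; rewrite /H' /K' /= te.
    by rewrite clamp1 ?clamp0 ?H1 ?K0 //; lra.
- move=> x /=; rewrite ival0 invr_ge0 ler0n /H' /= ival0 clamp0 ?H0 //; lra.
- move=> x /=; rewrite ival1 ifN; last by rewrite -ltNge; lra.
  by rewrite /K' /= ival1 clamp1 ?K1 //; lra.
- move=> x t Ax /=; rewrite /H' /K' HA // KA // -H1 HA //.
  by case: ifP.
Qed.

End Homotopy.

Section PathAlgebra.
Variables (R : realType) (X : topologicalType).
Local Notation I := (unit_interval R).

Definition path_homotopic (p q : I -> X) : Prop :=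
  homotopic_rel R [set zero; one] p q.

Lemma path_homotopic_reparam (p : I -> X) (f g : I -> R) :
  continuous p -> continuous f -> continuous g ->
  clamp (f zero) = clamp (g zero) -> clamp (f one) = clamp (g one) ->
  path_homotopic (p \o @clamp R \o f) (p \o @clamp R \o g).
Proof.
move=> cp cf cg fg0 fg1.
pose h (w : I * I) : R := (1 - ival w.2) * ival (clamp (f w.1)) +
  ival w.2 * ival (clamp (g w.1)).
have cc (k : I -> R) : continuous k ->
    continuous (fun w : I * I => ival (clamp (k w.1))).
  move=> ck; apply: (@continuous_o _ _ _ fst (fun t => ival (clamp (k t)))).
    exact: fst_cts.
  apply: (@continuous_o _ _ _ k (fun r => ival (clamp r)) ck).
  exact: (continuous_o (@clamp_continuous R) (@ival_continuous R)).
have ci : continuous (fun w : I * I => ival w.2).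
  exact: (continuous_o (@snd_cts _ _) (@ival_continuous R)).
exists (p \o @clamp R \o h); split.
- apply: continuous_o; last exact: (continuous_o (@clamp_continuous R) cp).
  move=> w; apply: cvgD; apply: cvgM.
  + by apply: cvgB; [exact: cvg_cst|exact: ci].
  + exact: cc.
  + exact: ci.
  + exact: cc.
- by move=> t; rewrite /= /h /= ival0 mul0r addr0 subr0 mul1r clampK.
- by move=> t; rewrite /= /h /= ival1 subrr mul0r add0r mul1r clampK.
- move=> t s; case=> /= ->; rewrite /h /= -?fg0 -?fg1 -mulrDl subrK mul1r;
  by rewrite clampK.
Qed.

Definition path_cat_fun (p q : I -> X) (t : I) : X :=
  if ival t <= 2^-1 then p (clamp (2 * ival t + 0))
  else q (clamp (2 * ival t + -1)).

Lemma path_cat_continuous p q :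
  continuous p -> continuous q -> p one = q zero ->
  continuous (path_cat_fun p q).
Proof.
move=> cp cq pq; apply: paste_continuous.
- exact: ival_continuous.
- by apply: (continuous_o _ cp); apply: affine_cts => ?; exact: cvg_id.
- by apply: (continuous_o _ cq); apply: affine_cts => ?; exact: cvg_id.
- by move=> t ->; rewrite clamp1 ?clamp0 //; lra.
Qed.

Lemma path_cat_zero p q : path_cat_fun p q zero = p zero.
Proof. by rewrite /path_cat_fun ival0 invr_ge0 ler0n clamp0 //; lra. Qed.

Lemma path_cat_one p q : path_cat_fun p q one = q one.
Proof.
rewrite /path_cat_fun ival1 ifN; last by rewrite -ltNge; lra.
by rewrite clamp1 //; lra.
Qed.

Lemma path_cat_homotopic p p' q q' : p one = q zero -> 
  path_homotopic p p' -> path_homotopic q q' ->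
  path_homotopic (path_cat_fun p q) (path_cat_fun p' q').
Proof.
move=> pq [H [cH H0 H1 HA]] [K [cK K0 K1 KA]].
exists (fun w => if ival w.1 <= 2^-1 then H (clamp (2 * ival w.1 + 0), w.2)
                 else K (clamp (2 * ival w.1 + -1), w.2)); split.
- apply: (@paste_continuous _ _ _ (fun w => ival w.1)).
  + exact: (continuous_o (@fst_cts _ _) (@ival_continuous R)).
  + apply: (continuous_o _ cH); apply: continuous_to_pair; last exact: snd_cts.
    exact/affine_cts/fst_cts.
  + apply: (continuous_o _ cK); apply: continuous_to_pair; last exact: snd_cts.
    exact/affine_cts/fst_cts.
  + move=> [x t] /= ->.
    have -> : clamp (2 * 2^-1 + 0 : R) = one by rewrite clamp1 //; lra.
    have -> : clamp (2 * 2^-1 + -1 : R) = zero by rewrite clamp0 //; lra.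
    by rewrite HA ?KA //; [left|right].
- by move=> t /=; rewrite H0 K0.
- by move=> t /=; rewrite H1 K1.
- move=> t s /= [] ->.
    rewrite path_cat_zero ival0 invr_ge0 ler0n clamp0; last lra.
    by rewrite HA //; left.
  rewrite path_cat_one ival1 ifN; last by rewrite -ltNge; lra.
  by rewrite clamp1 ?KA //; [right|lra].
Qed.

Lemma path_catA p q r : continuous p -> continuous q -> continuous r ->
  p one = q zero -> q one = r zero ->
  path_homotopic (path_cat_fun p (path_cat_fun q r))
                 (path_cat_fun (path_cat_fun p q) r).
Proof.
move=> cp cq cr pq qr.
pose P := path_cat_fun p (path_cat_fun q r).
have cP : continuous P.
  by apply: path_cat_continuous => //; [exact: path_cat_continuous|
                                        rewrite path_cat_zero].
pose k : R -> R := (fun x => 2 * x + 0) \min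
                   ((fun x => x + 4^-1) \min (fun x => 2^-1 * x + 2^-1)).
have ck : continuous k.
  move=> x; apply: (@continuous_min R R^o).
    by apply: cvgD; [apply: cvgM|]; [exact: cvg_cst|exact: cvg_id|exact: cvg_cst].
  apply: (@continuous_min R R^o).
    by apply: cvgD; [exact: cvg_id|exact: cvg_cst].
  by apply: cvgD; [apply: cvgM|]; [exact: cvg_cst|exact: cvg_id|exact: cvg_cst].
have -> : path_cat_fun (path_cat_fun p q) r = P \o @clamp R \o (k \o @ival R).
  apply/funext => t /=; have := ival_ge0 t; have := ival_le1 t.
  rewrite /P /path_cat_fun; move: (ival t) => x x1 x0.
  have kE : k x = if x <= 4^-1 then 2 * x else
                  if x <= 2^-1 then x + 4^-1 else 2^-1 * x + 2^-1.
    rewrite /k /= !minEle.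
    by do ! case: ifPn; rewrite -?ltNge => *; lra.
  have k01 : 0 <= k x <= 1.
    rewrite kE; apply/andP.
    by do ! case: ifPn; rewrite -?ltNge => *; split; lra.
  case/andP: k01 => k0 k1.
  rewrite (clampE k0 k1) kE.
  have E1 : x <= 2^-1 -> ival (clamp (2 * x + 0)) = 2 * x.
    by move=> ?; rewrite clampE; lra.
  have [x4|x4] := lerP x 4^-1.
    have x2 : x <= 2^-1 by lra.
    have xx2 : 2 * x <= 2^-1 by lra.
    by rewrite x2 E1 // xx2.
  have [x2|x2] := lerP x 2^-1.
    have xx2 : (2 * x <= 2^-1) = false by apply/negbTE; rewrite -ltNge; lra.
    have y2 : (x + 4^-1 <= 2^-1) = false by apply/negbTE; rewrite -ltNge; lra.
    have E2 : ival (clamp (2 * (x + 4^-1) + -1)) = 2 * x + - 2^-1.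
      by rewrite clampE; lra.
    have z2 : 2 * x + - 2^-1 <= 2^-1 by lra.
    rewrite E1 // xx2 y2 E2 z2; congr (q (clamp _)); lra.
  have y2 : (2^-1 * x + 2^-1 <= 2^-1) = false.
    by apply/negbTE; rewrite -ltNge; lra.
  have E2 : ival (clamp (2 * (2^-1 * x + 2^-1) + -1)) = x.
    by rewrite clampE; lra.
  have z2 : (x <= 2^-1) = false by apply/negbTE; rewrite -ltNge.
  by rewrite y2 E2 z2.
have {1}-> : path_cat_fun p (path_cat_fun q r) = P \o @clamp R \o @ival R.
  by apply/funext => t /=; rewrite clampK.
apply: path_homotopic_reparam => //.
- exact: ival_continuous.
- exact: (continuous_o (@ival_continuous R) ck).
- rewrite /= ival0 /k /= !minEle.
  by do ! case: ifPn; rewrite -?ltNge => *; congr clamp; lra.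
- rewrite /= ival1 /k /= !minEle.
  by do ! case: ifPn; rewrite -?ltNge => *; congr clamp; lra.
Qed.

Lemma path_cat1 p : continuous p ->
  path_homotopic (path_cat_fun (cst (p zero)) p) p.
Proof.
move=> cp.
have -> : path_cat_fun (cst (p zero)) p =
          p \o @clamp R \o (fun t => 2 * ival t + -1).
  apply/funext => t; rewrite /path_cat_fun /=.
  case: ifPn => // t2; suff -> : clamp (2 * ival t + -1) = zero by [].
  by rewrite clamp0 //; lra.
have {2}-> : p = p \o @clamp R \o @ival R.
  by apply/funext => t /=; rewrite clampK.
apply: path_homotopic_reparam => //.
- by apply: (@affine_ival_cts R I _ _ id) => ?; exact: cvg_id.
- exact: ival_continuous.
- by rewrite ival0 !clamp0 //; lra.
- by rewrite ival1 !clamp1 //; lra.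
Qed.

Lemma path_1cat p : continuous p ->
  path_homotopic (path_cat_fun p (cst (p one))) p.
Proof.
move=> cp.
have -> : path_cat_fun p (cst (p one)) =
          p \o @clamp R \o (fun t => 2 * ival t + 0).
  apply/funext => t; rewrite /path_cat_fun /=.
  case: ifPn => //; rewrite -ltNge => t2.
  suff -> : clamp (2 * ival t + 0) = one by [].
  by rewrite clamp1 //; lra.
have {2}-> : p = p \o @clamp R \o @ival R.
  by apply/funext => t /=; rewrite clampK.
apply: path_homotopic_reparam => //.
- by apply: (@affine_ival_cts R I _ _ id) => ?; exact: cvg_id.
- exact: ival_continuous.
- by rewrite ival0 !clamp0 //; lra.
- by rewrite ival1 !clamp1 //; lra.
Qed.

Definition path_rev_fun (p : I -> X) (t : I) : X := p (clamp (-1 * ival t + 1)).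

Lemma path_rev_continuous p : continuous p -> continuous (path_rev_fun p).
Proof.
by move=> cp; apply: (continuous_o _ cp); apply: affine_cts => ?; exact: cvg_id.
Qed.
Lemma path_rev_zero p : path_rev_fun p zero = p one.
Proof. by rewrite /path_rev_fun ival0 clamp1 //; lra. Qed.
Lemma path_rev_one p : path_rev_fun p one = p zero.
Proof. by rewrite /path_rev_fun ival1 clamp0 //; lra. Qed.
Lemma path_revK p : path_rev_fun (path_rev_fun p) = p.
Proof.
apply/funext => t; rewrite /path_rev_fun clampE; last 2 first.
- by have := ival_le1 t; lra.
- by have := ival_ge0 t; lra.
by rewrite (_ : -1 * (-1 * ival t + 1) + 1 = ival t) ?clampK //; lra.
Qed.

Lemma path_rev_homotopic p q :
  path_homotopic p q -> path_homotopic (path_rev_fun p) (path_rev_fun q).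
Proof.
case=> H [cH H0 H1 HA].
exists (fun w => H (clamp (-1 * ival w.1 + 1), w.2)); split.
- apply: (continuous_o _ cH); apply: continuous_to_pair; last exact: snd_cts.
  exact/affine_cts/fst_cts.
- by move=> t /=; rewrite H0.
- by move=> t /=; rewrite H1.
- move=> t s [] ->; rewrite HA //.
  + by right => /=; rewrite ival0 clamp1 //; lra.
  + by left => /=; rewrite ival1 clamp0 //; lra.
Qed.

Lemma path_catV p : continuous p ->
  path_homotopic (path_cat_fun (path_rev_fun p) p) (cst (p one)).
Proof.
move=> cp.
have -> : path_cat_fun (path_rev_fun p) p =
          p \o @clamp R \o (fun t => `|2 * ival t + -1|).
  apply/funext => t; rewrite /path_cat_fun /path_rev_fun /=.
  have t0 := ival_ge0 t; have t1 := ival_le1 t.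
  case: ifPn; rewrite -?ltNge => t2; last by rewrite ger0_norm //; lra.
  rewrite ler0_norm; last lra.
  by rewrite clampE; [congr (p (clamp _)); lra|lra..].
have -> : cst (p one) = p \o @clamp R \o (fun _ : I => 1 : R).
  by apply/funext => t /=; rewrite clamp1.
apply: path_homotopic_reparam => //.
- have ca : continuous (fun t : I => 2 * ival t + -1).
    by apply: (@affine_ival_cts R I _ _ id) => ?; exact: cvg_id.
  exact: (continuous_o ca (@norm_continuous R R^o)).
- exact: cst_continuous.
- by rewrite ival0 mulr0 add0r normrN1.
- by rewrite ival1 /=; congr clamp; rewrite ger0_norm; lra.
Qed.

Lemma path_Vcat p : continuous p ->
  path_homotopic (path_cat_fun p (path_rev_fun p)) (cst (p zero)).
Proof.
move=> cp; have := path_catV (path_rev_continuous cp).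
by rewrite path_revK path_rev_one.
Qed.

End PathAlgebra.

Section FundamentalGroup.
Variables (R : realType) (X : topologicalType) (x0 : X).
Local Notation I := (unit_interval R).

Definition loop := {path I from x0 to x0}.
HB.instance Definition _ := Choice.on loop.

Lemma loop_continuous (p : loop) : continuous (p : I -> X).
Proof. exact: cts_fun. Qed.

Definition loop_homotopic (p q : loop) : bool := `[< path_homotopic p q >].

Lemma loop_homotopic_refl : reflexive loop_homotopic.
Proof. by move=> p; apply/asboolP/homotopic_rel_refl; exact: cts_fun. Qed.
Lemma loop_homotopic_sym : symmetric loop_homotopic.
Proof.
by move=> p q; apply/idP/idP => /asboolP pq; apply/asboolP/homotopic_rel_sym.
Qed.
Lemma loop_homotopic_trans : transitive loop_homotopic.
Proof.
move=> q p r /asboolP pq /asboolP qr; apply/asboolP.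
exact: homotopic_rel_trans qr.
Qed.

Definition loop_equiv := EquivRel loop_homotopic
  loop_homotopic_refl loop_homotopic_sym loop_homotopic_trans.

Definition pi1 : Type := {eq_quot loop_equiv}.
HB.instance Definition _ := EqQuotient.on pi1.
HB.instance Definition _ := Choice.on pi1.

Lemma pi1P (p q : loop) : \pi_pi1 p = \pi_pi1 q <-> path_homotopic p q.
Proof.
split=> [/eqP|pq]; first by rewrite piE => /asboolP.
by apply/eqP; rewrite piE; apply/asboolP.
Qed.

Section LoopOperations.
Variables p q : loop.

Lemma loop_cat_continuous : continuous (path_cat_fun p q).
Proof.
by apply: path_cat_continuous; [exact: cts_fun..|rewrite path_one path_zero].
Qed.
Lemma loop_cat_zero : path_cat_fun p q zero = x0.
Proof. by rewrite path_cat_zero path_zero. Qed.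
Lemma loop_cat_one : path_cat_fun p q one = x0.
Proof. by rewrite path_cat_one path_one. Qed.
Definition loop_cat : loop :=
  mk_path loop_cat_continuous loop_cat_zero loop_cat_one.

Lemma loop_rev_continuous : continuous (path_rev_fun p).
Proof. by apply: path_rev_continuous; exact: cts_fun. Qed.
Lemma loop_rev_zero : path_rev_fun p zero = x0.
Proof. by rewrite path_rev_zero path_one. Qed.
Lemma loop_rev_one : path_rev_fun p one = x0.
Proof. by rewrite path_rev_one path_zero. Qed.
Definition loop_rev : loop :=
  mk_path loop_rev_continuous loop_rev_zero loop_rev_one.

End LoopOperations.

Definition pi1_mul (a b : pi1) : pi1 := \pi_pi1 (loop_cat (repr a) (repr b)).
Definition pi1_one : pi1 := \pi_pi1 (cst x0 : loop).
Definition pi1_inv (a : pi1) : pi1 := \pi_pi1 (loop_rev (repr a)).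

Lemma pi1_ind (P : pi1 -> Prop) : (forall p, P (\pi_pi1 p)) -> forall a, P a.
Proof. by move=> piP x; rewrite -[x]reprK. Qed.

Lemma repr_loop p : path_homotopic (repr (\pi_pi1 p)) p.
Proof. by apply/pi1P; rewrite reprK. Qed.

Lemma pi1_mul_pi p q : pi1_mul (\pi_pi1 p) (\pi_pi1 q) = \pi_pi1 (loop_cat p q).
Proof.
apply/pi1P; apply: path_cat_homotopic; rewrite ?path_one ?path_zero //;
exact: repr_loop.
Qed.

Lemma pi1_inv_pi p : pi1_inv (\pi_pi1 p) = \pi_pi1 (loop_rev p).
Proof. by apply/pi1P; apply: path_rev_homotopic; exact: repr_loop. Qed.

Lemma pi1_mulA : associative pi1_mul.
Proof.
elim/pi1_ind=> p; elim/pi1_ind=> q; elim/pi1_ind=> r; rewrite !pi1_mul_pi.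
by apply/pi1P; apply: path_catA; rewrite ?path_one ?path_zero //; exact: cts_fun.
Qed.
Lemma pi1_mul1 : left_id pi1_one pi1_mul.
Proof.
elim/pi1_ind=> p; rewrite pi1_mul_pi; apply/pi1P.
by have := path_cat1 (@loop_continuous p); rewrite path_zero.
Qed.
Lemma pi1_1mul : right_id pi1_one pi1_mul.
Proof.
elim/pi1_ind=> p; rewrite pi1_mul_pi; apply/pi1P.
by have := path_1cat (@loop_continuous p); rewrite path_one.
Qed.
Lemma pi1_mulV : left_inverse pi1_one pi1_inv pi1_mul.
Proof.
elim/pi1_ind=> p; rewrite pi1_inv_pi pi1_mul_pi; apply/pi1P.
by have := path_catV (@loop_continuous p); rewrite path_one.
Qed.
Lemma pi1_Vmul : right_inverse pi1_one pi1_inv pi1_mul.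
Proof.
elim/pi1_ind=> p; rewrite pi1_inv_pi pi1_mul_pi; apply/pi1P.
by have := path_Vcat (@loop_continuous p); rewrite path_zero.
Qed.

HB.instance Definition _ :=
  isGroup.Build pi1 pi1_mulA pi1_mul1 pi1_1mul pi1_mulV pi1_Vmul.

End FundamentalGroup.

Section EilenbergMacLane.
Variable R : realType.
Local Notation I := (unit_interval R).

Definition path_connected (X : topologicalType) : Prop :=
  forall x y : X, inhabited {path I from x to y}.

Definition cube_boundary (n : nat) : set 'rV[I]_n :=
  [set t | exists i, t 0 i = zero \/ t 0 i = one].

(* pi_n (X, x0) is the set of homotopy classes, relative to the boundary of   *)
(* the cube I^n, of the maps I^n -> X sending the boundary to x0; this says   *)
(* that the constant class is the only one.                                   *)
Definition trivial_pi (n : nat) (X : topologicalType) (x0 : X) : Prop :=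
  forall f : 'rV[I]_n -> X, continuous f ->
    (forall t, cube_boundary t -> f t = x0) ->
    homotopic_rel R (@cube_boundary n) f (cst x0).

Definition K1_space (X : topologicalType) (G : groupType) : Prop :=
  [/\ inhabited X,
      path_connected X &
      forall x0 : X, isomorphic_groups (pi1 R x0) G /\
        forall n, (2 <= n)%N -> trivial_pi n x0].

End EilenbergMacLane.

(* The topology of the norm on the complex numbers, as on any numFieldType. *)
HB.instance Definition _ (R : realType) := NormedModule.copy R[i] R[i]^o.

Section Triangles.
Variable R : realType.
Local Notation C := R[i].

Definition ordered_conf (n : nat) : set 'rV[C]_n :=
  [set z | injective (fun i => z 0 i)].

Section Unordered.
Variable n : nat.

Definition conf_perm (z w : @ordered_conf n) : bool :=
  [exists s : 'S_n, set_val w == col_perm s (set_val z)].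

Lemma conf_perm_refl : reflexive conf_perm.
Proof. by move=> z; apply/existsP; exists 1%g; rewrite col_perm1. Qed.
Lemma conf_perm_sym : symmetric conf_perm.
Proof.
suff sub z w : conf_perm z w -> conf_perm w z by move=> z w; apply/idP/idP => /sub.
case/existsP=> s /eqP wE; apply/existsP; exists (s^-1)%g.
by rewrite wE -col_permM mulVg col_perm1.
Qed.
Lemma conf_perm_trans : transitive conf_perm.
Proof.
move=> w z v /existsP[s /eqP wE] /existsP[t /eqP vE]; apply/existsP.
by exists (t * s)%g; rewrite vE wE -col_permM.
Qed.

Definition conf_equiv :=
  EquivRel conf_perm conf_perm_refl conf_perm_sym conf_perm_trans.

Definition unordered_conf : Type := quotient_topology {eq_quot conf_equiv}.
HB.instance Definition _ := Topological.on unordered_conf.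
HB.instance Definition _ := Quotient.on unordered_conf.

Lemma unordered_confP (z w : @ordered_conf n) :
  \pi_unordered_conf z = \pi_unordered_conf w <-> conf_perm z w.
Proof.
by split=> [|zw]; [move/(@eqmodP _ conf_equiv)|apply/(@eqmodP _ conf_equiv)].
Qed.

End Unordered.

Definition equilateral (z : 'rV[C]_3) : Prop :=
  `|z 0 0 - z 0 1| = `|z 0 1 - z 0 2| /\
  `|z 0 1 - z 0 2| = `|z 0 2 - z 0 0|.

Lemma equilateralP (z : 'rV[C]_3) :
  equilateral z <->
  forall i j k l, i != j -> k != l -> `|z 0 i - z 0 j| = `|z 0 k - z 0 l|.
Proof.
split=> [[e1 e2]|eq_sides]; last by split; apply: eq_sides.
suff side i j : i != j -> `|z 0 i - z 0 j| = `|z 0 0 - z 0 1|.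
  by move=> i j k l ij kl; rewrite !side.
have v (k : 'I_3) : [\/ k = 0, k = 1 | k = 2].
  case: k => [[|[|[|//]]] k3]; [constructor 1|constructor 2|constructor 3];
  exact: val_inj.
case: (v i) => ->; case: (v j) => ->; rewrite ?eqxx // => _.
- exact: etrans (distrC _ _) (etrans (esym e2) (esym e1)).
- exact: distrC.
- exact: etrans (esym e2) (esym e1).
- exact: etrans (distrC _ _) (esym e1).
Qed.

Lemma equilateral_perm (s : 'S_3) (z : 'rV[C]_3) :
  equilateral z -> equilateral (col_perm s z).
Proof.
move=> /equilateralP eq_sides; apply/equilateralP => i j k l ij kl.
by rewrite !mxE; apply: eq_sides; rewrite (inj_eq perm_inj).
Qed.

Definition equilateral_triangle : set (unordered_conf 3) :=
  [set T | exists2 z, T = \pi_(unordered_conf 3) z & equilateral (set_val z)].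

Lemma equilateral_triangleP (z : @ordered_conf 3) :
  equilateral_triangle (\pi_(unordered_conf 3) z) <-> equilateral (set_val z).
Proof.
split=> [[w /esym/unordered_confP]|ez]; last by exists z.
move=> /existsP[s /eqP ->]; exact: equilateral_perm.
Qed.

Definition non_equilateral_triangles : set (unordered_conf 3) :=
  ~` equilateral_triangle.

Definition hypersurface : set 'rV[C]_3 :=
  [set z | let: (z1, z2, z3) := (z 0 0, z 0 1, z 0 2) in
     (z1 - z2) * (z1 - z3) * (z2 - z3) *
     (z1 ^+ 2 + z2 ^+ 2 + z3 ^+ 2 - z1 * z2 - z1 * z3 - z2 * z3) = 0].

End Triangles.

(* Main.v *)
(* Up to translation, three distinct points are determined by the coefficients
   of X^3 - 3 p X - q with q^2 <> 4 p^3, and the triangle is equilateral exactly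
   when p = 0. The map (p, q) |-> p is a fibration over the punctured plane;
   writing p = s^2, the coordinate q / (2 s^3) identifies the fibres with the
   plane minus 1 and -1, and one turn around p = 0 rotates this fibre by pi,
   exchanging the loops around the two punctures: this gives F(2) >< F(1). For
   ordered triples, scaling by z2 - z1 splits off a punctured plane and leaves
   (z3 - z1) / (z2 - z1) in the plane minus 0, 1 and the two primitive sixth
   roots of unity.

   The plane minus n real points is cut by the real line into two half-planes,
   glued along n + 1 intervals; its universal covering space is a tree of
   half-planes. The image of a compact space under a map to this covering space
   meets finitely many half-planes, and a half-plane that is a leaf of the tree
   retracts onto the interval joining it to its parent, so the map can be
   contracted by pruning the leaves one after the other. *)
From HB Require Import structures.
From mathcomp Require Import all_boot all_order all_algebra all_fingroup.
From mathcomp Require Import generic_quotient.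
From mathcomp Require Import all_classical all_reals.
From mathcomp Require Import topology normedtype homotopy realfun.
From mathcomp Require Import complex ring lra.
Require Import Defs.

Set Implicit Arguments.
Unset Strict Implicit.
Unset Printing Implicit Defensive.

Import Order.TTheory GRing.Theory Num.Theory.
Import numFieldNormedType.Exports.

Local Open Scope classical_set_scope.
Local Open Scope ring_scope.
Local Open Scope complex_scope.
Local Open Scope quotient_scope.

Local Notation Re := (@complex.Re _).
Local Notation Im := (@complex.Im _).

(** No covering space is constructed. A covering with deck group [G] is encoded by a possibly
    discontinuous function [c] on pairs of points, and a map to it by a pair [(f, g)] in which [g]
    changes by [c] along [f]; products and twisted products of coverings become formulas.

    The property carried through the proof is [aspherical]. It is stated for pairs [(W, A)], so that
    one statement serves the injectivity of the monodromy and the higher homotopy groups, and it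
    replaces the long exact sequence of the fibration: homotopies in the base and in the fibre are
    found separately and recombined.

    Recombining needs a continuous root [s] of [p], which does not exist on the punctured plane. A
    lift of [p] to the covering of the base counts the crossings of the cut of the principal root,
    and its parity is the sign that makes the root continuous along the lift. Changing this sign
    rotates the fibre by pi, so the cocycle of the fibre has to be equivariant under this rotation:
    this dictates the choice of the middle interval as the trivial one and the splitting of the
    generators between the exits to the two half-planes. *)

Lemma pairl_continuous (W Z : topologicalType) (z : Z) :
  continuous (fun w : W => (w, z)).
Proof.
by apply: continuous_to_pair => w; [exact: cvg_id|exact: cvg_cst].
Qed.

Lemma pairr_continuous (W Z : topologicalType) (w : W) :
  continuous (fun z : Z => (w, z)).
Proof.
by apply: continuous_to_pair => z; [exact: cvg_cst|exact: cvg_id].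
Qed.

Lemma near_cts (W Z : topologicalType) (f : W -> Z) (w : W) (P : set Z) :
  continuous f -> (\forall z \near f w, P z) -> \forall w' \near w, P (f w').
Proof. by move=> cf; exact: cf. Qed.

(** * Connectedness, compactness and neighbourhoods of the unit interval *)

Section Interval.
Variable R : realType.
Local Notation I := (unit_interval R).

Lemma unit_interval_image (A : set R) :
  `[0, 1]%classic `<=` A -> @clamp R @` A = [set: I].
Proof.
move=> sA; apply/seteqP; split=> // t _; exists (ival t); last exact: clampK.
by apply: sA; rewrite /= in_itv /= ival_ge0 ival_le1.
Qed.

Lemma unit_interval_connected : connected [set: I].
Proof.
rewrite -(@unit_interval_image `[0, 1]%classic) //.
apply: connected_continuous_connected.
  by apply/connected_intervalP; exact: interval_is_interval.
exact/continuous_subspaceT/clamp_continuous.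
Qed.

Lemma unit_interval_compact : compact [set: I].
Proof.
rewrite -(@unit_interval_image `[0, 1]%classic) //.
apply: continuous_compact; last exact: segment_compact.
exact/continuous_subspaceT/clamp_continuous.
Qed.

Lemma unit_interval_clopen (S : set I) (t0 : I) : S t0 ->
  (forall t, \forall t' \near t, S t' <-> S t) -> forall t, S t.
Proof.
move=> S0 locS t.
have oS : open S.
  by rewrite openE => s Ss; apply: filterS (locS s) => s' [_]; exact.
have cS : closed S.
  rewrite -[S]setCK; apply: open_closedC; rewrite openE => s Ss.
  by apply: filterS (locS s) => s' [+ _] => /[apply].
suff -> : S = setT by [].
apply: (unit_interval_connected); first by exists t0.
  by exists S => //; rewrite setTI.
by exists S => //; rewrite setTI.
Qed.

Lemma near_unit_interval (t : I) (A : set I) : nbhs t A ->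
  exists2 e : R, 0 < e & forall s, `|ival s - ival t| < e -> A s.
Proof.
rewrite nbhsE => -[_ [[B oB <-] Bt] sA].
have : nbhs (ival t) B by apply: open_nbhs_nbhs.
case/nbhs_ballP => e /= e0 sB; exists e => // s st.
by apply: sA; apply: sB; rewrite /ball /= distrC.
Qed.

Lemma near_ival (t : I) (e : R) : 0 < e ->
  \forall s \near t, `|ival s - ival t| < e.
Proof.
move=> e0; have := @ival_continuous R t.
move/cvgrPdist_lt => /(_ e e0); apply: filterS => s.
by rewrite distrC.
Qed.

End Interval.

(** * Flat sections of local cocycles *)

Section FlatSections.
Variables (T : topologicalType) (G : groupType).
Implicit Types (c : T -> T -> G).

(** The neighbourhood of [x''] depends on [x']: for [crossing] and a real [x], the relation may fail
    when [x'] and [x''] are close to [x] but on opposite sides of the real line. *)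
Definition local_cocycle (X : set T) c : Prop := forall x, X x ->
  \forall x' \near x, \forall x'' \near x', c x x'' = (c x x' * c x' x'')%g.

(* A local cocycle [c] on [X] glues [X * G] into a covering space of [X] with  *)
(* deck group [G], and [flat c f g] says that [w |-> (f w, g w)] is a          *)
(* continuous lift of [f] to it.                                               *)
Definition flat (W : topologicalType) c (f : W -> T) (g : W -> G) : Prop :=
  forall w, \forall w' \near w, g w' = (g w * c (f w) (f w'))%g.

Lemma local_cocycle1 X c x : local_cocycle X c -> X x -> c x x = 1%g.
Proof.
move=> cc /cc /nbhs_singleton /nbhs_singleton cE.
by apply: (mulgI (c x x)); rewrite mulg1 -cE.
Qed.

Lemma flat_mull (W : topologicalType) c (f : W -> T) (g : W -> G) (h : G) :
  flat c f g -> flat c f (fun w => (h * g w)%g).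
Proof. by move=> fg w; apply: filterS (fg w) => w' ->; rewrite mulgA. Qed.

Lemma flat_comp (V W : topologicalType) c (f : W -> T) (g : W -> G)
    (u : V -> W) : continuous u -> flat c f g -> flat c (f \o u) (g \o u).
Proof. by move=> cu fg v; exact: cu (fg (u v)). Qed.

Lemma flat_cst (W : topologicalType) X c x (h : G) :
  local_cocycle X c -> X x -> flat c (fun _ : W => x) (fun _ => h).
Proof. by move=> cc Xx w; apply: nearW => w'; rewrite (local_cocycle1 cc Xx) mulg1. Qed.

Variable R : realType.
Local Notation I := (unit_interval R).

(** Near each time both sections are multiplied on the right by the same cocycle value, so the set
    where they agree is open and closed. *)
Lemma flat_unique c (f : I -> T) g g' t0 :
  flat c f g -> flat c f g' -> g t0 = g' t0 -> g = g'.
Proof.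
move=> fg fg' g0; apply/funext.
apply: (@unit_interval_clopen _ [set t | g t = g' t] t0) => // t.
near=> t'; rewrite /=.
have -> : g t' = (g t * c (f t) (f t'))%g by near: t'; exact: fg.
have -> : g' t' = (g' t * c (f t) (f t'))%g by near: t'; exact: fg'.
by split=> [/mulIg|->].
Unshelve. all: by end_near. Qed.

Lemma flat_const X c (f : I -> T) g x : local_cocycle X c -> X x ->
  (forall t, f t = x) -> flat c f g -> forall t, g t = g zero.
Proof.
move=> cc Xx fE fg t.
have -> : g = fun _ => g zero; last by [].
apply: (@flat_unique c f _ _ zero) => //.
have -> : f = fun _ => x by exact/funext.
exact: flat_cst cc Xx.
Qed.

(** * Homotopy lifting *)

Section Lifting.
Variables (X : set T) (c : T -> T -> G) (W : topologicalType).
Variables (F : W * I -> T) (g0 : W -> G).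
Hypotheses (cc : local_cocycle X c) (cF : continuous F).
Hypotheses (FX : forall z, X (F z)) (fg0 : flat c (fun w => F (w, zero)) g0).

Definition flat_upto (N : set W) (r : R) (g : W * I -> G) : Prop :=
  (forall w, N w -> g (w, zero) = g0 w) /\
  forall z, N z.1 -> ival z.2 <= r ->
    \forall z' \near z, ival z'.2 <= r -> g z' = (g z * c (F z) (F z'))%g.

(** Near [(w, t)] the function [s], made of cocycle values from the single point [F (w, t)], is
    itself a flat section, and a section known up to time [t1] is continued by a left multiple of
    it. As [t1] and [t2] can be exchanged, the set of times that can be reached is open and
    closed. *)
Lemma flat_upto_extend (w : W) (t : I) :
  exists e : R, 0 < e /\ forall t1 t2 : I,
    `|ival t1 - ival t| < e -> `|ival t2 - ival t| < e ->
    (exists N g, nbhs w N /\ flat_upto N (ival t1) g) ->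
    exists N g, nbhs w N /\ flat_upto N (ival t2) g.
Proof.
have := cF (cc (FX (w, t))) => /= -[[N0 J] [/= N0w Jt] NJ].
have [e e0 eJ] := near_unit_interval Jt.
exists e; split=> // t1 t2 t1e t2e [N [g [Nw [gi gf]]]].
have [t21|t12] := leP (ival t2) (ival t1).
  exists N, g; split=> //; split=> // z Nz zt2.
  have := gf z Nz (le_trans zt2 t21); apply: filterS => z' + z't2; apply.
  exact: le_trans t21.
pose s z := c (F (w, t)) (F z).
have sf z : N0 z.1 -> `|ival z.2 - ival t| < e ->
    \forall z' \near z, s z' = (s z * c (F z) (F z'))%g.
  move=> Nz ze; have NJz := NJ z (conj Nz (eJ _ ze)).
  exact: cF NJz.
(* The left factor matching [s] with [g] at time [t1]; it is locally constant because both change by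
   the same cocycle value. *)
pose h w' := (g (w', t1) * (s (w', t1))^-1)%g.
exists (N `&` N0), (fun z => if ival z.2 <= ival t1 then g z else h z.1 * s z)%g.
split; first exact: filterI.
split=> [w' [Nw' _]|]; first by rewrite /= ival0 ival_ge0 gi.
move=> [w' t'] /= [Nw' N0w'] t't2.
have ht1 : \forall w'' \near w', h w'' = h w'.
  have c1 := @pairl_continuous W I t1.
  have := near_cts c1 (gf (w', t1) Nw' (lexx _)).
  have := near_cts c1 (sf (w', t1) N0w' t1e).
  apply: filterS2 => w'' /= sE /(_ (lexx _)) gE.
  by rewrite /h gE sE invgM mulgA mulgK.
have ht1' : \forall z \near (w', t'), h z.1 = h w'.
  exact: (near_cts (w := (w', t')) (@fst_cts W I) ht1).
have ct : continuous (fun z : W * I => ival z.2).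
  exact: (continuous_o (@snd_cts W I) (@ival_continuous R)).
have [tt1|t1t|tt1] := ltgtP (ival t') (ival t1).
- have lt1 : \forall z \near (w', t'), ival z.2 <= ival t1.
    apply: (near_cts (P := [set r | r <= ival t1]) ct).
    by apply: filterS (lt_nbhsl tt1) => r; exact: ltW.
  have := gf (w', t') Nw' (ltW tt1).
  by move: lt1; apply: filterS2 => z' lt1 + z't2; rewrite lt1; exact.
- have te : `|ival t' - ival t| < e.
    move: t1e t2e; rewrite !ltr_norml => /andP[? ?] /andP[? ?].
    by apply/andP; split; lra.
  have lt1 : \forall z \near (w', t'), ival t1 < ival z.2.
    by apply: (near_cts (P := [set r | ival t1 < r]) ct); exact: lt_nbhsr.
  have := sf (w', t') N0w' te; move: ht1'; move: lt1.
  apply: filterS3 => z' lt1 hE sE _; rewrite leNgt lt1 /=.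
  by rewrite hE sE mulgA.
- have E : t' = t1 by exact: ival_inj.
  subst t'; have := sf (w', t1) N0w' t1e; have := gf (w', t1) Nw' (lexx _).
  move: ht1'; apply: filterS3 => z' hE gE sE _.
  case: ifPn => [/gE -> //|_].
  by rewrite hE sE /h !mulgA mulgVK.
Unshelve. all: by end_near. Qed.

Lemma lift_exists : exists g : W * I -> G,
  flat c F g /\ forall w, g (w, zero) = g0 w.
Proof.
have upto1 (w : W) : exists N g, nbhs w N /\ flat_upto N 1 g.
  rewrite -(ival1 R).
  pose S := [set t : I | exists N g, nbhs w N /\ flat_upto N (ival t) g].
  apply: (@unit_interval_clopen _ S zero) => [|t].
    exists setT, (g0 \o fst); split; first exact: filterT.
    split=> // -[w' t'] _ /=; rewrite ival0 => t'0.
    have -> : t' = zero by apply: ival_inj; apply/eqP; rewrite ival0 eq_le t'0 ival_ge0.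
    have := near_cts (w := (w', zero)) (@fst_cts W I) (fg0 w').
    apply: filterS => -[w'' t''] /= -> t''0.
    have -> // : t'' = zero by apply: ival_inj; apply/eqP; rewrite ival0 eq_le t''0 ival_ge0.
  have [e [e0 He]] := flat_upto_extend w t.
  near=> t'.
  have te : `|ival t' - ival t| < e by near: t'; exact: near_ival.
  by split; apply: He; rewrite // subrr normr0.
have /choice [Ng] : forall w : W, exists p : set W * (W * I -> G),
    nbhs w p.1 /\ flat_upto p.1 1 p.2.
  by move=> w; have [N [g H]] := upto1 w; exists (N, g).
(* Each point is evaluated in the local lift chosen for its own [w]; lifts chosen for nearby points
   agree on common slices by uniqueness, so the result is flat. *)
move=> NgP; exists (fun z => (Ng z.1).2 z); split; last first.
  by move=> w; have [/nbhs_singleton Nw [-> //]] := NgP w.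
have slice w w' : (Ng w).1 w' ->
    flat c (fun t => F (w', t)) (fun t => (Ng w).2 (w', t)).
  move=> Nw' t; have [_ [_]] := NgP w; move=> /(_ (w', t) Nw' (ival_le1 _)).
  by move/(near_cts (@pairr_continuous W I w')); apply: filterS => t' /= -> //; exact: ival_le1.
have same w w' t : (Ng w).1 w' -> (Ng w').2 (w', t) = (Ng w).2 (w', t).
  move=> Nw'; have [/nbhs_singleton Nww [gi _]] := NgP w'.
  have [_ [gi' _]] := NgP w.
  apply: (congr1 (fun h => h t) (flat_unique (t0 := zero) (slice _ _ Nww) (slice _ _ Nw') _)).
  by rewrite gi // gi'.
move=> [w t].
have [Nw [_]] := NgP w.
move=> /(_ (w, t) (nbhs_singleton Nw) (ival_le1 _)).
have : \forall z \near (w, t), (Ng w).1 z.1.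
  exact: (near_cts (w := (w, t)) (@fst_cts W I) Nw).
apply: filterS2 => -[w' t'] /= /same sameE.
by rewrite -sameE; apply; exact: ival_le1.
Unshelve. all: by end_near. Qed.

End Lifting.

End FlatSections.

(** * Entrywise topology and contractible sources *)

Lemma mx_coord_continuous (T : topologicalType) m n i j :
  continuous (fun M : 'M[T]_(m, n) => M i j).
Proof.
move=> M B nB.
exists (fun i' j' => if (i' == i) && (j' == j) then B else setT) => [i' j'|N].
  by case: ifPn => [/andP[/eqP -> /eqP ->] //|_]; exact: filterT.
by move=> /(_ i j); rewrite !eqxx.
Qed.

Lemma mx_continuous (Z T : topologicalType) m n (f : Z -> 'M[T]_(m, n)) :
  (forall i j, continuous (fun z => f z i j)) -> continuous f.
Proof.
move=> cf z A [P fP PA].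
have : \forall z' \near z, forall ij : 'I_m * 'I_n, P ij.1 ij.2 (f z' ij.1 ij.2).
  by apply: filter_forall => -[i j] /=; exact: cf (fP i j).
by apply: filterS => z' Pz'; apply: PA => i j; exact: (Pz' (i, j)).
Qed.

Lemma set_type_continuous (Z T : topologicalType) (X : set T) (h : Z -> T)
    (hX : forall z, X (h z)) : continuous h ->
  continuous (fun z => @exist _ (fun x => x \in X) (h z) (mem_set (hX z)) : X).
Proof.
move=> ch; apply: (@continuous_comp_initial _ _ _ (set_val : X -> T)).
by rewrite set_valE.
Qed.

Lemma set_valX (T : Type) (X : set T) (x : X) : X (set_val x).
Proof. by rewrite set_valE; exact: set_mem (valP x). Qed.

Section Contractible.
Variable R : realType.
Local Notation I := (unit_interval R).

HB.instance Definition _ := isPointed.Build I zero.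

Definition contractible (W : topologicalType) : Prop :=
  exists (w0 : W) (K : W * I -> W), [/\ continuous K,
    forall w, K (w, zero) = w0 & forall w, K (w, one) = w].

Definition imul (t s : I) : I := clamp (ival t * ival s).

Lemma ival_imul t s : ival (imul t s) = ival t * ival s.
Proof.
have := ival_ge0 t; have := ival_le1 t; have := ival_ge0 s; have := ival_le1 s.
by move=> *; rewrite clampE; nra.
Qed.

Lemma imul0 t : imul t zero = zero.
Proof. by apply: ival_inj; rewrite ival_imul ival0 mulr0. Qed.
Lemma imul1 t : imul t one = t.
Proof. by apply: ival_inj; rewrite ival_imul ival1 mulr1. Qed.

Lemma imul_continuous (Z : topologicalType) (u v : Z -> I) :
  continuous u -> continuous v -> continuous (fun z => imul (u z) (v z)).
Proof.
move=> cu cv; apply: (@continuous_o _ _ _ (fun z => ival (u z) * ival (v z))).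
  move=> z; apply: cvgM; [exact: (continuous_o cu (@ival_continuous R))|].
  exact: (continuous_o cv (@ival_continuous R)).
exact: clamp_continuous.
Qed.

Lemma unit_interval_contractible : contractible I.
Proof.
exists zero, (fun z => imul z.1 z.2); split.
- by apply: imul_continuous; [exact: fst_cts|exact: snd_cts].
- exact: imul0.
- exact: imul1.
Qed.

Lemma cube_contractible n : contractible 'rV[I]_n.
Proof.
exists (const_mx zero), (fun z : 'rV[I]_n * I => \row_i imul (z.1 0 i) z.2); split.
- apply: mx_continuous => i j.
  under [X in continuous X]eq_fun do rewrite mxE.
  apply: imul_continuous; last exact: snd_cts.
  exact: (continuous_o (@fst_cts _ _) (@mx_coord_continuous _ _ _ 0 j)).
- by move=> w; apply/rowP => i; rewrite !mxE imul0.
- by move=> w; apply/rowP => i; rewrite !mxE imul1.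
Qed.

Lemma cube_compact n : compact [set: 'rV[I]_n].
Proof.
have := @rV_compact I n (fun _ => setT) (fun _ => @unit_interval_compact R).
by congr compact; apply/seteqP; split.
Qed.

End Contractible.

(** * Aspherical cocycles and Eilenberg-MacLane spaces *)

Section Aspherical.
Variables (R : realType) (T : topologicalType) (X : set T) (G : groupType).
Local Notation I := (unit_interval R).

(** Applied to the interval with its end points, for the injectivity of the monodromy, and to a cube
    with its boundary, for the higher homotopy groups. *)
Definition null_lifts (c : T -> T -> G) : Prop :=
  forall (W : topologicalType) (A : set W) (f : W -> T) (g : W -> G) x0 g0,
    compact [set: W] -> contractible R W -> A !=set0 -> continuous f ->
    (forall w, X (f w)) -> flat c f g ->
    (forall a, A a -> f a = x0 /\ g a = g0) ->
    exists H : W * I -> T, [/\ continuous H, forall z, X (H z),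
      forall w, H (w, zero) = f w, forall w, H (w, one) = x0 &
      forall a t, A a -> H (a, t) = x0].

Definition lifted_path (c : T -> T -> G) (x y : T) (g : G) : Prop :=
  exists (p : I -> T) (s : I -> G),
    [/\ continuous p, forall t, X (p t), flat c p s &
        [/\ p zero = x, p one = y, s zero = 1%g & s one = g]].

Definition transitive_lifts (c : T -> T -> G) : Prop :=
  forall x y g, X x -> X y -> lifted_path c x y g.

(* The last two conditions say that the covering space of [X] defined by [c],  *)
(* whose points are the pairs (x, g), is weakly contractible.                  *)
Definition aspherical : Prop := exists c,
  [/\ local_cocycle X c, null_lifts c & transitive_lifts c].

End Aspherical.

Section FlatExists.
Variables (R : realType) (T : topologicalType) (X : set T) (G : groupType).
Local Notation I := (unit_interval R).
Variables (c : T -> T -> G).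
Hypothesis cc : local_cocycle X c.
Local Notation lifted_path := (@lifted_path R T X G c).

(** The homotopy [f \o K] starts at a constant map, which has a constant section. Its lift at time
    one is a section over [f], and a left translation adjusts the value at [w1]. *)
Lemma flat_exists (W : topologicalType) (f : W -> T) (w1 : W) (h : G) :
  contractible R W -> continuous f -> (forall w, X (f w)) ->
  exists g, flat c f g /\ g w1 = h.
Proof.
move=> [w0 [K [cK K0 K1]]] cf fX.
have [||//|g [gf _]] := @lift_exists _ _ R X c W (f \o K) (fun _ => 1%g) cc.
- exact: continuous_o.
- by move=> z; exact: fX.
- have -> : (fun w => (f \o K) (w, zero)) = fun _ => f w0.
    by apply/funext => w /=; rewrite K0.
  exact: flat_cst cc (fX w0).
exists (fun w => (h * (g (w1, one))^-1 * g (w, one))%g); split; last first.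
  by rewrite mulgVK.
apply: flat_mull.
have -> : f = (f \o K) \o (fun w => (w, one)) by apply/funext => w /=; rewrite K1.
exact: (flat_comp (@pairl_continuous _ _ _) gf).
Qed.

(** Translated on the left by [s one], the section over [q] continues the section over [p]. Cocycle
    values multiply on the right, so the factors appear in the order of travel and the monodromy is
    a homomorphism. *)
Lemma flat_path_cat (p q : I -> T) (s s' l : I -> G) :
  flat c p s -> flat c q s' -> p one = q zero -> flat c (path_cat_fun p q) l ->
  s zero = 1%g -> s' zero = 1%g -> l zero = 1%g -> l one = (s one * s' one)%g.
Proof.
move=> fs fs' pq fl s0 s'0 l0.
pose u (t : I) : I := clamp (2^-1 * ival t + 0).
pose v (t : I) : I := clamp (2^-1 * ival t + 2^-1).
have cu : continuous u by apply: affine_cts => ?; exact: cvg_id.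
have cv : continuous v by apply: affine_cts => ?; exact: cvg_id.
have u1v0 : u one = v zero by rewrite /u /v ival0 ival1; congr clamp; lra.
have uE t : ival (u t) = 2^-1 * ival t.
  by have := ival_ge0 t; have := ival_le1 t => *; rewrite clampE; lra.
have vE t : ival (v t) = 2^-1 * ival t + 2^-1.
  by have := ival_ge0 t; have := ival_le1 t => *; rewrite clampE; lra.
have -> : s = l \o u.
  apply: (flat_unique (t0 := zero) fs); last first.
    by rewrite s0 /= -l0; congr l; apply: ival_inj; rewrite uE ival0 mulr0.
  have -> : p = path_cat_fun p q \o u.
    apply/funext => t /=; rewrite /path_cat_fun uE ifT; last first.
      by have := ival_le1 t; lra.
    by rewrite -[in LHS](clampK t); congr (p (clamp _)); lra.
  exact: flat_comp.
have -> : s' = fun t => ((l (v zero))^-1 * l (v t))%g.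
  apply: (flat_unique (t0 := zero) fs'); last by rewrite s'0 mulVg.
  apply: flat_mull.
  have -> : q = path_cat_fun p q \o v.
    apply/funext => t /=; rewrite /path_cat_fun vE; case: ifPn => [t2|_].
      have -> : t = zero.
        by apply: ival_inj; apply/eqP; rewrite ival0 eq_le ival_ge0; lra.
      by rewrite -pq ival0 clamp1 //; lra.
    by rewrite -[in LHS](clampK t); congr (q (clamp _)); lra.
  exact: flat_comp.
rewrite /= u1v0 mulgA mulgV mul1g; congr l.
by apply: ival_inj; rewrite vE ival1; lra.
Qed.

Lemma lifted_path_trans x y z g h :
  lifted_path x y g -> lifted_path y z h -> lifted_path x z (g * h)%g.
Proof.
move=> [p [s [cp pX fs [p0 p1 s0 s1]]]] [q [s' [cq qX fs' [q0 q1 s'0 s'1]]]].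
have pq : p one = q zero by rewrite p1 q0.
have cpq := path_cat_continuous cp cq pq.
have pqX t : X (path_cat_fun p q t) by rewrite /path_cat_fun; case: ifP.
have [l [fl l0]] := flat_exists zero 1%g (@unit_interval_contractible R) cpq pqX.
exists (path_cat_fun p q), l; split=> //; split=> //.
- by rewrite path_cat_zero.
- by rewrite path_cat_one.
- by rewrite (flat_path_cat fs fs' pq fl) // s1 s'1.
Qed.

Lemma lifted_path_sym x y g : lifted_path x y g -> lifted_path y x g^-1%g.
Proof.
move=> [p [s [cp pX fs [p0 p1 s0 s1]]]].
pose r (t : I) : I := clamp (-1 * ival t + 1).
have cr : continuous r by apply: affine_cts => ?; exact: cvg_id.
have r0 : r zero = one by rewrite /r ival0 clamp1 //; lra.
have r1 : r one = zero by rewrite /r ival1 clamp0 //; lra.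
exists (p \o r), (fun t => (g^-1 * s (r t))%g); split.
- exact: continuous_o.
- by move=> t; exact: pX.
- exact/flat_mull/flat_comp.
- by rewrite /= r0 r1 p0 p1 s0 s1 mulVg mulg1.
Qed.

Lemma lifted_path_exists x y (p : I -> T) : continuous p -> (forall t, X (p t)) ->
  p zero = x -> p one = y -> exists g, lifted_path x y g.
Proof.
move=> cp pX p0 p1.
have [l [fl l0]] := flat_exists zero 1%g (@unit_interval_contractible R) cp pX.
by exists (l one), p, l.
Qed.

Lemma lifted_path_base b : (forall x, X x -> exists g, lifted_path x b g) ->
  (forall g, lifted_path b b g) -> transitive_lifts R X c.
Proof.
move=> xb bb x y g /xb[h xbh] /xb[k ybk].
have := lifted_path_trans xbh (lifted_path_trans (bb (h^-1 * g * k)%g)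
  (lifted_path_sym ybk)).
by rewrite !mulgA mulgV mul1g mulgK.
Qed.

End FlatExists.

(** * Homotopy groups computed from an aspherical cocycle *)

Section EilenbergMacLane.
Variables (R : realType) (T : topologicalType) (X : set T) (G : groupType).
Local Notation I := (unit_interval R).
Local Notation XT := (set_type X).
Variable c : T -> T -> G.
Hypotheses (cc : local_cocycle X c) (nc : null_lifts R X c).
Hypothesis tc : transitive_lifts R X c.

Lemma set_val_continuous : continuous (set_val : XT -> T).
Proof. exact: initial_continuous. Qed.

Lemma null_lifts_set_type (W : topologicalType) (A : set W) (f : W -> XT)
    (g : W -> G) (x0 : XT) g0 :
  compact [set: W] -> contractible R W -> A !=set0 -> continuous f ->
  flat c (set_val \o f) g -> (forall a, A a -> f a = x0 /\ g a = g0) ->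
  homotopic_rel R A f (cst x0).
Proof.
move=> kW tW A0 cf fg fA.
have [||a Aa|H [cH HX H0 H1 HA]] :=
    nc (f := set_val \o f) (x0 := set_val x0) (g0 := g0) kW tW A0 _ _ fg.
- exact: (continuous_o cf set_val_continuous).
- by move=> w; exact: set_valX.
- by have [/= -> ->] := fA a Aa.
exists (fun z => @exist _ (fun x => x \in X) (H z) (mem_set (HX z)) : XT).
split; first exact: set_type_continuous.
- by move=> w; apply: val_inj; rewrite /= H0 /= set_valE.
- by move=> w; apply: val_inj; rewrite /= H1 /= set_valE.
- by move=> a t Aa; apply: val_inj; rewrite /= HA // (fA a Aa).1 set_valE.
Qed.

Section BasePoint.
Variable x0 : XT.
Local Notation loop := (loop R x0).
Implicit Types p q : loop.

Lemma loop_lift p : exists g, flat c (set_val \o p) g /\ g zero = 1%g.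
Proof.
apply: (flat_exists cc _ _ (@unit_interval_contractible R)) => [|t].
  exact: (continuous_o (@loop_continuous _ _ _ p) set_val_continuous).
exact: set_valX.
Qed.

Definition monodromy p : G := sval (cid (loop_lift p)) one.

Lemma monodromyE p g : flat c (set_val \o p) g -> g zero = 1%g ->
  g one = monodromy p.
Proof.
rewrite /monodromy; case: cid => g' /= [fg' g'0] fg g0.
by rewrite (flat_unique (t0 := zero) fg fg') // g0 g'0.
Qed.

Lemma monodromy_homotopic p q : path_homotopic p q -> monodromy p = monodromy q.
Proof.
case=> H [cH H0 H1 HA].
have [g [fg g0]] := loop_lift p.
have cF : continuous (set_val \o H) := continuous_o cH set_val_continuous.
have [||k [fk k0]] := @lift_exists _ _ R X c I (set_val \o H) g cc cF.
- by move=> z; exact: set_valX.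
- by have -> : (fun w => (set_val \o H) (w, zero)) = set_val \o p;
    [apply/funext => w /=; rewrite H0|].
have slice t : p t = x0 -> (t = zero \/ t = one) ->
    forall s, k (t, s) = k (t, zero).
  move=> pt At.
  apply: (@flat_const _ _ R X c (fun s => set_val (H (t, s))) _ (set_val x0) cc).
  - exact: set_valX.
  - by move=> s; rewrite HA // pt.
  - exact: (flat_comp (@pairr_continuous _ _ t) fk).
rewrite -(monodromyE fg g0) -k0 -(slice one _ _ one); [|exact: path_one|by right].
apply: (@monodromyE q (fun t => k (t, one))); last first.
  by rewrite slice ?k0 //; [exact: path_zero|left].
have -> : set_val \o q = (set_val \o H) \o (fun t => (t, one)).
  by apply/funext => t /=; rewrite H1.
exact: (flat_comp (@pairl_continuous _ _ _) fk).
Qed.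

Lemma monodromy_cat p q : monodromy (loop_cat p q) = (monodromy p * monodromy q)%g.
Proof.
have [g [fg g0]] := loop_lift (loop_cat p q); rewrite -(monodromyE fg g0).
have [gp [fgp gp0]] := loop_lift p; rewrite -(monodromyE fgp gp0).
have [gq [fgq gq0]] := loop_lift q; rewrite -(monodromyE fgq gq0).
apply: flat_path_cat fgp fgq _ _ gp0 gq0 g0.
  by rewrite [LHS]/= [RHS]/= path_one path_zero.
have -> // : path_cat_fun (set_val \o p) (set_val \o q) = set_val \o loop_cat p q.
by apply/funext => t; rewrite /= /loop_cat /mk_path /path_cat_fun; case: ifP.
Qed.

Lemma pi1_aspherical : isomorphic_groups (pi1 R x0) G.
Proof.
pose Phi (a : pi1 R x0) : G := monodromy (repr a).
have PhiE p : Phi (\pi_(pi1 R x0) p) = monodromy p.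
  by apply: monodromy_homotopic; exact: repr_loop.
have PhiM : {morph Phi : x y / (x * y)%g}.
  elim/pi1_ind=> p; elim/pi1_ind=> q.
  have -> : (\pi_(pi1 R x0) p * \pi_(pi1 R x0) q)%g = \pi_(pi1 R x0) (loop_cat p q).
    exact: pi1_mul_pi.
  by rewrite !PhiE monodromy_cat.
have Phi1 : Phi 1%g = 1%g by apply: (mulgI (Phi 1%g)); rewrite -PhiM !mulg1.
have PhiV x : Phi x^-1%g = (Phi x)^-1%g.
  by apply: (mulgI (Phi x)); rewrite -PhiM !mulgV.
(* A loop with trivial monodromy has a section with value 1 at both end points, so [null_lifts]
   applies relative to them; surjectivity will come from [transitive_lifts]. *)
have ker x : Phi x = 1%g -> x = 1%g.
  elim/pi1_ind: x => p; rewrite PhiE => p1.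
  apply/pi1P.
  have [g [fg g0]] := loop_lift p.
  apply: (@null_lifts_set_type _ [set zero; one] p g x0 1%g) => //.
  - exact: unit_interval_compact.
  - exact: unit_interval_contractible.
  - by exists zero; left.
  - exact: loop_continuous.
  - move=> t; case=> ->; first by rewrite path_zero.
    by rewrite path_one (monodromyE fg g0).
exists Phi => //.
have /choice[Psi PsiK] : forall g, exists a, Phi a = g.
  move=> g; have [p [s [cp pX fs [p0 p1 s0 s1]]]] := tc g (set_valX x0) (set_valX x0).
  pose p' t : XT := @exist _ (fun x => x \in X) (p t) (mem_set (pX t)).
  have cp' : continuous p' by exact: set_type_continuous.
  have p'0 : p' zero = x0 by apply: val_inj; rewrite /= p0 set_valE.
  have p'1 : p' one = x0 by apply: val_inj; rewrite /= p1 set_valE.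
  exists (\pi_(pi1 R x0) (mk_path cp' p'0 p'1 : loop)); rewrite PhiE -s1.
  by apply/esym/monodromyE => //; rewrite set_valE.
exists Psi => // a; have := PsiK (Phi a) => /eqP.
rewrite -[X in _ == X]mulg1 -[X in X == _](mulVKg (Phi a)) (inj_eq (mulgI _)).
by rewrite -PhiV -PhiM => /eqP/ker /(congr1 (fun z => a * z)%g); rewrite mulVKg mulg1.
Qed.

(** From dimension two on, the boundary of the cube is path connected, so a section is constant on
    it and [null_lifts] applies relative to the boundary. *)
Lemma higher_pi_aspherical n : (2 <= n)%N -> trivial_pi R n x0.
Proof.
case: n => [//|[//|n _]] f cf fb.
have cf' : continuous (set_val \o f) := continuous_o cf set_val_continuous.
have [|g [fg g0]] :=
    flat_exists cc (const_mx zero) 1%g (@cube_contractible R n.+2) cf'.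
  by move=> w; exact: set_valX.
have seg (u : I -> 'rV[I]_n.+2) : continuous u ->
    (forall t, cube_boundary (u t)) -> g (u one) = g (u zero).
  move=> cu ub.
  apply: (@flat_const _ _ R X c (fun t => set_val (f (u t)))
    (g \o u) (set_val x0) cc).
  - exact: set_valX.
  - by move=> t; rewrite fb.
  - exact: (flat_comp cu fg).
apply: (@null_lifts_set_type _ _ f g x0 1%g) => //.
- exact: cube_compact.
- exact: cube_contractible.
- by exists (const_mx zero), 0; left; rewrite mxE.
move=> a [i ai]; split; first by apply: fb; exists i.
pose u (j0 : pred 'I_n.+2) (b : 'rV[I]_n.+2) (t : I) : 'rV[I]_n.+2 :=
  \row_j (if j0 j then imul (b 0 j) t else b 0 j).
have cu j0 b : continuous (u j0 b).
  apply: mx_continuous => k j.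
  under [X in continuous X]eq_fun do rewrite mxE.
  case: (j0 j); last exact: cst_continuous.
  apply: (@imul_continuous R I (fun _ => b 0 j) id); first exact: cst_continuous.
  by move=> ?; exact: cvg_id.
have u1 j0 b : u j0 b one = b.
  by apply/rowP => j; rewrite mxE; case: ifP; rewrite ?imul1.
have [k ki] : exists k : 'I_n.+2, k != i.
  have [->|i0] := eqVneq i ord0; first by exists ord_max.
  by exists ord0; rewrite eq_sym.
(* All coordinates except the [i]-th are shrunk to zero inside the face containing [a]. The [k]-th
   coordinate is then zero, and the [i]-th one can be shrunk inside the face of [k]. *)
rewrite -(u1 (fun j => j != i) a) seg //; last first.
  by move=> t; exists i; rewrite mxE eqxx.
rewrite -(u1 (fun j => j == i) (u _ a zero)) seg //; last first.
  by move=> t; exists k; left; rewrite !mxE (negbTE ki) /= imul0.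
rewrite -g0; congr g; apply/rowP => j; rewrite !mxE.
by case: eqP => /=; rewrite imul0.
Qed.

End BasePoint.

End EilenbergMacLane.

Theorem aspherical_K1 (R : realType) (T : topologicalType) (X : set T)
    (G : groupType) :
  X !=set0 -> aspherical R X G -> K1_space R X G.
Proof.
move=> [x Xx] [c [cc nc tc]]; split.
- by constructor; exists x; exact: mem_set.
- move=> x0 y0.
  have [p [s [cp pX _ [p0 p1 _ _]]]] := tc _ _ 1%g (set_valX x0) (set_valX y0).
  pose p' t : X := @exist _ (fun x => x \in X) (p t) (mem_set (pX t)).
  have cp' : continuous p' by exact: set_type_continuous.
  have p'0 : p' zero = x0 by apply: val_inj; rewrite /= p0 set_valE.
  have p'1 : p' one = y0 by apply: val_inj; rewrite /= p1 set_valE.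
  by constructor; exact: (mk_path cp' p'0 p'1).
- move=> x0; split; first exact: pi1_aspherical cc nc tc x0.
  by move=> n; exact: higher_pi_aspherical cc nc _ _.
Qed.

(** * Topology of the complex plane *)

Section ComplexTopology.
Variable R : realType.
Local Notation C := R[i].

Lemma normc_real (a : R) : `|a%:C| = `|a|%:C.
Proof. by rewrite normc_def /= expr0n /= addr0 sqrtr_sqr. Qed.

Lemma norm_Im_le (z : C) : `|Im z|%:C <= `|z|.
Proof.
rewrite normc_def lecR -sqrtr_sqr ler_sqrt ?lerDr ?sqr_ge0 //.
by rewrite addr_ge0 ?sqr_ge0.
Qed.

Lemma normc_i (a : R) : `|0 +i* a| = `|a|%:C.
Proof. by rewrite normc_def /= expr0n /= add0r sqrtr_sqr. Qed.

Lemma Re_continuous : continuous (fun z : C => Re z).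
Proof.
move=> z; have FF := nbhs_filter z; apply/cvgrPdist_lt => e e0.
apply/nbhs_ballP; exists e%:C => [|w]; first by rewrite /= ltcR.
rewrite /ball /= => zw; rewrite -ltcR.
apply: le_lt_trans zw; case: z FF w => [a b] _ [a' b']; exact: (normc_ge_Re (_ +i* _)).
Qed.

Lemma Im_continuous : continuous (fun z : C => Im z).
Proof.
move=> z; have FF := nbhs_filter z; apply/cvgrPdist_lt => e e0.
apply/nbhs_ballP; exists e%:C => [|w]; first by rewrite /= ltcR.
rewrite /ball /= => zw; rewrite -ltcR.
apply: le_lt_trans zw; case: z FF w => [a b] _ [a' b']; exact: (norm_Im_le (_ +i* _)).
Qed.

Lemma complex_continuous (Z : topologicalType) (u v : Z -> R) (z : Z) :
  continuous_at z u -> continuous_at z v ->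
  continuous_at z (fun z => u z +i* v z : C).
Proof.
move=> cu cv; apply/cvgrPdist_lt => e.
rewrite ltcE /= => /andP[/eqP e0 e1].
have -> : e = (Re e)%:C by move: e0; clear; case: e => a b /= ->.
move: (Re e) e1 => d d0.
have d2 : 0 < d / 2 by rewrite divr_gt0.
move/cvgrPdist_lt/(_ _ d2): cu; move/cvgrPdist_lt/(_ _ d2): cv.
apply: filterS2 => w vw uw.
have -> : (u z +i* v z) - (u w +i* v w) = (u z - u w)%:C + (0 +i* (v z - v w)) :> C.
  by apply/eqP; rewrite eq_complex /= addr0 add0r !eqxx.
apply: le_lt_trans (ler_normD _ _) _.
by rewrite normc_i normc_real -rmorphD ltcR; lra.
Qed.

End ComplexTopology.

Section ComplexContinuity.
Variables (R : realType) (Z : topologicalType).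
Local Notation C := R[i].
Implicit Types (u v : Z -> C) (z : Z).

Lemma complexD_continuous u v z : continuous_at z u -> continuous_at z v ->
  continuous_at z (fun z => u z + v z).
Proof. by move=> cu cv; exact: (@cvgD C C Z (nbhs z) (nbhs_filter z) u v _ _ cu cv). Qed.

Lemma complexB_continuous u v z : continuous_at z u -> continuous_at z v ->
  continuous_at z (fun z => u z - v z).
Proof. by move=> cu cv; exact: (@cvgB C C Z (nbhs z) (nbhs_filter z) u v _ _ cu cv). Qed.

Lemma complexM_continuous u v z : continuous_at z u -> continuous_at z v ->
  continuous_at z (fun z => u z * v z).
Proof. by move=> cu cv; exact: (@cvgM C Z (nbhs z) (nbhs_filter z) u v _ _ cu cv). Qed.

Lemma complexX_continuous u n z : continuous_at z u ->
  continuous_at z (fun z => u z ^+ n).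
Proof.
move=> cu; elim: n => [|n IH]; first exact: cvg_cst.
under [X in continuous_at _ X]eq_fun do rewrite exprS.
exact: complexM_continuous.
Qed.

Lemma complexV_continuous u z : u z != 0 -> continuous_at z u ->
  continuous_at z (fun z => (u z)^-1).
Proof. by move=> u0 cu; exact: (@cvgV C Z (nbhs z) (nbhs_filter z) u _ u0 cu). Qed.

End ComplexContinuity.

Lemma for_comp (W Z Y : topologicalType) (f : W -> Z) (g : Z -> Y) (w : W) :
  continuous_at w f -> continuous_at (f w) g ->
  continuous_at w (g \o f).
Proof. by move=> cf cg; exact: continuous_comp. Qed.

Lemma near_for (W Z : topologicalType) (f : W -> Z) (w : W) (P : set Z) :
  continuous_at w f -> (\forall z \near f w, P z) ->
  \forall w' \near w, P (f w').
Proof. by move=> cf; exact: cf. Qed.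

Lemma for_pair (W Z Y : topologicalType) (f : W -> Z) (g : W -> Y) (w : W) :
  continuous_at w f -> continuous_at w g ->
  continuous_at w (fun w => (f w, g w)).
Proof. by move=> cf cg; exact: cvg_pair. Qed.

(** * Homeomorphisms and products *)

Section Transfer.
Variable R : realType.
Local Notation C := R[i].
Local Notation I := (unit_interval R).

(** Continuity and inversion are asked at the points of [X] and [X'] only, because the inverse used
    for triangles is arbitrary elsewhere. Openness of [X] keeps the intermediate point of the
    cocycle relation in the domain of continuity of [h]. *)
Lemma aspherical_homeo (T T' : topologicalType) (X : set T) (X' : set T')
    (h : T -> T') (k : T' -> T) (G : groupType) : open X ->
  (forall x, X x -> [/\ continuous_at x h, X' (h x) & k (h x) = x]) ->
  (forall y, X' y -> [/\ continuous_at y k, X (k y) & h (k y) = y]) ->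
  aspherical R X' G -> aspherical R X G.
Proof.
move=> oX hX kX' [c [cc nc tc]].
have hc (W : topologicalType) (f : W -> T) : continuous f ->
    (forall w, X (f w)) -> continuous (h \o f).
  by move=> cf fX w; apply: for_comp; [exact: cf|have [] := hX _ (fX w)].
have kc (W : topologicalType) (f : W -> T') : continuous f ->
    (forall w, X' (f w)) -> continuous (k \o f).
  by move=> cf fX w; apply: for_comp; [exact: cf|have [] := kX' _ (fX w)].
exists (fun x x' => c (h x) (h x')); split.
- move=> x Xx; have [ch hx _] := hX x Xx.
  have := near_for ch (cc _ hx).
  have : \forall x' \near x, X x' by apply: open_nbhs_nbhs.
  apply: filterS2 => x' Xx'.
  by have [ch' _ _] := hX x' Xx'; exact: (near_for ch').
- move=> W A f g x0 g0 kW tW A0 cf fX fg fA.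
  have [|w|//|a Aa|H [cH HX H0 H1 HA]] :=
      nc W A (h \o f) g (h x0) g0 kW tW A0.
  + exact: hc.
  + by have [] := hX _ (fX w).
  + by rewrite /=; have [-> ->] := fA a Aa.
  have Xx0 : X x0 by have [a Aa] := A0; have [<- _] := fA a Aa; exact: fX.
  exists (k \o H); split.
  + exact: kc.
  + by move=> z; have [] := kX' _ (HX z).
  + by move=> w; rewrite /= H0 /=; have [] := hX _ (fX w).
  + by move=> w; rewrite /= H1 /=; have [] := hX _ Xx0.
  + by move=> a t Aa; rewrite /= HA //; have [] := hX _ Xx0.
- move=> x y g Xx Xy; have [_ hx kx] := hX _ Xx; have [_ hy ky] := hX _ Xy.
  have [p [s [cp pX fs [p0 p1 s0 s1]]]] := tc _ _ g hx hy.
  exists (k \o p), s; split.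
  + exact: kc.
  + by move=> t; have [] := kX' _ (pX t).
  + move=> t; apply: filterS (fs t) => t' ->.
    by have [_ _ /= ->] := kX' _ (pX t); have [_ _ ->] := kX' _ (pX t').
  + by rewrite /= p0 p1.
Qed.

Lemma aspherical_prod (T T' : topologicalType) (X : set T) (X' : set T')
    (G G' : groupType) :
  aspherical R X G -> aspherical R X' G' ->
  aspherical R (X `*` X') (G * G')%type.
Proof.
move=> [c [cc nc tc]] [c' [cc' nc' tc']].
exists (fun z z' => (c z.1 z'.1, c' z.2 z'.2)); split.
- move=> [x x'] [/= Xx Xx'].
  have := near_cts (w := (x, x')) (@snd_cts T T') (cc' _ Xx').
  have := near_cts (w := (x, x')) (@fst_cts T T') (cc _ Xx).
  apply: filterS2 => -[y y'] /=.
  move=> /(near_cts (w := (y, y')) (@fst_cts T T')) + /(near_cts (w := (y, y')) (@snd_cts T T')).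
  by apply: filterS2 => z -> ->.
- move=> W A f g x0 g0 kW tW A0 cf fX fg fA.
  have [||w|a Aa|H [cH HX H0 H1 HA]] :=
      nc W A (fst \o f) (fst \o g) x0.1 g0.1 kW tW A0.
  + exact: (continuous_o cf (@fst_cts _ _)).
  + by move=> w; have [] := fX w.
  + by apply: filterS (fg w) => w' /= ->.
  + by rewrite /=; have [-> ->] := fA a Aa.
  have [||w|a Aa|H' [cH' HX' H0' H1' HA']] :=
      nc' W A (snd \o f) (snd \o g) x0.2 g0.2 kW tW A0.
  + exact: (continuous_o cf (@snd_cts _ _)).
  + by move=> w; have [] := fX w.
  + by apply: filterS (fg w) => w' /= ->.
  + by rewrite /=; have [-> ->] := fA a Aa.
  exists (fun z => (H z, H' z)); split.
  + exact: continuous_to_pair.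
  + by move=> z; split; [exact: HX|exact: HX'].
  + by move=> w; rewrite H0 H0' /=; case: (f w).
  + by move=> w; rewrite H1 H1'; case: (x0).
  + by move=> a t Aa; rewrite HA // HA' //; case: (x0).
- move=> [x x'] [y y'] [g g'] [/= Xx Xx'] [/= Xy Xy'].
  have [p [s [cp pX fs [p0 p1 s0 s1]]]] := tc _ _ g Xx Xy.
  have [p' [s' [cp' pX' fs' [p0' p1' s0' s1']]]] := tc' _ _ g' Xx' Xy'.
  exists (fun t => (p t, p' t)), (fun t => (s t, s' t)); split.
  + exact: continuous_to_pair.
  + by move=> t; split; [exact: pX|exact: pX'].
  + by move=> t; move: (fs t) (fs' t); apply: filterS2 => t' /= -> ->.
  + by rewrite p0 p1 s0 s1 p0' p1' s0' s1'.
Qed.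

Lemma real_complex_continuous : continuous (fun a : R => a%:C).
Proof.
by move=> a; apply: complex_continuous; [exact: cvg_id|exact: cvg_cst].
Qed.

Lemma complex_affine_continuous (W : topologicalType) (u : W -> I) (f g : W -> C) :
  continuous u -> continuous f -> continuous g ->
  continuous (fun w => f w + (ival (u w))%:C * (g w - f w)).
Proof.
move=> cu cf cg w; apply: complexD_continuous; first exact: cf.
apply: complexM_continuous; last by apply: complexB_continuous; [exact: cg|exact: cf].
apply: (@for_comp _ _ _ (fun w => ival (u w)) (fun a : R => a%:C)).
  exact: (continuous_o cu (@ival_continuous R)).
exact: real_complex_continuous.
Qed.

Lemma aspherical_complex_prod (T : topologicalType) (X : set T) (G : groupType) :
  aspherical R X G -> aspherical R ([set: C] `*` X) G.
Proof.
move=> [c [cc nc tc]].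
exists (fun z z' => c z.2 z'.2); split.
- move=> [x x'] [/= _ Xx'].
  have := near_cts (w := (x, x')) (@snd_cts C T) (cc _ Xx').
  apply: filterS => -[y y'] /=.
  by move=> /(near_cts (w := (y, y')) (@snd_cts C T)); apply: filterS => z ->.
- move=> W A f g x0 g0 kW tW A0 cf fX fg fA.
  have [||//|a Aa|H [cH HX H0 H1 HA]] :=
      nc W A (snd \o f) g x0.2 g0 kW tW A0.
  + exact: (continuous_o cf (@snd_cts _ _)).
  + by move=> w; have [] := fX w.
  + by rewrite /=; have [-> ->] := fA a Aa.
  exists (fun z => ((f z.1).1 + (ival z.2)%:C * (x0.1 - (f z.1).1), H z)); split.
  + apply: continuous_to_pair => //.
    apply: complex_affine_continuous; first exact: snd_cts.
      exact: (continuous_o (@fst_cts W I) (continuous_o cf (@fst_cts C T))).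
    exact: cst_continuous.
  + by move=> z; split => //; exact: HX.
  + by move=> w; rewrite H0 ival0 /= mul0r addr0; case: (f w).
  + by move=> w; rewrite H1 ival1 /= mul1r addrC subrK; case: (x0).
  + move=> a t Aa; rewrite HA //= (fA a Aa).1 subrr mulr0 addr0; by case: (x0).
- move=> [x x'] [y y'] g [/= _ Xx'] [/= _ Xy'].
  have [p [s [cp pX fs [p0 p1 s0 s1]]]] := tc _ _ g Xx' Xy'.
  exists (fun t => (x + (ival t)%:C * (y - x), p t)), s; split => //.
  + apply: continuous_to_pair => //; apply: complex_affine_continuous.
    * by move=> ?; exact: cvg_id.
    * exact: cst_continuous.
    * exact: cst_continuous.
  + by move=> t; split => //; exact: pX.
  + by rewrite p0 p1 ival0 ival1 mul0r mul1r addr0 addrC subrK.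
Qed.

End Transfer.

(** * The tree of the free group *)

Section Toggle.
Variable K : eqType.
Implicit Types s : seq K.

Definition reduced s : bool := sorted (fun a b => a != b) s.

(* Reduced words are the vertices of a tree: [toggle k] crosses the edge of    *)
(* type [k], and the edge towards the root is given by the head of the word.   *)
Definition toggle k s : seq K :=
  if s is a :: s' then if a == k then s' else k :: s else [:: k].

Lemma toggle_reduced k s : reduced s -> reduced (toggle k s).
Proof.
case: s => [//|a s] rs /=; case: (eqVneq a k) => [_|ak].
  exact: path_sorted rs.
by rewrite /reduced /= eq_sym ak.
Qed.

Lemma toggleK k s : reduced s -> toggle k (toggle k s) = s.
Proof.
case: s => [|a s] rs /=; first by rewrite eqxx.
have [ak|ak] := eqVneq a k; last by rewrite /= eqxx.
by rewrite ak in rs *; case: s rs => [//|b s] /= /andP[kb _]; rewrite eq_sym (negbTE kb).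
Qed.

Lemma odd_size_toggle k s : odd (size (toggle k s)) = ~~ odd (size s).
Proof. by case: s => [//|a s] /=; case: ifP => _ //=; rewrite negbK. Qed.

End Toggle.

(** * Action of the free group on the vertices of the tree *)

Section FreeAction.
Variables (n : nat) (m : 'I_n.+1).
Local Notation K := 'I_n.+1.
Implicit Types (s : seq K) (g h : Free n).

(* The generator [j] crosses two edges, of types [m] and [lift m j].           *)
Definition act_letter s (a : letter 'I_n) : seq K :=
  let k := lift m a.1 in
  if (k < m)%N == a.2 then toggle m (toggle k s) else toggle k (toggle m s).

Definition act_word s (w : word 'I_n) := foldl act_letter s w.

Lemma act_letter_reduced s a : reduced s -> reduced (act_letter s a).
Proof. by move=> rs; rewrite /act_letter; case: ifP => _; do 2!apply: toggle_reduced. Qed.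

Lemma act_letterK s a : reduced s -> act_letter (act_letter s a) (letter_inv a) = s.
Proof.
case: a => j b rs; rewrite /act_letter /=.
by case: (_ < _)%N b => -[] /=; rewrite ?toggleK // ?toggle_reduced // toggleK.
Qed.

Lemma act_word_reduced s w : reduced s -> reduced (act_word s w).
Proof. by elim: w s => //= a w IH s rs; apply: IH; exact: act_letter_reduced. Qed.

Lemma act_word_eqv s u v : reduced s -> word_eqv u v -> act_word s u = act_word s v.
Proof.
move=> rs; elim=> {u v} // [u v a|u w v _ -> _ -> //].
by rewrite /act_word !foldl_cat /= act_letterK // act_word_reduced.
Qed.

(** Read from its end, a reduced word is a normal form in the free product of [n.+1] groups of order
    two, and [toggle k] is right multiplication by the [k]-th factor. A generator acts as a product
    of two factors, one of them the [m]-th. *)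
Definition act s g : seq K := act_word s (repr g).

Lemma act_pi s w : reduced s -> act s (\pi_(Free n) w) = act_word s w.
Proof. by move=> rs; apply: act_word_eqv => //; exact: repr_eqv. Qed.

Lemma act_reduced s g : reduced s -> reduced (act s g).
Proof. exact: act_word_reduced. Qed.

Lemma actM s g h : reduced s -> act s (g * h)%g = act (act s g) h.
Proof.
move: g h; elim/fg_ind=> u; elim/fg_ind=> v rs.
have -> : (\pi_(Free n) u * \pi_(Free n) v)%g = \pi_(Free n) (u ++ v).
  exact: fg_mul_pi.
by rewrite !act_pi // ?act_word_reduced // /act_word foldl_cat.
Qed.

Lemma act1 s : reduced s -> act s 1%g = s.
Proof. by move=> rs; have <- : \pi_(Free n) [::] = 1%g by []; rewrite act_pi. Qed.

Lemma odd_size_act s g : odd (size (act s g)) = odd (size s).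
Proof.
rewrite /act; elim: (repr g) s => //= a w IH s.
by rewrite IH /act_letter; case: ifP => _; rewrite !odd_size_toggle negbK.
Qed.

Definition edge_gen (k : K) : Free n :=
  if unlift m k is Some j then fg_gen j else 1%g.

(* The values of the cocycle from a point of the [k]-th interval of the real  *)
(* line to the upper and to the lower half-plane. Every loop through the      *)
(* intervals [m] and [k] thus gives the generator attached to [k], and the    *)
(* rotation by pi exchanges [up_gen] and [dn_gen] when [n] is [m.*2].         *)
Definition up_gen (k : K) : Free n := if (m < k)%N then edge_gen k else 1%g.
Definition dn_gen (k : K) : Free n := if (k < m)%N then edge_gen k else 1%g.

(** At a point of the [k]-th interval the half-planes above and below are neighbours across an edge
    of type [k]. The [toggle m] on the left is the convention that equal group elements above and
    below name half-planes glued along the interval [m], where both [up_gen] and [dn_gen] are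
    trivial. *)
Lemma act_up_dn s g (k : K) : reduced s ->
  toggle m (act s (g * dn_gen k)%g) = toggle k (act s (g * up_gen k)%g).
Proof.
move=> rs; have rg := act_reduced g rs; rewrite !actM // /up_gen /dn_gen /edge_gen.
case: unliftP => [j|] kE; last by rewrite kE !ltnn.
have -> : fg_gen j = \pi_(Free n) [:: (j, true)] by [].
have jk : bump m j = k by rewrite kE.
case: ltngtP => km; rewrite ?act1 // ?act_pi // /act_word /= /act_letter /= -?kE ?jk.
- by rewrite km eqxx toggleK // toggle_reduced.
- by rewrite ltnNge (ltnW km) /= toggleK // toggle_reduced.
- by have := neq_lift m j; rewrite -kE; move/eqP; case; exact/val_inj.
Qed.

End FreeAction.

(** * The plane minus finitely many real points *)

Lemma near_imply (T : topologicalType) (x : T) (b : bool) (Q : set T) :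
  (b -> \forall y \near x, Q y) -> \forall y \near x, b -> Q y.
Proof.
by case: b => [/(_ isT)|_]; [apply: filterS => y Qy _|exact: nearW].
Qed.

Section Intervals.
Variables (R : realType) (n : nat) (P : n.-tuple R).
Hypothesis sP : sorted <%R P.
Local Notation C := R[i].
Local Notation K := 'I_n.+1.

Definition punctured : set C := [set z : C | ~ (Im z = 0 /\ Re z \in P)].

Definition interval_at (k : K) : set R :=
  [set x | ((0 < k)%N -> P`_k.-1 < x) /\ ((k < n)%N -> x < P`_k)].

Definition interval_of (x : R) : K := inord (count (fun p => p < x) P).

Lemma sorted_nth_lt (s : seq R) x i : sorted <%R s -> (i < size s)%N ->
  (s`_i < x) = (i < count (fun p => (p < x)%R) s)%N.
Proof.
elim: s i => //= a s IH i pas; rewrite ltnS => is_.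
have [ax|xa] := ltP a x.
  by case: i is_ => [|i] is_ //=; rewrite IH // (path_sorted pas).
have count0 : count (fun p => (p < x)%R) s = 0%N.
  apply/eqP; rewrite -leqn0 leqNgt -has_count; apply/hasPn => p ps.
  rewrite -leNgt (le_trans xa) // ltW //.
  by move: pas; rewrite (path_sortedE lt_trans) => /andP[/allP] /(_ p ps).
rewrite count0 /=; case: i is_ => [|i] is_ /=; first by rewrite ltNge xa.
by rewrite IH ?count0 // (path_sorted pas).
Qed.

Lemma interval_ofE x : (interval_of x : nat) = count (fun p => p < x) P.
Proof. by rewrite inordK // ltnS -[X in (_ <= X)%N](size_tuple P) count_size. Qed.

Lemma interval_at_of x : x \notin P -> interval_at (interval_of x) x.
Proof.
move=> xP; split; rewrite interval_ofE => k0.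
  have c1 : ((count (fun p => (p < x)%R) P).-1 < count (fun p => (p < x)%R) P)%N by rewrite prednK.
  by rewrite sorted_nth_lt // (leq_trans c1) // count_size.
rewrite lt_neqAle leNgt sorted_nth_lt ?size_tuple // ltnn andbT.
by apply: contra xP => /eqP ->; rewrite mem_nth // size_tuple.
Qed.

Lemma interval_at_inj k x : interval_at k x -> interval_of x = k.
Proof.
move=> [k0 kn]; apply/val_inj; rewrite /= interval_ofE.
have cn : (count (fun p => (p < x)%R) P <= n)%N.
  by rewrite -[X in (_ <= X)%N](size_tuple P) count_size.
apply/eqP; rewrite eqn_leq; apply/andP; split; rewrite leqNgt; apply/negP.
  move=> kc; have kn' : (k < n)%N by exact: leq_trans cn.
  move: (kn kn'); rewrite ltNge => /negP; apply; apply: ltW.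
  by rewrite sorted_nth_lt // size_tuple.
move=> ck; have k0' : (0 < k)%N by exact: leq_ltn_trans ck.
have := k0 k0'; rewrite sorted_nth_lt //; last by rewrite size_tuple prednK // -ltnS.
by rewrite prednK // leqNgt ck.
Qed.

Lemma interval_at_notin k x : interval_at k x -> x \notin P.
Proof.
move=> [k0 kn]; apply/negP => /tnthP[[i iltn]]; rewrite (tnth_nth 0) /= => /esym xE.
have [ik|ki] := ltnP i k; last first.
  have := kn (leq_ltn_trans ki iltn); rewrite -xE ltNge => /negP; apply.
  by rewrite (lt_sorted_leq_nth 0 sP) ?inE ?size_tuple // (leq_ltn_trans ki).
have k0' : (0 < k)%N by exact: leq_ltn_trans ik.
have := k0 k0'; rewrite -xE ltNge => /negP; apply.
have ik1 : (i <= k.-1)%N by rewrite -ltnS prednK.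
have kn1 : (k.-1 < n)%N by rewrite prednK // -ltnS.
by rewrite (lt_sorted_leq_nth 0 sP) ?inE ?size_tuple.
Qed.

Lemma interval_at_near k x : interval_at k x -> \forall x' \near x, interval_at k x'.
Proof.
move=> [k0 kn].
have [] := (@near_imply _ x (0 < k)%N [set y | P`_k.-1 < y] (fun h => lt_nbhsr (k0 h)),
            @near_imply _ x (k < n)%N [set y | y < P`_k] (fun h => lt_nbhsl (kn h))).
by apply: filterS2 => x' ? ?.
Qed.

Lemma interval_of_near x : x \notin P ->
  \forall x' \near x, interval_of x' = interval_of x.
Proof.
move=> /interval_at_of /interval_at_near; apply: filterS => x'.
exact: interval_at_inj.
Qed.

Lemma interval_retraction (k : K) : exists rho : C -> R,
  [/\ continuous rho, forall z, punctured z -> interval_at k (rho z) &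
      forall z, Im z = 0 -> interval_at k (Re z) -> rho z = Re z].
Proof.
pose d p (z : C) := `|Im z| + `|Re z - p|.
have cd p : continuous (d p).
  move=> z; have FF := nbhs_filter z; apply: (@cvgD R R^o C (nbhs z) FF).
    exact: (@cvg_norm R R^o C (nbhs z) FF _ _ (@Im_continuous R z)).
  apply: (@cvg_norm R R^o C (nbhs z) FF).
  apply: (@cvgB R R^o C (nbhs z) FF); first exact: Re_continuous.
  exact: cvg_cst.
have d0 p z : p \in P -> punctured z -> 0 < d p z.
  move=> pP; apply: contra_notT; rewrite -leNgt => dz.
  have : d p z == 0 by rewrite eq_le dz addr_ge0 ?normr_ge0.
  rewrite paddr_eq0 ?normr_ge0 // !normr_eq0 subr_eq0 => /andP[/eqP -> /eqP ->].
  by split.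
have PE i : (i < n)%N -> P`_i \in P by move=> ?; rewrite mem_nth // size_tuple.
have [k0|k0] := posnP k; have [kn|kn] := ltnP k n.
- exists (fun z => P`_k - d P`_k z); split.
  + move=> z; apply: (@cvgB R R^o C (nbhs z) (nbhs_filter z)); last exact: cd.
    exact: cvg_cst.
  + move=> z Yz; split=> [h|_]; first by rewrite k0 in h.
    by have := d0 _ z (PE _ kn) Yz; lra.
  + move=> z z0 [_ /(_ kn) zk]; rewrite /d z0 normr0 add0r ltr0_norm; lra.
- exists (fun z => Re z); split=> //; first exact: Re_continuous.
  by move=> z _; split=> h; [rewrite k0 in h|rewrite ltnNge kn in h].
- have kn' : (k.-1 < n)%N by rewrite prednK // -ltnS.
  set a := P`_k.-1; set b := P`_k.
  have ab : a < b.
    by rewrite /a /b (lt_sorted_ltn_nth 0 sP) ?inE ?size_tuple // prednK.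
  (* This lower bound on the denominator makes [rho] continuous on the whole plane, punctures
     included. *)
  have ge_ab z : b - a <= d a z + d b z.
    have := normr_ge0 (Im z); have := ler_norm (Re z - a); rewrite /d.
    by have := ler_norm (b - Re z); rewrite (distrC b); lra.
  have gt0 z : 0 < d a z + d b z by apply: lt_le_trans (ge_ab z); rewrite subr_gt0.
  exists (fun z => a + (b - a) * (d a z / (d a z + d b z))); split.
  + move=> z; have FF := nbhs_filter z.
    apply: (@cvgD R R^o C (nbhs z) FF); first exact: cvg_cst.
    apply: (@cvgM R C (nbhs z) FF); first exact: cvg_cst.
    apply: (@cvgM R C (nbhs z) FF); first exact: cd.
    apply: (@cvgV R C (nbhs z) FF); first by rewrite gt_eqF.
    by apply: (@cvgD R R^o C (nbhs z) FF); exact: cd.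
  + move=> z Yz; have da := d0 _ z (PE _ kn') Yz; have db := d0 _ z (PE _ kn) Yz.
    have q0 : 0 < d a z / (d a z + d b z) by rewrite divr_gt0.
    have q1 : d a z / (d a z + d b z) < 1.
      by rewrite ltr_pdivrMr // mul1r ltrDl.
    by split=> _; rewrite -/a -/b; nra.
  + move=> z z0 [/(_ k0) za /(_ kn) zb].
    rewrite /d z0 normr0 !add0r gtr0_norm ?subr_gt0 // ltr0_norm ?subr_lt0 //.
    have -> : Re z - a - (Re z - b) = b - a by ring.
    by rewrite mulrC mulfVK ?subr_eq0 ?gt_eqF // addrC subrK.
exists (fun z => P`_k.-1 + d P`_k.-1 z); split.
- move=> z; apply: (@cvgD R R^o C (nbhs z) (nbhs_filter z)); last exact: cd.
  exact: cvg_cst.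
- move=> z Yz; split=> [_|h]; last by rewrite ltnNge kn in h.
  have kn' : (k.-1 < n)%N by rewrite prednK // -ltnS.
  by have := d0 _ z (PE _ kn') Yz; lra.
- move=> z z0 [/(_ k0) zk _]; rewrite /d z0 normr0 add0r gtr0_norm; lra.
Qed.

End Intervals.

(** * Pasting on closed sets and composing homotopies *)

Section Pasting.
Variable R : realType.
Local Notation I := (unit_interval R).

Lemma closed_paste (W Z : topologicalType) (D E : set W) (f g : W -> Z) :
  closed D -> closed E -> D `|` E = setT -> continuous f -> continuous g ->
  (forall w, D w -> E w -> f w = g w) ->
  continuous (fun w => if w \in D then f w else g w).
Proof.
move=> cD cE DE cf cg fg; apply/continuous_subspace_setT; rewrite -DE.
apply: withinU_continuous => //.
- apply: (@subspace_eq_continuous _ _ _ f); last exact: continuous_subspaceT.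
  by move=> w wD; rewrite /from_subspace wD.
- apply: (@subspace_eq_continuous _ _ _ g); last exact: continuous_subspaceT.
  move=> w /set_mem Ew; rewrite /from_subspace; case: ifPn => // /set_mem Dw.
  by rewrite fg.
Qed.

Definition homotopic_in (T W : topologicalType) (X : set T) (A : set W)
    (f g : W -> T) : Prop :=
  exists H : W * I -> T, [/\ continuous H, forall z, X (H z),
    forall w, H (w, zero) = f w, forall w, H (w, one) = g w &
    forall a t, A a -> H (a, t) = f a].

Lemma homotopic_in_trans (T W : topologicalType) (X : set T) (A : set W)
    (f g h : W -> T) :
  homotopic_in X A f g -> homotopic_in X A g h -> homotopic_in X A f h.
Proof.
case=> H [cH HX H0 H1 HA] [K [cK KX K0 K1 KA]].
pose H' (w : W * I) := H (w.1, clamp (2 * ival w.2 + 0)).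
pose K' (w : W * I) := K (w.1, clamp (2 * ival w.2 + -1)).
exists (fun w => if ival w.2 <= 2^-1 then H' w else K' w); split.
- apply: (@paste_continuous _ _ _ (fun w => ival w.2)).
  + exact: (continuous_o (@snd_cts _ _) (@ival_continuous R)).
  + apply: (continuous_o _ cH); apply: continuous_to_pair; first exact: fst_cts.
    exact/affine_cts/snd_cts.
  + apply: (continuous_o _ cK); apply: continuous_to_pair; first exact: fst_cts.
    exact/affine_cts/snd_cts.
  + move=> [x t] /= te; rewrite /H' /K' /= te.
    by rewrite clamp1 ?clamp0 ?H1 ?K0 //; lra.
- by move=> z; case: ifP => _; [exact: HX|exact: KX].
- move=> x /=; rewrite ival0 invr_ge0 ler0n /H' /= ival0 clamp0 ?H0 //; lra.
- move=> x /=; rewrite ival1 ifN; last by rewrite -ltNge; lra.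
  by rewrite /K' /= ival1 clamp1 ?K1 //; lra.
- move=> x t Ax /=; rewrite /H' /K' HA // KA // -H1 HA //.
  by case: ifP.
Qed.

End Pasting.

(** * Contraction of a punctured closed half-plane *)

Section HalfPlane.
Variables (R : realType) (n : nat) (P : n.-tuple R).
Local Notation C := R[i].
Local Notation I := (unit_interval R).
Local Notation Y := (punctured P).

Definition in_side (e : bool) (z : C) : Prop :=
  if e then 0 <= Im z else Im z <= 0.

(* The half-plane is mapped to the strictly convex region [y >= x ^+ 2], in    *)
(* which a segment meets the boundary in its end points only.                  *)
Definition bent_segment (e : bool) (t : R) (z z' : C) : C :=
  ((1 - t) * Re z + t * Re z') +i*
  ((1 - t) * Im z + t * Im z' +
   (if e then 1 else -1) * (t * (1 - t) * (Re z - Re z') ^+ 2)).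

Lemma bent_segment0 e z z' : bent_segment e 0 z z' = z.
Proof.
by case: z => x y; rewrite /bent_segment /= !(subr0, mul0r, mul1r, mulr0, addr0).
Qed.

Lemma bent_segment1 e z z' : bent_segment e 1 z z' = z'.
Proof.
by case: z' => x y; rewrite /bent_segment /= subrr !(mul0r, mul1r, mulr0, add0r, addr0).
Qed.

Lemma bent_segmentzz e t z : bent_segment e t z z = z.
Proof.
case: z => x y; rewrite /bent_segment /= subrr expr0n /= !mulr0 addr0.
by rewrite -!mulrDl subrK !mul1r.
Qed.

(** Up to a common sign, the imaginary part is a sum of three nonnegative terms. If it vanishes
    strictly between the ends, all three vanish and the ends coincide; a straight segment between
    two intervals of the real line would instead run through the punctures. *)
Lemma bent_segment_punctured e t z z' : 0 <= t -> t <= 1 ->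
  Y z -> Y z' -> in_side e z -> in_side e z' -> Y (bent_segment e t z z').
Proof.
move=> t0 t1 Yz Yz' ez ez'.
have [->|tn0] := eqVneq t 0; first by rewrite bent_segment0.
have [->|tn1] := eqVneq t 1; first by rewrite bent_segment1.
have {t0 tn0}t0 : 0 < t by rewrite lt_neqAle eq_sym tn0.
have {t1 tn1}t1 : t < 1 by rewrite lt_neqAle tn1.
have u0 : 0 < 1 - t by lra.
have tu0 : 0 < t * (1 - t) by exact: mulr_gt0.
case=> Im0 ReP; suff E : z = z' by move: Im0 ReP; rewrite -E bent_segmentzz => *; exact: Yz.
have d0 := sqr_ge0 (Re z - Re z').
have tud := mulr_ge0 (ltW tu0) d0.
have [Iz Iz' dz] : [/\ Im z = 0, Im z' = 0 & Re z - Re z' = 0].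
  suff : (1 - t) * Im z = 0 /\ t * Im z' = 0 /\ t * (1 - t) * (Re z - Re z') ^+ 2 = 0.
    case=> /eqP + [/eqP + /eqP].
    by rewrite !mulf_eq0 !(gt_eqF t0) (gt_eqF u0) /= orbb
      => /eqP -> /eqP -> /eqP ->.
  move: Im0 ez ez'; rewrite /bent_segment /in_side /=; case: (e) => Im0 ez ez'.
    have := mulr_ge0 (ltW u0) ez; have := mulr_ge0 (ltW t0) ez'.
    by rewrite mul1r in Im0; split; [lra|split; lra].
  have := mulr_ge0_le0 (ltW u0) ez; have := mulr_ge0_le0 (ltW t0) ez'.
  by rewrite mulN1r in Im0; split; [lra|split; lra].
apply/eqP; rewrite eq_complex Iz Iz' eqxx andbT -subr_eq0.
by rewrite dz.
Qed.

Lemma bent_segment_continuous e (W : topologicalType) (t : W -> R) (f g : W -> C) :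
  continuous t -> continuous f -> continuous g ->
  continuous (fun w => bent_segment e (t w) (f w) (g w)).
Proof.
move=> ct cf cg w.
have cRe (h : W -> C) : continuous h -> continuous (fun w => Re (h w)).
  by move=> ch; exact: (continuous_o ch (@Re_continuous R)).
have cIm (h : W -> C) : continuous h -> continuous (fun w => Im (h w)).
  by move=> ch; exact: (continuous_o ch (@Im_continuous R)).
have c1t : (1 - t w') @[w' --> w] --> 1 - t w.
  by apply: cvgB; [exact: cvg_cst|exact: ct].
have cd : (Re (f w') - Re (g w')) @[w' --> w] --> Re (f w) - Re (g w).
  by apply: cvgB; [exact: cRe cf w|exact: cRe cg w].
apply: complex_continuous.
  by apply: cvgD; apply: cvgM => //; [exact: cRe cf w|exact: ct|exact: cRe cg w].
apply: cvgD.
  by apply: cvgD; apply: cvgM => //; [exact: cIm cf w|exact: ct|exact: cIm cg w].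
apply: cvgM; first exact: cvg_cst.
apply: cvgM; first by apply: cvgM => //; exact: ct.
by rewrite expr2; under eq_fun do rewrite expr2; exact: cvgM.
Qed.

End HalfPlane.

Lemma near_all (T : topologicalType) (x : T) (Q : set T) :
  (forall y, Q y) -> \forall y \near x, Q y.
Proof. by move=> Qy; exact: nearW. Qed.

(** * The cocycle of the punctured plane *)

Section PuncturedCocycle.
Variables (R : realType) (n : nat) (P : n.-tuple R) (m : 'I_n.+1).
Hypothesis sP : sorted <%R P.
Local Notation C := R[i].
Local Notation I := (unit_interval R).
Local Notation Y := (punctured P).
Local Notation K := 'I_n.+1.

Definition up_of (z : C) : Free n :=
  if Im z == 0 then up_gen m (interval_of P (Re z)) else 1%g.
Definition dn_of (z : C) : Free n :=
  if Im z == 0 then dn_gen m (interval_of P (Re z)) else 1%g.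

(** Points near a non-real point are non-real and on the same side, so only departures from the real
    line need a value; arrivals are read backwards from the real point. *)
Definition crossing (z z' : C) : Free n :=
  if 0 < Im z' then up_of z else if Im z' < 0 then dn_of z else 1%g.

Lemma near_Im_gt0 (z : C) : 0 < Im z -> \forall z' \near z, 0 < Im z'.
Proof.
move=> z0.
exact: (@near_cts C R _ z (fun x : R => 0 < x) (@Im_continuous R) (lt_nbhsr z0)).
Qed.

Lemma near_Im_lt0 (z : C) : Im z < 0 -> \forall z' \near z, Im z' < 0.
Proof.
move=> z0.
exact: (@near_cts C R _ z (fun x : R => x < 0) (@Im_continuous R) (lt_nbhsl z0)).
Qed.

Lemma near_interval_of (z : C) : Y z -> Im z = 0 ->
  \forall z' \near z, interval_of P (Re z') = interval_of P (Re z).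
Proof.
move=> Yz z0; have zP : Re z \notin P by apply/negP => zP; exact: Yz.
exact: (near_cts (w := z) (@Re_continuous R) (interval_of_near sP zP)).
Qed.

Lemma crossing_off (z z' : C) : Im z != 0 -> crossing z z' = 1%g.
Proof. by rewrite /crossing /up_of /dn_of => /negbTE ->; rewrite !if_same. Qed.

Lemma crossing_cocycle : local_cocycle Y crossing.
Proof.
move=> z Yz; have [z0|z0|z0] := ltgtP (Im z) 0.
- have := near_Im_lt0 z0; apply: filterS => z' z'0; apply: near_all => z''.
  by rewrite !crossing_off ?mulg1 // lt_eqF.
- have := near_Im_gt0 z0; apply: filterS => z' z'0; apply: near_all => z''.
  by rewrite !crossing_off ?mulg1 // gt_eqF.
have := near_interval_of Yz z0; apply: filterS => z' zz'.
have [z'0|z'0|z'0] := ltgtP (Im z') 0.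
- have := near_Im_lt0 z'0; apply: filterS => z'' z''0.
  rewrite [crossing z' _]crossing_off ?lt_eqF // mulg1.
  by rewrite /crossing !ltNge !(ltW z'0) !(ltW z''0) /= -!ltNge z'0 z''0.
- have := near_Im_gt0 z'0; apply: filterS => z'' z''0.
  rewrite [crossing z' _]crossing_off ?gt_eqF // mulg1.
  by rewrite /crossing z'0 z''0.
- apply: near_all => z''; rewrite [crossing z z']/crossing z'0 ltxx mul1g.
  by rewrite /crossing /up_of /dn_of z0 z'0 eqxx zz'.
Qed.

Section Paths.

Local Notation lp := (@lifted_path R C Y (Free n) crossing).

Lemma crossing_path (k : K) :
  lp (0 +i* 1) (0 +i* -1) ((up_gen m k)^-1 * dn_gen m k)%g.
Proof.
have [rho [_ rhoJ _]] := interval_retraction sP k.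
have Yi : Y (0 +i* 1) by case=> /= /eqP; rewrite oner_eq0.
(* The retraction is used here to obtain a point [x] of the [k]-th interval. *)
have := rhoJ _ Yi; move: (rho _) => x Jx {rho rhoJ}.
have kx := interval_at_inj sP Jx; have xP := interval_at_notin sP Jx.
pose u (t : I) : R := -2 * ival t + 1.
have cu : continuous u by apply: affine_ival_cts => ?; exact: cvg_id.
have cnu : continuous (fun t => `|u t|) by exact: (continuous_o cu (@norm_continuous R R^o)).
(* A broken line from [i] to [-i] that is real only at [x], so that its section is given by the
   values of [crossing] from [x] alone. *)
pose p (t : I) : C := (x * (1 - `|u t|)) +i* u t.
have cp : continuous p.
  move=> t; apply: complex_continuous; last exact: (cu t).
  apply: (@cvgM R I (nbhs t) (nbhs_filter t)); first exact: cvg_cst.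
  apply: (@cvgB R R^o I (nbhs t) (nbhs_filter t)); last exact: (cnu t).
  exact: cvg_cst.
have pR t : Im (p t) = 0 -> p t = x +i* 0.
  by rewrite /p /= => ->; rewrite normr0 subr0 mulr1.
have pY t : Y (p t) by move=> [/pR ->] /= /(negP xP).
have Yx : Y (x +i* 0) by move=> [_] /= /(negP xP).
have crossx z : crossing (x +i* 0) z = if 0 < Im z then up_gen m k else
    if Im z < 0 then dn_gen m k else 1%g.
  by rewrite /crossing /up_of /dn_of /= eqxx kx.
exists p, (fun t => ((up_gen m k)^-1 * crossing (x +i* 0) (p t))%g); split=> //.
- apply: flat_mull => t.
  have [t0|t0|t0] := ltgtP (Im (p t)) 0.
  + have := near_cts cp (near_Im_lt0 t0); apply: filterS => t' t'0.
    rewrite [crossing (p t) _]crossing_off ?lt_eqF // mulg1 !crossx.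
    by rewrite t0 t'0 !ltNge !ltW.
  + have := near_cts cp (near_Im_gt0 t0); apply: filterS => t' t'0.
    by rewrite [crossing (p t) _]crossing_off ?gt_eqF // mulg1 !crossx t0 t'0.
  + by apply: near_all => t'; rewrite (pR t t0) (local_cocycle1 crossing_cocycle) ?mul1g.
- have p0 : p zero = 0 +i* 1.
    by rewrite /p /u ival0 mulr0 add0r normr1 subrr mulr0.
  have p1 : p one = 0 +i* -1.
    rewrite /p /u ival1 (_ : -2 * 1 + 1 = -1 :> R); last by lra.
    by rewrite normrN1 subrr mulr0.
  rewrite p0 p1 !crossx /= ltr01 mulVg; split=> //.
  by rewrite ltrN10 oppr_gt0 ltr10.
Qed.

Lemma crossing_loop g : lp (0 +i* 1) (0 +i* 1) g.
Proof.
have Yi : Y (0 +i* 1) by case=> /= /eqP; rewrite oner_eq0.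
have loopk k : lp (0 +i* 1) (0 +i* 1) ((up_gen m k)^-1 * dn_gen m k)%g.
  have := lifted_path_trans crossing_cocycle (crossing_path k)
    (lifted_path_sym (crossing_path m)).
  have -> : up_gen m m = 1%g by rewrite /up_gen ltnn.
  by have -> : dn_gen m m = 1%g; [rewrite /dn_gen ltnn|rewrite invg1 mulg1 invg1 mulg1].
have loopg j : lp (0 +i* 1) (0 +i* 1) (fg_gen j).
  have := loopk (lift m j); rewrite /up_gen /dn_gen /edge_gen liftK.
  have := neq_lift m j; rewrite -val_eqE /=; case: ltngtP => //= _ _.
    by move/lifted_path_sym; rewrite mulg1 invgK.
  by rewrite invg1 mul1g.
elim/fg_ind: g; elim=> [|[j b] w IH].
  exists (fun _ => 0 +i* 1), (fun _ => 1%g); split=> //; first exact: cst_continuous.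
  exact: flat_cst crossing_cocycle Yi.
have -> : \pi_(Free n) ((j, b) :: w) = (\pi_(Free n) [:: (j, b)] * \pi_(Free n) w)%g.
  by rewrite -[RHS]/(fg_mul _ _) fg_mul_pi.
apply: (lifted_path_trans crossing_cocycle _ IH).
case: b; first exact: loopg.
have -> : \pi_(Free n) [:: (j, false)] = ((fg_gen j)^-1)%g.
  by rewrite -[RHS]/(fg_inv _) fg_inv_pi.
exact/lifted_path_sym/loopg.
Qed.

Lemma crossing_transitive : transitive_lifts R Y crossing.
Proof.
apply: (@lifted_path_base R C Y _ _ crossing_cocycle (0 +i* 1)); last exact: crossing_loop.
move=> z Yz.
(* The straight segment from [z] has imaginary part of the sign of [b] at every positive time, so it
   can be real only at its starting point. *)
have vertical (b : R) : Y (0 +i* b) -> (0 < b /\ 0 <= Im z) \/ (b < 0 /\ Im z < 0) ->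
    exists g, lp z (0 +i* b) g.
  move=> Yb zb.
  apply: (@lifted_path_exists _ _ _ _ _ crossing_cocycle _ _
    (fun t => z + (ival t)%:C * (0 +i* b - z))).
  + apply: complex_affine_continuous.
    * by move=> ?; exact: cvg_id.
    * exact: cst_continuous.
    * exact: cst_continuous.
  + move=> t; have := ival_ge0 t; have := ival_le1 t.
    have [->|tn0] := eqVneq (ival t) 0; first by rewrite rmorph0 mul0r addr0.
    rewrite [0 <= _]le_eqVlt eq_sym (negbTE tn0) /= => t1 t0.
    case: z Yz zb => x y Yz zb []; simpc => /= Im0 _.
    by case: zb => /= -[h1 h2]; nra.
  + by rewrite ival0 rmorph0 mul0r addr0.
  + by rewrite ival1 rmorph1 mul1r addrC subrK.
have [z0|z0] := ltP (Im z) 0.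
  have [||g gP] := vertical (-1).
  - by case=> /= /eqP; rewrite oppr_eq0 oner_eq0.
  - by right; rewrite ltrN10.
  by eexists; exact: (lifted_path_trans crossing_cocycle gP (lifted_path_sym (crossing_path m))).
apply: vertical; last by left; rewrite ltr01.
by case=> /= /eqP; rewrite oner_eq0.
Qed.

End Paths.

End PuncturedCocycle.

(** * Pruning the tree of half-planes *)

Section TreeOfHalfPlanes.
Variables (R : realType) (n : nat) (P : n.-tuple R).
Hypothesis sP : sorted <%R P.
Local Notation C := R[i].
Local Notation I := (unit_interval R).
Local Notation Y := (punctured P).
Local Notation K := 'I_n.+1.
Variables (W : topologicalType) (A : set W) (x0 : C).
Hypothesis A0 : A !=set0.

(* A map to the universal covering space of [Y]: it sends the closed set [D v] *)
(* to the half-plane labelled by the vertex [v] of the tree, and the parity of *)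
(* [v] tells upper half-planes from lower ones.                                *)
Record tree_map (e : bool) (Vs : seq (seq K)) (f : W -> C) (D : seq K -> set W) :
    Prop := TreeMap {
  tree_map_continuous : continuous f;
  tree_map_in : forall w, Y (f w);
  tree_map_closed : forall v, closed (D v);
  tree_map_side : forall v w, D v w -> in_side (e (+) odd (size v)) (f w);
  tree_map_cover : forall w, exists v, D v w;
  tree_map_finite : forall v w, D v w -> v \in Vs;
  tree_map_edge : forall v v' w, D v w -> D v' w -> v != v' ->
    exists k, [/\ v' = toggle k v, Im (f w) = 0 & interval_at P k (Re (f w))];
  tree_map_base : forall a, A a -> D [::] a /\ f a = x0
}.

Lemma size_le_sumn (T : eqType) (s : seq T) (Vs : seq (seq T)) : s \in Vs ->
  (size s <= sumn (map size Vs))%N.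
Proof.
elim: Vs => //= t Vs IH; rewrite inE => /predU1P[->|/IH]; first exact: leq_addr.
by move/leq_trans; apply; exact: leq_addl.
Qed.

Lemma sumn_size_filter (T : eqType) (s : seq T) (Vs : seq (seq T)) : s \in Vs ->
  (size s + sumn (map size [seq t <- Vs | t != s]) <= sumn (map size Vs))%N.
Proof.
elim: Vs => //= t Vs IH; rewrite inE; have [->|ts] := eqVneq t s => /=.
  move=> _; rewrite leq_add2l; elim: Vs {IH} => //= t' Vs IH.
  by case: ifP => _ /=; [rewrite leq_add2l|apply: leq_trans IH _; exact: leq_addl].
by move/IH; rewrite addnCA leq_add2l.
Qed.

Lemma tree_map_max (Vs : seq (seq K)) : (0 < sumn (map size Vs))%N ->
  exists k u, (k :: u) \in Vs /\ forall v, v \in Vs -> (size v <= (size u).+1)%N.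
Proof.
elim: Vs => // v Vs IH /=.
have [s0|/IH[k [u [kuV uV]]]] := posnP (sumn (map size Vs)).
  rewrite s0 addn0; case: v => // k u _; exists k, u; split; first exact: mem_head.
  move=> v; rewrite inE => /predU1P[-> //|vV].
  by have := size_le_sumn vV; rewrite s0 leqn0 => /eqP ->.
move=> _; have [vu|uv] := leqP (size v) (size u).+1.
  exists k, u; split; first by rewrite inE kuV orbT.
  by move=> v'; rewrite inE => /predU1P[-> //|]; exact: uV.
case: v uv => // k' u'; rewrite /= ltnS => uu'; exists k', u'.
split; first exact: mem_head.
move=> v'; rewrite inE => /predU1P[-> //|/uV]; move/leq_trans; apply.
exact: ltnW.
Qed.

Lemma tree_map_prune e Vs f D : tree_map e Vs f D -> (0 < sumn (map size Vs))%N ->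
  exists Vs' f' D', [/\ (sumn (map size Vs') < sumn (map size Vs))%N,
    tree_map e Vs' f' D' & homotopic_in R Y A f f'].
Proof.
move=> [cf fY cD Ds Dc Df De DA] /tree_map_max[k [u [v0V Vmax]]].
set v0 := k :: u in v0V.
have [rho [crho rhoJ rhoid]] := interval_retraction sP k.
pose r z : C := rho z +i* 0.
have rY z : Y z -> Y (r z).
  by move=> /rhoJ /(interval_at_notin sP) rP [_] /= /(negP rP).
have r_side b z : in_side b (r z) by case: b; rewrite /in_side /= lexx.
have cr : continuous r.
  by move=> z; apply: complex_continuous; [exact: crho|exact: cst_continuous].
(* Crossing an edge of type other than [k] from [v0] lengthens the word, against maximality. So
   [D v0] meets no other set than [D u], and there [f] takes values in the [k]-th interval, which
   [r] fixes. *)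
have v0E v w : D v0 w -> D v w -> v != v0 -> v = u /\ r (f w) = f w.
  move=> Dw Dvw; rewrite eq_sym => vv0; have [k' [vE fw0 fwk]] := De _ _ _ Dw Dvw vv0.
  have kk' : k = k'.
    apply/eqP; case: eqP => // /eqP kk'; have := Vmax _ (Df _ _ Dvw).
    by rewrite vE /= (negbTE kk') /= ltnn.
  subst k'; split; first by rewrite vE /= eqxx.
  by rewrite /r rhoid // -fw0; case: (f w).
(* Closed as a finite union, which allows the homotopy to be constant there and pasted with the one
   on [D v0]. *)
pose D1 := [set w | exists v, [/\ v \in Vs, v != v0 & D v w]].
have cD1 : closed D1.
  have -> : D1 = \big[setU/set0]_(v <- [seq v <- Vs | v != v0]) D v.
    rewrite -bigcup_seq; apply/seteqP; split => w.
      by move=> [v [vV vv0 Dvw]]; exists v => //=; rewrite mem_filter vv0.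
    by move=> [v /=]; rewrite mem_filter => /andP[vv0 vV] Dvw; exists v.
  by apply: closed_bigsetU => v _; exact: cD.
have D01 : D v0 `|` D1 = setT.
  apply/seteqP; split=> // w _; have [v Dvw] := Dc w.
  by have [<-|vv0] := eqVneq v v0; [left|right; exists v; split=> //; exact: Df Dvw].
pose b := e (+) odd (size v0).
pose F (z : W * I) : C :=
  if z \in (fst @^-1` D v0 : set (W * I))
  then bent_segment b (ival z.2) (f z.1) (r (f z.1)) else f z.1.
have FE z : D v0 z.1 -> F z = bent_segment b (ival z.2) (f z.1) (r (f z.1)).
  by move=> Dz; rewrite /F ifT // inE.
have F1E v z : D v z.1 -> v != v0 -> F z = f z.1.
  move=> Dz vv0; rewrite /F; case: ifPn => // /set_mem /= D0z.
  by have [_ ->] := v0E _ _ D0z Dz vv0; rewrite bent_segmentzz.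
have cF : continuous F.
  apply: (closed_paste (E := fst @^-1` D1)).
  - by apply: closed_comp (cD v0) => ? _; exact: fst_cts.
  - by apply: closed_comp cD1 => ? _; exact: fst_cts.
  - by rewrite -preimage_setU D01.
  - apply: bent_segment_continuous.
    + exact: (continuous_o (@snd_cts _ _) (@ival_continuous R)).
    + exact: (continuous_o (@fst_cts _ _) cf).
    + exact: (continuous_o (continuous_o (@fst_cts _ _) cf) cr).
  - exact: (continuous_o (@fst_cts _ _) cf).
  - move=> z /= D0z [v [_ vv0 Dvz]].
    by have [_ ->] := v0E _ _ D0z Dvz vv0; rewrite bent_segmentzz.
have FY z : Y (F z).
  have [v Dv] := Dc z.1; have [v0v|vv0] := eqVneq v v0; last first.
    by rewrite (F1E _ _ Dv vv0).
  rewrite v0v in Dv; rewrite FE //; apply: bent_segment_punctured => //.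
  - exact: ival_ge0.
  - exact: ival_le1.
  - exact: rY.
  - exact: Ds Dv.
pose f' w := F (w, one).
have f'0 w : D v0 w -> f' w = r (f w) by move=> Dw; rewrite /f' FE //= ival1 bent_segment1.
have f'1 v w : D v w -> v != v0 -> f' w = f w by move=> Dw vv0; rewrite /f' (F1E v).
(* After the retraction the values on [D v0] are real, hence on both sides, and these points can be
   relabelled by the parent [u], one letter shorter: the total length decreases. *)
pose D' v w := (v != v0 /\ D v w) \/ (v = u /\ D v0 w).
have uv0 : u != v0 by apply/eqP => /(congr1 size) /= /n_Sn.
exists (u :: [seq v <- Vs | v != v0]), f', D'; split.
- have := sumn_size_filter v0V; rewrite /= addSn => /leq_trans; apply.
  exact: leqnn.
- split.
  + exact: (continuous_o (@pairl_continuous _ _ _) cF).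
  + by move=> w; exact: FY.
  + move=> v; have [vv0|vv0] := eqVneq v v0.
      rewrite (_ : D' v = set0); first exact: closed0.
      apply/seteqP; split=> // w [[/eqP] //|[vu _]].
      by move: uv0; rewrite -vu vv0 eqxx.
    have [vu|vu] := eqVneq v u.
      rewrite (_ : D' v = D v `|` D v0); first exact: closedU.
      apply/seteqP; split=> w; first by case=> -[_]; [left|right].
      by case; [left|right].
    rewrite (_ : D' v = D v) //; apply/seteqP; split=> w.
      by move=> [[]//|[vu']]; rewrite vu' eqxx in vu.
    by left.
  + move=> v w [[vv0 Dw]|[-> Dw]]; last by rewrite f'0.
    by rewrite (f'1 v) //; exact: Ds.
  + move=> w; have [v Dw] := Dc w; have [v0v|vv0] := eqVneq v v0.
      by exists u; right; rewrite -v0v.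
    by exists v; left.
  + move=> v w [[vv0 Dw]|[-> Dw]]; last exact: mem_head.
    by rewrite inE mem_filter vv0 (Df _ _ Dw) orbT.
  + move=> v v' w [[vv0 Dw]|[-> Dw]] [[v'v0 D'w]|[-> D'w]] vv'.
    * by rewrite (f'1 v) //; exact: De.
    * by have [vu _] := v0E _ _ D'w Dw vv0; rewrite vu eqxx in vv'.
    * by have [v'u _] := v0E _ _ Dw D'w v'v0; rewrite v'u eqxx in vv'.
    * by rewrite eqxx in vv'.
  + move=> a Aa; have [Da fa] := DA a Aa.
    by split; [left|rewrite (f'1 [::])].
- exists F; split=> //.
  + move=> w; have [v Dv] := Dc w; have [v0v|vv0] := eqVneq v v0; last first.
      by rewrite (F1E v).
    by rewrite v0v in Dv; rewrite FE //= ival0 bent_segment0.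
  + by move=> a t Aa; have [Da _] := DA a Aa; rewrite (F1E [::]).
Qed.

Lemma tree_map_null e Vs f D : tree_map e Vs f D ->
  homotopic_in R Y A f (fun _ => x0).
Proof.
have [N] := ubnP (sumn (map size Vs)); elim: N Vs f D => // N IH Vs f D.
rewrite ltnS => VN tm.
have [s0|s1] := posnP (sumn (map size Vs)); last first.
  have [Vs' [f' [D' [V'V tm' ff']]]] := tree_map_prune tm s1.
  by apply: homotopic_in_trans ff' (IH _ _ _ (leq_trans V'V VN) tm').
(* With total length zero only the root is left, so [f] stays in one half-plane and bent segments
   contract it to [x0]. *)
have side w : in_side e (f w).
  have [v Dv] := tree_map_cover tm w; have := tree_map_side tm Dv.
  suff -> : v = [::] by rewrite addbF.
  apply/nilP; rewrite /nilp -leqn0 -s0 size_le_sumn //.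
  exact: (tree_map_finite tm Dv).
have [a Aa] := A0; have [_ fa] := tree_map_base tm Aa.
exists (fun z => bent_segment e (ival z.2) (f z.1) x0); split.
- apply: bent_segment_continuous.
  + exact: (continuous_o (@snd_cts _ _) (@ival_continuous R)).
  + exact: (continuous_o (@fst_cts _ _) (tree_map_continuous tm)).
  + exact: cst_continuous.
- move=> z; rewrite -fa; apply: bent_segment_punctured => //.
  + exact: ival_ge0.
  + exact: ival_le1.
  + exact: tree_map_in tm _.
  + exact: tree_map_in tm _.
- by move=> w; rewrite /= ival0 bent_segment0.
- by move=> w; rewrite /= ival1 bent_segment1.
- by move=> a' t A'; have [_ ->] := tree_map_base tm A'; rewrite bent_segmentzz.
Qed.

End TreeOfHalfPlanes.

(** Lists ordered by inclusion form a directed family; compactness, as a near-covering property for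
    its filter of tails, yields a single list for all points. *)
Lemma compact_finite_labels (W : topologicalType) (V : eqType) (D : V -> set W)
    (r : W -> seq V) : compact [set: W] ->
  (forall w, \forall w' \near w, forall v, D v w' -> v \in r w) ->
  exists Vs : seq V, forall v w, D v w -> v \in Vs.
Proof.
move=> /compact_near_coveringP kW Dr.
pose F : set_system (seq V) :=
  fun S => exists s0 : seq V, forall s : seq V, {subset s0 <= s} -> S s.
have FF : Filter F.
  split; first by exists [::].
    move=> S S' [s0 H] [s1 H']; exists (s0 ++ s1) => s ss.
    by split; [apply: H|apply: H'] => x xs; apply: ss; rewrite mem_cat xs ?orbT.
  by move=> S S' SS' [s0 H]; exists s0 => s /H; exact: SS'.
have [|Vs VsP] := kW _ F (fun s w => forall v, D v w -> v \in s) FF.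
  move=> w _; exists ([set w' | forall v, D v w' -> v \in r w],
    [set s : seq V | {subset r w <= s}]); first by split; [exact: Dr|exists (r w)].
  by move=> [w' s] [/= w'P sP] v /w'P /sP.
by exists Vs => v w; exact: VsP (fun _ h => h) _ _ _.
Qed.

(** * Half-planes met by a lifted map *)

Section PuncturedAspherical.
Variables (R : realType) (n : nat) (P : n.-tuple R) (m : 'I_n.+1).
Hypothesis sP : sorted <%R P.
Local Notation C := R[i].
Local Notation I := (unit_interval R).
Local Notation Y := (punctured P).
Local Notation K := 'I_n.+1.
Local Notation c := (crossing P m).

Lemma near_Im_le (z : C) (b : bool) : ~ in_side b z -> 
  \forall z' \near z, ~ in_side b z'.
Proof.
case: b => /negP; rewrite -ltNge.
  by move=> /near_Im_lt0; apply: filterS => z'; rewrite /in_side leNgt => ->.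
by move=> /near_Im_gt0; apply: filterS => z'; rewrite /in_side leNgt => ->.
Qed.

Section Labels.
Variables (W : topologicalType) (f : W -> C) (g : W -> Free n) (s : seq K).
Hypotheses (cf : continuous f) (fY : forall w, Y (f w)) (fg : flat c f g).
Hypothesis rs : reduced s.

(* The half-plane of type [b] containing the lift of [w], when there is one.   *)
Definition half_plane (b : bool) (w : W) : seq K :=
  if b then act m s (g w * up_of P m (f w))%g
  else toggle m (act m s (g w * dn_of P m (f w))%g).

Definition half_plane_set (v : seq K) : set W :=
  [set w | exists b, in_side b (f w) /\ half_plane b w = v].

(** The conclusion goes back from [w'] to [w] because a limit of points of a closed half-plane stays
    in it. This gives both the closedness of the sets [half_plane_set v] and at most two labels near
    each point. *)
Lemma half_plane_locally_constant b w :
  \forall w' \near w, in_side b (f w') ->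
    in_side b (f w) /\ half_plane b w' = half_plane b w.
Proof.
have [bw|bw] := pselect (in_side b (f w)); last first.
  by have := near_cts cf (near_Im_le bw); apply: filterS => w'.
have [w0|w0|w0] := ltgtP (Im (f w)) 0.
- have := near_cts cf (near_Im_lt0 w0); have := fg w.
  apply: filterS2 => w' gw' w'0 _; split=> //.
  rewrite /half_plane gw' crossing_off ?lt_eqF // mulg1 /up_of /dn_of.
  by rewrite !lt_eqF.
- have := near_cts cf (near_Im_gt0 w0); have := fg w.
  apply: filterS2 => w' gw' w'0 _; split=> //.
  rewrite /half_plane gw' crossing_off ?gt_eqF // mulg1 /up_of /dn_of.
  by rewrite !gt_eqF.
have := near_cts cf (near_interval_of sP (@fY w) w0); have := fg w.
apply: filterS2 => w' gw' ww' bw'; split=> //; move: bw'.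
rewrite /half_plane gw' /crossing /in_side.
have [w'0|w'0|w'0] := ltgtP (Im (f w')) 0; case: (b) => // _.
- by rewrite /dn_of w0 eqxx (lt_eqF w'0) mulg1.
- by rewrite /up_of w0 eqxx (gt_eqF w'0) mulg1.
- by rewrite /up_of w0 w'0 eqxx mulg1 ww'.
- by rewrite /dn_of w0 w'0 eqxx mulg1 ww'.
Qed.

Lemma half_plane_edge w : Im (f w) = 0 ->
  half_plane false w = toggle (interval_of P (Re (f w))) (half_plane true w).
Proof. by move=> w0; rewrite /half_plane /up_of /dn_of w0 eqxx act_up_dn. Qed.

Lemma half_plane_setP v v' w : half_plane_set v w -> half_plane_set v' w ->
  v != v' -> exists k, [/\ v' = toggle k v, Im (f w) = 0 & interval_at P k (Re (f w))].
Proof.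
have rl b : reduced (half_plane b w).
  by rewrite /half_plane; case: b; rewrite ?toggle_reduced ?act_reduced.
move=> [b [bw <-]] [b' [b'w <-]] bb'.
have [w0 wP] : Im (f w) = 0 /\ Re (f w) \notin P.
  have w0 : Im (f w) = 0.
    apply/eqP; rewrite eq_le; move: bw b'w bb'; rewrite /in_side.
    by case: (b) (b') => -[] //; rewrite ?eqxx // => -> ->.
  by split=> //; apply/negP => wP; exact: (@fY w).
exists (interval_of P (Re (f w))); split=> //; last exact: interval_at_of.
move: bb'; case: (b) (b') => -[]; rewrite ?eqxx // => _.
  exact: half_plane_edge.
by rewrite half_plane_edge // toggleK.
Qed.

(** The action preserves parity, so labels of upper half-planes have the parity of [s]; hence the
    side [~~ odd (size s)] of the root. *)
Lemma half_plane_tree_map (A : set W) x0 : compact [set: W] ->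
  (forall a, A a -> half_plane_set [::] a /\ f a = x0) ->
  exists Vs, tree_map P A x0 (~~ odd (size s)) Vs f half_plane_set.
Proof.
move=> kW fA.
have near_set w : \forall w' \near w, forall v, half_plane_set v w' ->
    half_plane_set v w /\ v \in [:: half_plane true w; half_plane false w].
  have := half_plane_locally_constant true w.
  have := half_plane_locally_constant false w.
  apply: filterS2 => w' wF wT v [[] [bw' <-]].
    by have [bw ->] := wT bw'; split; [exists true|rewrite inE eqxx].
  by have [bw ->] := wF bw'; split; [exists false|rewrite !inE eqxx orbT].
have [w|Vs VsP] := @compact_finite_labels W _ half_plane_set
    (fun w => [:: half_plane true w; half_plane false w]) kW.
  by apply: filterS (near_set w) => w' H v /H[].
exists Vs; split=> //.
- move=> v; rewrite -[half_plane_set v]setCK; apply: open_closedC.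
  rewrite openE => w /= nw; apply: filterS (near_set w) => w' H Dw'.
  by have [] := H _ Dw'.
- move=> v w [b [bw <-]]; congr (in_side _ _): bw.
  rewrite /half_plane; case: b; rewrite ?odd_size_toggle odd_size_act.
    by case: odd.
  by case: odd.
- move=> w; have [w0|w0] := leP 0 (Im (f w)).
    by exists (half_plane true w), true.
  by exists (half_plane false w), false; split=> //; exact: ltW.
- exact: half_plane_setP.
Qed.

End Labels.

Lemma crossing_null : null_lifts R Y c.
Proof.
move=> W A f g x0 g0 kW tW A0 cf fY fg fA.
(* The starting vertex is chosen so that the half-plane containing the lift of [A] is the root. In
   the lower case one starts from [[:: m]], whose last letter is removed by the [toggle m] in
   [half_plane]. *)
have [s rs sA] : exists2 s, reduced s &
    forall a, A a -> half_plane_set f g s [::] a /\ f a = x0.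
  have [x00|x00] := leP 0 (Im x0).
    exists (act m [::] (g0 * up_of P m x0)^-1%g); first exact: act_reduced.
    move=> a Aa; have [fa ga] := fA a Aa; split=> //; exists true.
    by rewrite /half_plane /in_side fa ga -actM // mulVg act1.
  exists (act m [:: m] (g0 * dn_of P m x0)^-1%g); first exact: act_reduced.
  move=> a Aa; have [fa ga] := fA a Aa; split=> //; exists false.
  rewrite /half_plane /in_side fa ga -actM // mulVg act1 //= eqxx.
  by split=> //; exact: ltW.
have [Vs tm] := half_plane_tree_map cf fY fg rs kW sA.
have [H [cH HY H0 H1 HA]] := tree_map_null sP A0 tm.
exists H; split=> // a t Aa; rewrite HA //; exact: (fA a Aa).1.
Qed.

Theorem aspherical_punctured : aspherical R Y (Free n).
Proof.
exists c; split; [exact: crossing_cocycle|exact: crossing_null|].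
exact: crossing_transitive.
Qed.

End PuncturedAspherical.

(** * The fibration over the punctured plane *)

Section Parity.

Definition parity (g : Free 1) : bool := odd (size (repr g)).

Lemma word_eqv_parity (u v : word 'I_1) : word_eqv u v -> odd (size u) = odd (size v).
Proof.
elim=> {u v} // [u v a|u w v _ -> _ -> //].
by rewrite !size_cat /= !oddD /= negbK.
Qed.

Lemma parity_pi w : parity (\pi_(Free 1) w) = odd (size w).
Proof. exact/word_eqv_parity/repr_eqv. Qed.

Lemma parityM g h : parity (g * h)%g = parity g (+) parity h.
Proof.
move: g h; elim/fg_ind=> u; elim/fg_ind=> v.
have -> : (\pi_(Free 1) u * \pi_(Free 1) v)%g = \pi_(Free 1) (u ++ v).
  exact: fg_mul_pi.
by rewrite !parity_pi size_cat oddD.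
Qed.

Lemma parity1 : parity 1%g = false.
Proof. by have <- : \pi_(Free 1) [::] = 1%g by []; rewrite parity_pi. Qed.

Lemma parity_gen i : parity (fg_gen i) = true.
Proof. by rewrite /fg_gen parity_pi. Qed.

(** The swap is an involution, so its action factors through the exponent modulo two. *)
Lemma swap_actionE g z : swap_action g z = if parity g then swap_fun z else z.
Proof.
elim/fg_ind: g => w; rewrite parity_pi /swap_action fg_lift_pi /word_eval.
elim: w => [|[i b] w IH]; first by rewrite big_nil.
rewrite big_cons; set h : aut (Free 2) := (\prod_(_ <- w) _)%g in IH *.
have -> : forall f : aut (Free 2), (f * h)%g z = f (h z) by [].
have -> : (if (i, b).2 then swap_aut else swap_aut^-1%g) (h z) = swap_fun (h z).
  by case: b.
by rewrite IH /=; case: (odd _) => //=; rewrite swap_funK.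
Qed.

End Parity.

(** * Square roots made continuous by a sign *)

Section SignedContinuity.
Variable R : realType.
Local Notation C := R[i].

Lemma continuous_at_near (Z T : topologicalType) (f g : Z -> T) z :
  (\forall z' \near z, f z' = g z') -> continuous_at z f -> continuous_at z g.
Proof.
move=> fg cf B; rewrite -(nbhs_singleton fg) => /cf.
by apply: filterS2 fg => z' /= <-.
Qed.

Lemma near_neq0 (Z : topologicalType) (f : Z -> C) z :
  continuous_at z f -> f z != 0 -> \forall z' \near z, f z' != 0.
Proof.
move=> cf f0; have FF := nbhs_filter z.
move/cvgrPdist_lt: cf => /(_ `|f z|); rewrite normr_gt0 => /(_ f0).
by apply: filterS => z'; apply: contraTneq => ->; rewrite subr0 ltxx.
Qed.

(** The factor [e] may jump: its jumps are absorbed by the zero of [u]. *)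
Lemma continuous_at_sign (Z : topologicalType) (e u : Z -> R) z :
  (forall z', `|e z'| <= 1) -> u z = 0 -> continuous_at z u ->
  continuous_at z (fun z' => e z' * u z').
Proof.
move=> e1 u0 cu; have FF := nbhs_filter z; apply/cvgrPdist_lt => d d0.
move/cvgrPdist_lt: cu => /(_ d d0); apply: filterS => z'.
rewrite u0 mulr0 !sub0r !normrN normrM; apply: le_lt_trans.
by rewrite ler_piMl.
Qed.

Definition sign (b : bool) (z : C) : C := if b then - z else z.

Lemma signM a b z : sign (a (+) b) z = sign a (sign b z).
Proof. by case: a b => -[] //=; rewrite opprK. Qed.

Lemma sign_exp3 b z : sign b z ^+ 3 = sign b (z ^+ 3).
Proof. by case: b => //=; rewrite exprNn -signr_odd /= expr1 mulN1r. Qed.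

Lemma sign_sqr b z : sign b z ^+ 2 = z ^+ 2.
Proof. by case: b => //=; rewrite sqrrN. Qed.

Lemma sign_eq0 b z : (sign b z == 0) = (z == 0).
Proof. by case: b => //=; rewrite oppr_eq0. Qed.

Lemma sign_continuous (Z : topologicalType) b (f : Z -> C) z :
  continuous_at z f -> continuous_at z (fun z' => sign b (f z')).
Proof.
move=> cf; case: b; last exact: cf.
exact: (@cvgN C C Z (nbhs z) (nbhs_filter z) f _ cf).
Qed.

Definition sqrt_re (z : C) : R := Num.sqrt ((Num.sqrt (Re z ^+ 2 + Im z ^+ 2) + Re z) / 2).
Definition sqrt_im (z : C) : R := Num.sqrt ((Num.sqrt (Re z ^+ 2 + Im z ^+ 2) - Re z) / 2).

Lemma sqrtcE (z : C) :
  sqrtc z = sqrt_re z +i* ((if Im z < 0 then -1 else 1) * sqrt_im z).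
Proof.
case: z => x y; rewrite /sqrtc /sqrt_re /sqrt_im /=; congr (_ +i* (_ * _)).
by have [y0|y0|y0] := ltgtP y 0; [rewrite ltr0_sg|rewrite gtr0_sg|].
Qed.

Lemma sqrt_re_continuous : continuous sqrt_re /\ continuous sqrt_im.
Proof.
have cn : continuous (fun z : C => Num.sqrt (Re z ^+ 2 + Im z ^+ 2)).
  move=> z; have FF := nbhs_filter z.
  apply: (@continuous_comp _ _ _ (fun z : C => Re z ^+ 2 + Im z ^+ 2)); last exact: sqrt_continuous.
  apply: (@cvgD R R^o C (nbhs z) FF).
    exact: (@cvgM R C (nbhs z) FF _ _ _ _ (@Re_continuous R z) (@Re_continuous R z)).
  exact: (@cvgM R C (nbhs z) FF _ _ _ _ (@Im_continuous R z) (@Im_continuous R z)).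
split=> z; have FF := nbhs_filter z.
  apply: (@continuous_comp _ _ _
    (fun z : C => (Num.sqrt (Re z ^+ 2 + Im z ^+ 2) + Re z) / 2));
    last exact: sqrt_continuous.
  apply: (@cvgM R C (nbhs z) FF); last exact: cvg_cst.
  exact: (@cvgD R R^o C (nbhs z) FF _ _ _ _ (cn z) (@Re_continuous R z)).
apply: (@continuous_comp _ _ _
  (fun z : C => (Num.sqrt (Re z ^+ 2 + Im z ^+ 2) - Re z) / 2));
  last exact: sqrt_continuous.
apply: (@cvgM R C (nbhs z) FF); last exact: cvg_cst.
exact: (@cvgB R R^o C (nbhs z) FF _ _ _ _ (cn z) (@Re_continuous R z)).
Qed.

End SignedContinuity.

Section SignedRoot.
Variable R : realType.
Local Notation C := R[i].
Local Notation I := (unit_interval R).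

Definition punctures1 : 1.-tuple R := [tuple 0].
Local Notation Cstar := (punctured punctures1).
(* The plane is cut along the negative reals, as for the principal root.      *)
Local Notation c1 := (crossing punctures1 ord_max).

Lemma punctures1_sorted : sorted <%R punctures1.
Proof. by []. Qed.

Lemma punctured1P (z : C) : Cstar z <-> z != 0.
Proof.
split=> [Yz|]; first by apply/eqP => z0; apply: Yz; rewrite z0 inE.
case: z => x y z0 [/= y0]; rewrite inE => /eqP x0.
by move: z0; rewrite x0 y0 eqxx.
Qed.

Lemma interval_of1 (x : R) : (interval_of punctures1 x : nat) = (0 < x).
Proof. by rewrite interval_ofE /= addn0. Qed.

Lemma parity_crossing1 (z z' : C) :
  parity (c1 z z') = [&& Im z == 0, ~~ (0 < Re z) & Im z' < 0].
Proof.
rewrite /crossing; case: (ltgtP (Im z') 0) => z'0; rewrite ?parity1 ?andbF //; last first.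
  rewrite /up_of /up_gen; case: eqP => _; rewrite ?parity1 //.
  by rewrite ltnNge leq_ord parity1.
rewrite /dn_of andbT; case: eqP => _; rewrite ?parity1 //.
rewrite /dn_gen /= interval_of1; case: ltP => x0 /=; first by rewrite parity1.
rewrite /edge_gen; case: unliftP => [j _|]; first by rewrite parity_gen.
by move/(congr1 val); rewrite /= interval_of1 ltNge x0.
Qed.

(** The principal root jumps only when one leaves the negative axis downwards, which is exactly when
    [c1] has odd parity. On the positive axis the sign of the imaginary part jumps, but there
    [sqrt_im] vanishes. *)
Lemma signed_root_continuous (z : C) : Cstar z ->
  continuous_at z (fun z' => sign (parity (c1 z z')) (sqrtc z')).
Proof.
move=> /punctured1P z0; have [cre cim] := sqrt_re_continuous R.
have [zI|zI] := eqVneq (Im z) 0; last first.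
  have E b : (\forall z' \near z, (Im z' < 0) = b) ->
      continuous_at z (fun z' => sign (parity (c1 z z')) (sqrtc z')).
    move=> nb; apply: (@continuous_at_near _ _
      (fun z' => sqrt_re z' +i* ((if b then -1 else 1) * sqrt_im z'))).
      apply: filterS nb => z' z'b; rewrite parity_crossing1 (negbTE zI) /=.
      by rewrite sqrtcE z'b.
    apply: complex_continuous; first exact: cre.
    apply: (@cvgM R C (nbhs z) (nbhs_filter z)); last exact: cim.
    exact: cvg_cst.
  have [zlt|zge] := ltP (Im z) 0.
    by apply: (E true); apply: filterS (near_Im_lt0 zlt) => z' ->.
  have zgt : 0 < Im z by rewrite lt_neqAle eq_sym zI.
  by apply: (E false); apply: filterS (near_Im_gt0 zgt) => z' z'0; rewrite ltNge ltW.
have Re0 : Re z != 0.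
  by apply: contraNneq z0 => zR; apply/eqP; case: z zI zR => x y /= -> ->.
have norm_z : Num.sqrt (Re z ^+ 2 + Im z ^+ 2) = `|Re z|.
  by rewrite zI expr0n addr0 sqrtr_sqr.
have [zp|zn] := ltP 0 (Re z).
  apply: (@continuous_at_near _ _
    (fun z' => sqrt_re z' +i* ((if Im z' < 0 then -1 else 1) * sqrt_im z'))).
    by apply: near_all => z'; rewrite parity_crossing1 zI eqxx zp sqrtcE.
  apply: complex_continuous; first exact: cre.
  apply: continuous_at_sign; last exact: cim.
    by move=> z'; case: ifP; rewrite ?normrN normr1.
  by rewrite /sqrt_im norm_z gtr0_norm // subrr mul0r sqrtr0.
(* On the negative axis the correction moves the jumping sign from the imaginary part to the real
   part, and [sqrt_re] vanishes there. *)
apply: (@continuous_at_near _ _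
  (fun z' => ((if Im z' < 0 then -1 else 1) * sqrt_re z') +i* sqrt_im z')).
  apply: near_all => z'; rewrite parity_crossing1 zI eqxx -leNgt zn /= sqrtcE.
  by case: ifP => _ /=; apply/eqP; rewrite eq_complex /= ?mulN1r ?mul1r ?opprK !eqxx.
apply: complex_continuous; last exact: cim.
apply: continuous_at_sign; last exact: cre.
  by move=> z'; case: ifP; rewrite ?normrN normr1.
by rewrite /sqrt_re norm_z ler0_norm // addNr mul0r sqrtr0.
Qed.

Definition signed_root (W : Type) (p : W -> C) (g : W -> Free 1) (w : W) : C :=
  sign (parity (g w)) (sqrtc (p w)).

Lemma signed_root_sqr (W : Type) (p : W -> C) g w : signed_root p g w ^+ 2 = p w.
Proof. by rewrite /signed_root sign_sqr sqr_sqrtc. Qed.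

Lemma signed_root_neq0 (W : Type) (p : W -> C) g w : p w != 0 -> signed_root p g w != 0.
Proof. by rewrite /signed_root sign_eq0 sqrtc_eq0. Qed.

(** The section [g] records each crossing of the cut, and its parity compensates the change of sign
    of the principal root. *)
Lemma signed_root_flat (W : topologicalType) (p : W -> C) (g : W -> Free 1) :
  continuous p -> (forall w, Cstar (p w)) -> flat c1 p g ->
  continuous (signed_root p g).
Proof.
move=> cp pY fg w.
apply: (@continuous_at_near _ _ (fun w' => sign (parity (g w))
    (sign (parity (c1 (p w) (p w'))) (sqrtc (p w'))))).
  by apply: filterS (fg w) => w' gw'; rewrite /signed_root gw' parityM signM.
apply: sign_continuous.
apply: (@for_comp _ _ _ p (fun z' => sign (parity (c1 (p w) z')) (sqrtc z'))).
  exact: cp.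
exact: signed_root_continuous.
Qed.

End SignedRoot.

(** * The fibre and its rotation by pi *)

Section CubicCocycle.
Variable R : realType.
Local Notation C := R[i].
Local Notation I := (unit_interval R).
Local Notation Cstar := (punctured (punctures1 R)).
Local Notation c1 := (crossing (punctures1 R) ord_max).

Definition punctures2 : 2.-tuple R := [tuple -1; 1].
Local Notation Y2 := (punctured punctures2).
Definition mid3 : 'I_3 := Ordinal (isT : (1 < 3)%N).
Local Notation c2 := (crossing punctures2 mid3).

Lemma punctures2_sorted : sorted <%R punctures2.
Proof. by rewrite /= andbT; lra. Qed.

Lemma punctured2P (z : C) : Y2 z <-> z ^+ 2 != 1.
Proof.
rewrite -subr_eq0 -{1}(expr1n _ 2) subr_sqr mulf_eq0 subr_eq0 addr_eq0.
case: z => x y; rewrite !eq_complex /= oppr0; split=> [Yz|].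
  apply/negP => H; apply: Yz; rewrite !inE.
  by move: H => /orP[]/andP[/eqP -> /eqP ->]; rewrite eqxx ?orbT.
move=> /negP zP [/= y0]; rewrite !inE y0 eqxx !andbT orbC in zP *.
exact: zP.
Qed.

Lemma interval_of2N (x : R) : x \notin punctures2 ->
  interval_of punctures2 (- x) = rev_ord (interval_of punctures2 x).
Proof.
rewrite !inE => xP; apply/val_inj; rewrite /= !interval_ofE /= !addn0.
move: xP; have -> : (-1 < - x) = (x < 1) by rewrite ltrN2.
have -> : (1 < - x) = (x < -1) by rewrite ltrNr.
by case: (ltgtP x (-1)) => x1; case: (ltgtP x 1) => x2 //=; exfalso; lra.
Qed.

Lemma swap1 : swap_fun 1%g = 1%g.
Proof. exact: (aut1g swap_aut). Qed.

Lemma up_gen_rev k : up_gen mid3 (rev_ord k) = swap_fun (dn_gen mid3 k).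
Proof.
case: k => [[|[|[|//]]] k3]; rewrite /up_gen /dn_gen /= ?swap1 //.
rewrite /edge_gen; case: unliftP => [j /(congr1 val) /= jE|/(congr1 val)] //.
case: unliftP => [i /(congr1 val) /= iE|/(congr1 val)] //.
rewrite /swap_fun fg_lift_gen; congr fg_gen; apply/val_inj => /=.
by move: jE iE; case: j i => [[|[|//]] j2] [[|[|//]] i2].
Qed.

Lemma dn_gen_rev k : dn_gen mid3 (rev_ord k) = swap_fun (up_gen mid3 k).
Proof. by rewrite -{2}(rev_ordK k) up_gen_rev swap_funK. Qed.

(** The rotation reverses the order of the three intervals and exchanges the half-planes; it fixes
    the middle interval, which is the trivial one for [c2], and exchanges the two generators. *)
Lemma crossing2N (z z' : C) : Y2 z -> c2 (- z) (- z') = swap_fun (c2 z z').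
Proof.
move=> Yz; rewrite /crossing raddfN /= oppr_gt0 oppr_lt0.
have E : up_of punctures2 mid3 (- z) = swap_fun (dn_of punctures2 mid3 z) /\
         dn_of punctures2 mid3 (- z) = swap_fun (up_of punctures2 mid3 z).
  rewrite /up_of /dn_of !raddfN /= oppr_eq0; case: eqP => z0; last by rewrite swap1.
  have zP : Re z \notin punctures2 by apply/negP => zP; exact: Yz.
  by rewrite interval_of2N // up_gen_rev dn_gen_rev.
by case: E => -> ->; case: ltgtP => //; rewrite swap1.
Qed.

Lemma crossing2_sign g (z z' : C) : Y2 z ->
  c2 (sign (parity g) z) (sign (parity g) z') = swap_action g (c2 z z').
Proof. by move=> Yz; rewrite swap_actionE; case: parity => //=; exact: crossing2N. Qed.

End CubicCocycle.

(** * The semidirect cocycle of the fibration *)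

Section CubicSpace.
Variable R : realType.
Local Notation C := R[i].
Local Notation I := (unit_interval R).
Local Notation Cstar := (punctured (punctures1 R)).
Local Notation c1 := (crossing (punctures1 R) ord_max).
Local Notation Y2 := (punctured (punctures2 R)).
Local Notation c2 := (crossing (punctures2 R) mid3).
Local Notation G := F2_rtimes_F1.

Definition cubic_space : set (C * C) :=
  [set b | b.1 != 0 /\ b.2 ^+ 2 != 4 * b.1 ^+ 3].

Definition fiber_coord (b : C * C) : C := b.2 / (2 * sqrtc b.1 ^+ 3).

(* The fibration [(p, q) |-> p] over the punctured plane becomes trivial after *)
(* [p = s ^+ 2]: then [q / (2 * s ^+ 3)] ranges over the plane minus [1, -1],  *)
(* and turning once around [p = 0] changes its sign.                           *)
Definition cubic_crossing (b b' : C * C) : G :=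
  (c2 (fiber_coord b) (sign (parity (c1 b.1 b'.1)) (fiber_coord b')), c1 b.1 b'.1).

Lemma two_neq0 : (2 : C) != 0. Proof. by rewrite pnatr_eq0. Qed.

Lemma cubic_spaceP (s y : C) : s != 0 ->
  cubic_space (s ^+ 2, 2 * s ^+ 3 * y) <-> Y2 y.
Proof.
move=> s0; have E : (2 * s ^+ 3 * y) ^+ 2 = 4 * (s ^+ 2) ^+ 3 * y ^+ 2 by ring.
rewrite punctured2P /cubic_space /= E expf_eq0 /= s0.
have s60 : 4 * (s ^+ 2) ^+ 3 != 0 by rewrite mulf_neq0 ?pnatr_eq0 // !expf_neq0.
split=> [[_]|y1]; first by apply: contraNneq => ->; rewrite mulr1.
split=> //; apply: contraNneq y1 => y1; apply/eqP/(mulfI s60).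
by rewrite y1 mulr1.
Qed.

Lemma fiber_coordE (b : C * C) e : b.1 != 0 ->
  sign e (fiber_coord b) = b.2 / (2 * sign e (sqrtc b.1) ^+ 3).
Proof.
move=> b0; rewrite sign_exp3 /fiber_coord; case: e => //=.
by rewrite mulrN invrN mulrN.
Qed.

Lemma root_fiber (b : C * C) e : b.1 != 0 ->
  2 * sign e (sqrtc b.1) ^+ 3 * sign e (fiber_coord b) = b.2.
Proof.
move=> b0; rewrite fiber_coordE // mulrC mulfVK //.
by rewrite mulf_neq0 ?two_neq0 // expf_neq0 // sign_eq0 sqrtc_eq0.
Qed.

Lemma fiber_coord_in b e : cubic_space b -> Y2 (sign e (fiber_coord b)).
Proof.
move=> Bb; have b0 := Bb.1; apply/(@cubic_spaceP (sign e (sqrtc b.1))).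
  by rewrite sign_eq0 sqrtc_eq0.
by rewrite root_fiber // sign_sqr sqr_sqrtc; case: b Bb {b0}.
Qed.

Lemma cubic_space_open b : cubic_space b -> \forall b' \near b, cubic_space b'.
Proof.
move=> [b1 b2].
have c_fst : continuous_at b (fun b : C * C => b.1) by exact: fst_cts.
have c_snd : continuous_at b (fun b : C * C => b.2) by exact: snd_cts.
have n1 := near_neq0 c_fst b1.
have n2 : \forall b' \near b, b'.2 ^+ 2 - 4 * b'.1 ^+ 3 != 0.
  apply: (@near_neq0 _ _ (fun b' : C * C => b'.2 ^+ 2 - 4 * b'.1 ^+ 3)); last by rewrite subr_eq0.
  apply: complexB_continuous; first exact: complexX_continuous c_snd.
  apply: (@complexM_continuous _ _ (fun=> 4) (fun b' : C * C => b'.1 ^+ 3)).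
    exact: cst_continuous.
  exact: complexX_continuous c_fst.
by move: n1 n2; apply: filterS2 => b' ? ; rewrite subr_eq0.
Qed.

Lemma fiber_coord_continuous b e : cubic_space b ->
  continuous_at b (fun b' => sign e (sign (parity (c1 b.1 b'.1)) (fiber_coord b'))).
Proof.
move=> Bb; apply: sign_continuous.
have c_fst : continuous_at b (fun b : C * C => b.1) by exact: fst_cts.
have c_snd : continuous_at b (fun b : C * C => b.2) by exact: snd_cts.
apply: (@continuous_at_near (C * C)%type C (fun b' : C * C =>
  b'.2 / (2 * sign (parity (c1 b.1 b'.1)) (sqrtc b'.1) ^+ 3))).
  have := near_neq0 c_fst Bb.1; apply: filterS => b' b'0.
  by rewrite fiber_coordE.
apply: complexM_continuous; first exact: c_snd.
apply: complexV_continuous.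
  by rewrite mulf_neq0 ?two_neq0 // expf_neq0 // sign_eq0 sqrtc_eq0 Bb.1.
apply: complexM_continuous; first exact: cvg_cst.
apply: complexX_continuous.
apply: (@for_comp _ _ _ fst (fun z' => sign (parity (c1 b.1 z')) (sqrtc z'))).
  exact: c_fst.
by apply: signed_root_continuous; apply/punctured1P; exact: Bb.1.
Qed.

Lemma cubic_mulE (g h : G) : (g * h)%g = ((g.1 * swap_action g.2 h.1)%g, (g.2 * h.2)%g).
Proof. by []. Qed.

(** The fibre component of the second step is computed with the sign [e] accumulated in the first;
    by equivariance of [c2] this sign becomes the action of the base component, as in the law of the
    semidirect product. *)
Lemma cubic_cocycle : local_cocycle cubic_space cubic_crossing.
Proof.
move=> b Bb; have c1c := @crossing_cocycle R 1 (punctures1 R) ord_max (punctures1_sorted R).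
have c2c := @crossing_cocycle R 2 (punctures2 R) mid3 (punctures2_sorted R).
have Yb1 : Cstar b.1 by apply/punctured1P; exact: Bb.1.
have n1 := near_cts (@fst_cts C C) (c1c _ Yb1).
have e1 : parity (c1 b.1 b.1) = false by rewrite (local_cocycle1 c1c Yb1) parity1.
have cb := @fiber_coord_continuous b false Bb.
have Yb := @fiber_coord_in b false Bb.
have n2 : \forall b' \near b, \forall y \near sign (parity (c1 b.1 b'.1)) (fiber_coord b'),
    c2 (fiber_coord b) y = (c2 (fiber_coord b) (sign (parity (c1 b.1 b'.1)) (fiber_coord b'))
      * c2 (sign (parity (c1 b.1 b'.1)) (fiber_coord b')) y)%g.
  apply: (near_for (P := fun y1 : C => \forall y \near y1, c2 (fiber_coord b) y =
    (c2 (fiber_coord b) y1 * c2 y1 y)%g) cb).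
  by rewrite /= e1; exact: c2c Yb.
have n3 := cubic_space_open Bb.
move: n1 n2 n3; apply: filterS3 => b' n1 n2 Bb'.
set e := parity (c1 b.1 b'.1) in n2 *.
have c1c' : Cstar b'.1 by apply/punctured1P; exact: Bb'.1.
have e1' : parity (c1 b'.1 b'.1) = false by rewrite (local_cocycle1 c1c c1c') parity1.
have cb' := @fiber_coord_continuous b' e Bb'.
have n2' : \forall b'' \near b',
    c2 (fiber_coord b) (sign e (sign (parity (c1 b'.1 b''.1)) (fiber_coord b''))) =
    (c2 (fiber_coord b) (sign e (fiber_coord b'))
      * c2 (sign e (fiber_coord b')) (sign e (sign (parity (c1 b'.1 b''.1)) (fiber_coord b''))))%g.
  apply: (near_for (P := fun y => c2 (fiber_coord b) y =
    (c2 (fiber_coord b) (sign e (fiber_coord b'))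
      * c2 (sign e (fiber_coord b')) y)%g) cb'); move: n2; rewrite e1' /=; exact.
have n1' := near_cts (@fst_cts C C) n1.
move: n1' n2'; apply: filterS2 => b'' n1' n2'.
rewrite cubic_mulE /cubic_crossing /= n1' parityM signM -/e n2'.
rewrite crossing2_sign //; exact: (@fiber_coord_in b' false Bb').
Qed.

(** The fibre coordinate for the root [signed_root] instead of [sqrtc], hence continuous along a
    lift of the base. *)
Definition twisted_fiber (W : Type) (f : W -> C * C) (g : W -> Free 1) (w : W) : C :=
  sign (parity (g w)) (fiber_coord (f w)).

Lemma cubic_flatP (W : topologicalType) (f : W -> C * C) (g : W -> G) :
  (forall w, cubic_space (f w)) ->
  flat cubic_crossing f g <->
  flat c1 (fst \o f) (snd \o g) /\
  flat c2 (twisted_fiber f (snd \o g)) (fst \o g).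
Proof.
move=> fB.
have E w w' : (snd \o g) w' = ((snd \o g) w * c1 ((fst \o f) w) ((fst \o f) w'))%g ->
    c2 (twisted_fiber f (snd \o g) w) (twisted_fiber f (snd \o g) w') =
    swap_action (g w).2 (cubic_crossing (f w) (f w')).1.
  move=> gw'; rewrite /twisted_fiber gw' parityM signM crossing2_sign //.
  exact: (@fiber_coord_in (f w) false (fB w)).
split=> [fg|[f1 f2] w].
  have f1 : flat c1 (fst \o f) (snd \o g).
    by move=> w; apply: filterS (fg w) => w' /= ->.
  split=> // w; move: (f1 w) (fg w); apply: filterS2 => w' /E -> /= ->.
  by rewrite cubic_mulE.
move: (f1 w) (f2 w); apply: filterS2 => w' gw'; rewrite E // => gw1.
rewrite cubic_mulE [LHS]surjective_pairing; congr (_, _); [exact: gw1|exact: gw'].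
Qed.

Lemma twisted_fiberE (W : Type) (f : W -> C * C) g w : (f w).1 != 0 ->
  twisted_fiber f g w = (f w).2 / (2 * signed_root (fst \o f) g w ^+ 3).
Proof. by move=> f0; rewrite /twisted_fiber fiber_coordE. Qed.

Lemma twisted_fiber_continuous (W : topologicalType) (f : W -> C * C) g :
  continuous f -> (forall w, cubic_space (f w)) -> flat c1 (fst \o f) g ->
  continuous (twisted_fiber f g).
Proof.
move=> cf fB fg.
have cs : continuous (signed_root (fst \o f) g).
  apply: signed_root_flat fg; first exact: (continuous_o cf (@fst_cts C C)).
  by move=> w; apply/punctured1P; exact: (fB w).1.
have -> : twisted_fiber f g = fun w => (f w).2 / (2 * signed_root (fst \o f) g w ^+ 3).
  by apply/funext => w; rewrite twisted_fiberE // (fB w).1.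
move=> w; apply: complexM_continuous; first exact: (continuous_o cf (@snd_cts C C)).
apply: complexV_continuous.
  by rewrite mulf_neq0 ?two_neq0 // expf_neq0 // signed_root_neq0 //= (fB w).1.
apply: complexM_continuous; first exact: cvg_cst.
apply: complexX_continuous; exact: cs.
Qed.

(** Recovers a map to [cubic_space] from its base component and its twisted fibre coordinate. *)
Definition cubic_point (W : Type) (p y : W -> C) (g : W -> Free 1) (w : W) : C * C :=
  (p w, 2 * signed_root p g w ^+ 3 * y w).

Lemma cubic_point_continuous (W : topologicalType) (p y : W -> C) g :
  continuous p -> (forall w, Cstar (p w)) -> flat c1 p g -> continuous y ->
  continuous (cubic_point p y g).
Proof.
move=> cp pY fg cy; apply: continuous_to_pair; first exact: cp.
move=> w.
apply: complexM_continuous; last exact: cy.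
apply: complexM_continuous; first exact: cvg_cst.
apply: complexX_continuous; exact: signed_root_flat.
Qed.

Lemma cubic_point_in (W : Type) (p y : W -> C) g w : Cstar (p w) -> Y2 (y w) ->
  cubic_space (cubic_point p y g w).
Proof.
move=> /punctured1P p0 Yy; rewrite /cubic_point -{1}(signed_root_sqr p g).
by apply/cubic_spaceP => //; exact: signed_root_neq0.
Qed.

Lemma twisted_fiber_point (W : Type) (p y : W -> C) g : (forall w, p w != 0) ->
  twisted_fiber (cubic_point p y g) g = y.
Proof.
move=> p0; apply/funext => w; rewrite twisted_fiberE /=; last exact: p0.
rewrite mulrC mulKf //.
by rewrite mulf_neq0 ?two_neq0 // expf_neq0 // signed_root_neq0.
Qed.

Lemma cubic_pointK (W : Type) (f : W -> C * C) g w : (f w).1 != 0 ->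
  cubic_point (fst \o f) (twisted_fiber f g) g w = f w.
Proof.
by move=> f0; rewrite /cubic_point /signed_root /twisted_fiber /= root_fiber // -surjective_pairing.
Qed.

(** The base component and the twisted fibre coordinate are contracted independently. Lifting the
    homotopy of the base provides the sign of the root at all times, with which the two homotopies
    are put together. *)
Lemma cubic_null : null_lifts R cubic_space cubic_crossing.
Proof.
move=> W A f g b0 g0 kW tW A0 cf fB /(cubic_flatP g fB)[f1 f2] fA.
have [a0 Aa0] := A0; have [fa0 ga0] := fA a0 Aa0.
have pY w : Cstar ((fst \o f) w) by apply/punctured1P; exact: (fB w).1.
have cp : continuous (fst \o f) := continuous_o cf (@fst_cts C C).
have [a Aa|p [cpp pC p0 p1 pA]] := @crossing_null R 1 (punctures1 R) ord_max
    (punctures1_sorted R) W A (fst \o f) (snd \o g) b0.1 g0.2 kW tW A0 cp pY f1.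
  by have [/= -> ->] := fA a Aa.
have cy := twisted_fiber_continuous cf fB f1.
have yY w : Y2 (twisted_fiber f (snd \o g) w) by exact: fiber_coord_in.
have [a Aa|y [cyy yC y0 y1 yA]] := @crossing_null R 2 (punctures2 R) mid3
    (punctures2_sorted R) W A _ (fst \o g) (twisted_fiber f (snd \o g) a0) g0.1
    kW tW A0 cy yY f2.
  by rewrite /twisted_fiber /=; have [-> ->] := fA a Aa; rewrite fa0 ga0.
have c1c := @crossing_cocycle R 1 (punctures1 R) ord_max (punctures1_sorted R).
have [|k [fk k0]] := @lift_exists C _ R Cstar c1 W p (snd \o g) c1c cpp pC.
  by have -> : (fun w => p (w, zero)) = fst \o f by exact/funext.
have b0C : Cstar b0.1 by rewrite -fa0; exact: pY.
have kA a t : A a -> k (a, t) = g0.2.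
  move=> Aa; have [_ <-] := fA a Aa; rewrite -[(g a).2]/((snd \o g) a) -k0.
  apply: (@flat_const C _ R Cstar c1 (fun t => p (a, t)) (fun t => k (a, t)) b0.1 c1c b0C).
    by move=> t'; exact: pA.
  exact: (flat_comp (@pairr_continuous _ _ a) fk).
(* At time one the base map is constant, so its section is constant along the contraction of [W],
   hence on all of [W]; its value is read on [A]. *)
have k1 w : k (w, one) = g0.2.
  have [w0 [K [cK K0 K1]]] := tW.
  have kK w' : k (w', one) = k (w0, one).
    have H t : k (K (w', t), one) = k (K (w', zero), one).
      apply: (@flat_const C _ R Cstar c1 (fun t => p (K (w', t), one))
        (fun t => k (K (w', t), one)) b0.1 c1c b0C).
        by move=> t'; exact: p1.
      have cu : continuous (fun t : I => (K (w', t), one : I)) :=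
        continuous_o (continuous_o (@pairr_continuous W I w') cK)
          (@pairl_continuous W I one).
      exact: (flat_comp cu fk).
    by rewrite -[w' in LHS]K1 H K0.
  by rewrite kK -(kK a0) kA.
have Pb : cubic_point (fst \o f) (twisted_fiber f (snd \o g)) (snd \o g) a0 = b0.
  by rewrite cubic_pointK // (fB a0).1.
have PE (z : W * I) : p z = b0.1 -> y z = twisted_fiber f (snd \o g) a0 -> k z = g0.2 ->
    cubic_point p y k z = b0.
  move=> pz yz kz; rewrite -[RHS]Pb /cubic_point /signed_root pz yz kz /=.
  by rewrite fa0 ga0.
exists (cubic_point p y k); split.
- exact: (cubic_point_continuous cpp pC fk cyy).
- by move=> z; exact: (cubic_point_in _ (pC z) (yC z)).
- move=> w; rewrite -[RHS](cubic_pointK (f := f) (snd \o g)); last exact: (fB w).1.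
  by rewrite /cubic_point /signed_root p0 y0 k0.
- by move=> w; exact: PE.
- by move=> a t Aa; apply: PE; [exact: pA|exact: yA|exact: kA].
Qed.

Lemma cubic_transitive : transitive_lifts R cubic_space cubic_crossing.
Proof.
move=> b b' [g2 g1] Bb Bb'.
have Yb : Cstar b.1 by apply/punctured1P; exact: Bb.1.
have Yb' : Cstar b'.1 by apply/punctured1P; exact: Bb'.1.
have [p [s [cp pC fs [p0 p1 s0 s1]]]] :=
  @crossing_transitive R 1 (punctures1 R) ord_max (punctures1_sorted R) _ _ g1 Yb Yb'.
(* Along the base path the root is multiplied by the sign of [parity g1] compared with the principal
   one, so the fibre path has to end at the fibre coordinate of [b'] with that sign. *)
have [y [s' [cy yC fs' [y0 y1 s'0 s'1]]]] :=
  @crossing_transitive R 2 (punctures2 R) mid3 (punctures2_sorted R) _ _ g2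
    (@fiber_coord_in b false Bb) (@fiber_coord_in b' (parity g1) Bb').
have HB t : cubic_space (cubic_point p y s t) by exact: (cubic_point_in _ (pC t) (yC t)).
exists (cubic_point p y s), (fun t => (s' t, s t)); split.
- exact: (cubic_point_continuous cp pC fs cy).
- exact: HB.
- apply/cubic_flatP => //; split; first exact: fs.
  have -> : twisted_fiber (cubic_point p y s) (snd \o (fun t => (s' t, s t))) = y.
    by apply: twisted_fiber_point => t; apply/punctured1P; exact: pC.
  exact: fs'.
- split.
  + rewrite /cubic_point /signed_root p0 y0 s0 parity1 /=.
    by rewrite (@root_fiber b false Bb.1); case: (b).
  + rewrite /cubic_point /signed_root p1 y1 s1.
    by rewrite (@root_fiber b' (parity g1) Bb'.1); case: (b').
  + by rewrite s0 s'0.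
  + by rewrite s1 s'1.
Qed.

Theorem aspherical_cubic : aspherical R cubic_space G.
Proof.
exists cubic_crossing; split; [exact: cubic_cocycle|exact: cubic_null|].
exact: cubic_transitive.
Qed.

End CubicSpace.

(** * Non-equilateral triangles *)

Section TriangleInvariants.
Variable R : realType.
Local Notation C := R[i].
Implicit Types z w : 'rV[C]_3.

Lemma ord3P (k : 'I_3) : [\/ k = 0, k = 1 | k = 2].
Proof.
case: k => [[|[|[|//]]] k3]; [constructor 1|constructor 2|constructor 3];
exact: val_inj.
Qed.

Definition tsum z : C := z 0 0 + z 0 1 + z 0 2.
(** The product of the two Lagrange resolvents of the triple. *)
Definition tquad z : C := z 0 0 ^+ 2 + z 0 1 ^+ 2 + z 0 2 ^+ 2
  - z 0 0 * z 0 1 - z 0 0 * z 0 2 - z 0 1 * z 0 2.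
Definition tcube z : C := (2 * z 0 0 - z 0 1 - z 0 2) *
  (2 * z 0 1 - z 0 0 - z 0 2) * (2 * z 0 2 - z 0 0 - z 0 1).
Definition triangle_coord z : C * (C * C) := (tsum z, (tquad z, tcube z)).

(* The monic polynomial with the roots [3 * z_j - tsum z] has no quadratic     *)
(* term; this is its value at [3 * x - s].                                     *)
Definition depressed_cubic (y : C * (C * C)) (x : C) : C :=
  (3 * x - y.1) ^+ 3 - 3 * y.2.1 * (3 * x - y.1) - y.2.2.

Lemma depressed_cubicE z x : depressed_cubic (triangle_coord z) x =
  27 * ((x - z 0 0) * (x - z 0 1) * (x - z 0 2)).
Proof. by rewrite /depressed_cubic /triangle_coord /tsum /tquad /tcube /=; ring. Qed.

Lemma triangle_disc z : 4 * tquad z ^+ 3 - tcube z ^+ 2 =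
  27 * ((z 0 0 - z 0 1) * (z 0 0 - z 0 2) * (z 0 1 - z 0 2)) ^+ 2.
Proof. by rewrite /tquad /tcube; ring. Qed.

Lemma ordered_confP z : @ordered_conf R 3 z <->
  tcube z ^+ 2 != 4 * tquad z ^+ 3.
Proof.
rewrite eq_sym -subr_eq0 triangle_disc mulf_eq0 pnatr_eq0 /= expf_eq0 /=.
rewrite !mulf_eq0 !subr_eq0; split=> [inj_z|].
  by apply/negP => /orP[/orP[]|] /eqP /inj_z.
move=> /norP[/norP[n01 n02] n12] i j /=.
case: (ord3P i) => ->; case: (ord3P j) => -> // /eqP.
- by rewrite (negbTE n01).
- by rewrite (negbTE n02).
- by rewrite eq_sym (negbTE n01).
- by rewrite (negbTE n12).
- by rewrite eq_sym (negbTE n02).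
- by rewrite eq_sym (negbTE n12).
Qed.

Lemma triangle_coord_surj (y : C * (C * C)) : exists z, triangle_coord z = y.
Proof.
case: y => s [p q].
have [a aE] := @solve_monicpoly C 3
  (fun i => if i == 0%N then q else if i == 1%N then 3 * p else 0) isT.
move: aE; rewrite !big_ord_recl big_ord0 /= expr0 expr1 => aE.
(* Dividing [X^3 - 3 p X - q] by [X - a] leaves [X^2 + a X + a^2 - 3 p], whose discriminant is this
   number. *)
have dE := sqr_sqrtc (12 * p - 3 * a ^+ 2); move: (sqrtc _) dE => d dE.
have qE : q = a ^+ 3 - 3 * p * a by rewrite aE; ring.
have pE : p = (d ^+ 2 + 3 * a ^+ 2) / 12 by rewrite dE; field.
pose b := (- a + d) / 2; pose c := (- a - d) / 2.
exists (\row_j tnth [tuple (a + s) / 3; (b + s) / 3; (c + s) / 3] j).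
rewrite /triangle_coord /tsum /tquad /tcube !mxE !(tnth_nth 0) /= /b /c.
by congr (_, (_, _)); rewrite ?qE ?pE; field.
Qed.

Lemma prod_eq0_ord3 z x : (x - z 0 0) * (x - z 0 1) * (x - z 0 2) = 0 ->
  exists j, x = z 0 j.
Proof.
move/eqP; rewrite !mulf_eq0 !subr_eq0 => /orP[/orP[]|] /eqP ->; [exists 0|exists 1|exists 2];
by [].
Qed.

Lemma triangle_coord_perm (s : 'S_3) z :
  triangle_coord (col_perm s z) = triangle_coord z.
Proof.
rewrite /triangle_coord /tsum /tquad /tcube !mxE.
have s01 : s 0 != s 1 by rewrite (inj_eq perm_inj).
have s02 : s 0 != s 2 by rewrite (inj_eq perm_inj).
have s12 : s 1 != s 2 by rewrite (inj_eq perm_inj).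
by case: (ord3P (s 0)) s01 s02 => ->; case: (ord3P (s 1)) s12 => ->;
  case: (ord3P (s 2)) => ->; rewrite ?eqxx // => _ _ _; congr (_, (_, _)); ring.
Qed.

Lemma equilateral_quad z : equilateral z <-> tquad z = 0.
Proof.
pose a := z 0 0 - z 0 1; pose b := z 0 1 - z 0 2.
have -> : tquad z = a ^+ 2 + a * b + b ^+ 2 by rewrite /tquad /a /b; ring.
rewrite /equilateral -/a -/b.
have -> : z 0 2 - z 0 0 = - (a + b) by rewrite /a /b; ring.
rewrite normrN; split=> [[ab bc]|q0].
  have aa := sqr_normc a; have bb := sqr_normc b; have cc := sqr_normc (a + b).
  rewrite -bc -ab aa in cc; rewrite -ab aa in bb.
  have [a0|a0] := eqVneq a 0.
    move: ab; rewrite a0 normr0 => /esym/eqP; rewrite normr_eq0 => /eqP ->.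
    by rewrite expr0n mul0r !addr0.
  have b0 : b != 0 by rewrite -normr_eq0 -ab normr_eq0.
  have ab0 : a^* * b^* != 0 by rewrite mulf_neq0 // conjc_eq0.
  apply/(mulfI ab0); rewrite mulr0.
  (* Multiplied by the two conjugates, the form becomes a combination of differences of squared
     moduli of the sides, which all vanish. *)
  have -> : a^* * b^* * (a ^+ 2 + a * b + b ^+ 2) =
      a * a^* * ((a + b) * (a^* + b^*) - a * a^*) + (b * b^* - a * a^*) * (b * a^*).
    by ring.
  have cD : (a + b)^* = a^* + b^*.
    by case: (a) (b) => x y [u v]; apply/eqP; rewrite eq_complex /= opprD !eqxx.
  by rewrite -cD -cc -bb !subrr mulr0 mul0r addr0.
have cube (u v : C) : u ^+ 2 + u * v + v ^+ 2 = 0 -> `|u| = `|v|.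
  move=> uv; have : u ^+ 3 = v ^+ 3.
    have E : u ^+ 3 - v ^+ 3 = (u - v) * (u ^+ 2 + u * v + v ^+ 2) by ring.
    by apply/eqP; rewrite -subr_eq0 E uv mulr0.
  move/(congr1 Num.norm); rewrite !normrX => /eqP.
  by rewrite eqrXn2 // => /eqP.
split; first exact: cube.
by rewrite -normrN; apply: cube; rewrite -q0; ring.
Qed.

End TriangleInvariants.

(** * Triangles as cubic polynomials *)

Section TriangleSpace.
Variable R : realType.
Local Notation C := R[i].
Local Notation conf := (@ordered_conf R 3).
Local Notation triangles := (unordered_conf R 3).

Lemma triangle_coord_continuous :
  continuous (@triangle_coord R : 'rV[C]_3 -> C * (C * C)).
Proof.
move=> z; have cz i : continuous_at z (fun z : 'rV[C]_3 => z 0 i).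
  exact: mx_coord_continuous.
have c2 i : continuous_at z (fun z : 'rV[C]_3 => z 0 i ^+ 2) := complexX_continuous (cz i).
have cM i j : continuous_at z (fun z : 'rV[C]_3 => z 0 i * z 0 j) :=
  complexM_continuous (cz i) (cz j).
have cd i j k : continuous_at z (fun z : 'rV[C]_3 => 2 * z 0 i - z 0 j - z 0 k).
  have ct : continuous_at z (fun _ : 'rV[C]_3 => 2 : C) by exact: cst_continuous.
  exact: (complexB_continuous (complexB_continuous (complexM_continuous ct (cz i)) (cz j)) (cz k)).
apply: for_pair; first exact: (complexD_continuous (complexD_continuous (cz 0) (cz 1)) (cz 2)).
apply: for_pair.
  exact: (complexB_continuous (complexB_continuous (complexB_continuous
    (complexD_continuous (complexD_continuous (c2 0) (c2 1)) (c2 2)) (cM 0 1)) (cM 0 2)) (cM 1 2)).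
exact: (complexM_continuous (complexM_continuous (cd 0 1 2) (cd 1 0 2)) (cd 2 0 1)).
Qed.

Definition triangle_invariant (T : triangles) : C * (C * C) :=
  triangle_coord (set_val (repr T : conf)).

Lemma triangle_invariant_pi (z : conf) :
  triangle_invariant (\pi_triangles z) = triangle_coord (set_val z).
Proof.
have /unordered_confP/existsP[s /eqP E] :
    \pi_triangles (repr (\pi_triangles z)) = \pi_triangles z by rewrite reprK.
by rewrite E triangle_coord_perm.
Qed.

Lemma triangle_invariant_continuous : continuous triangle_invariant.
Proof.
apply/quotient_continuous.
have -> : triangle_invariant \o \pi_triangles = (@triangle_coord R) \o set_val.
  by apply/funext => z; exact: triangle_invariant_pi.
apply: continuous_o; [exact: initial_continuous|exact: triangle_coord_continuous].
Qed.

Definition nondegenerate : set (C * (C * C)) :=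
  [set y | y.2.2 ^+ 2 != 4 * y.2.1 ^+ 3].

Lemma triangle_invariant_nondegenerate T : nondegenerate (triangle_invariant T).
Proof. by apply/ordered_confP; exact: set_valX. Qed.

Lemma triangle_invariant_surj y : nondegenerate y ->
  exists T, triangle_invariant T = y.
Proof.
move=> Uy; have [z zy] := triangle_coord_surj y.
have zconf : conf z by apply/ordered_confP; move: Uy; rewrite -zy.
exists (\pi_triangles (@exist _ (fun x => x \in conf) z (mem_set zconf) : conf)).
by rewrite triangle_invariant_pi set_valE.
Qed.

(** The points of [w] are distinct, so [j] is injective and therefore a permutation. *)
Lemma conf_permP (z w : conf) (j : 'I_3 -> 'I_3) :
  (forall i, set_val w 0 i = set_val z 0 (j i)) -> conf_perm z w.
Proof.
move=> wz; have j_inj : injective j.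
  by move=> a b jab; apply: (set_valX w); rewrite /= !wz jab.
apply/existsP; exists (perm j_inj); apply/eqP/rowP => i.
by rewrite mxE permE wz.
Qed.

Lemma triangle_coord_inj (z w : conf) :
  triangle_coord (set_val z) = triangle_coord (set_val w) -> conf_perm z w.
Proof.
move=> zw; have /choice[j jP] : forall i, exists j, set_val w 0 i = set_val z 0 j.
  move=> i; apply: prod_eq0_ord3.
  have : 27 != 0 :> C by rewrite pnatr_eq0.
  move/mulfI; apply; rewrite mulr0 -depressed_cubicE zw depressed_cubicE.
  by case: (ord3P i) => ->; rewrite subrr !(mul0r, mulr0).
exact: conf_permP jP.
Qed.

Lemma triangle_invariant_inj : injective triangle_invariant.
Proof.
move=> T T' /triangle_coord_inj /unordered_confP; rewrite !reprK; exact.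
Qed.

(* Continuity of roots: as the value at [z_i] of the cubic with roots [w_j] is *)
(* [27] times the product of the [z_i - w_j], some [w_j] is close to [z_i]     *)
(* when this value is small, and the [z_i] being distinct this matches them.   *)
Lemma triangle_invariant_open (T : triangles) (N : set triangles) : nbhs T N ->
  \forall y \near triangle_invariant T, forall T', triangle_invariant T' = y -> N T'.
Proof.
rewrite -[T]reprK; move: (repr T) => z {T} TN.
rewrite triangle_invariant_pi.
have [U Uz UN] : exists2 U : set 'rV[C]_3, nbhs (set_val z) U &
    forall w : conf, U (set_val w) -> N (\pi_triangles w).
  have H : nbhs z (fun w : conf => N (\pi_triangles w)) :=
    near_cts (w := z) (@pi_continuous _ triangles) TN.
  rewrite nbhsE in H; case: H => _ [[B oB <-] Bz] sB.
  exists B; first exact: (open_nbhs_nbhs (conj oB Bz)).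
  by move=> w; exact: sB.
case: Uz => P zP PU.
have near_i i : exists2 e : C, 0 < e & forall x, `|set_val z 0 i - x| < e ->
    P 0 i x /\ forall k, k != i -> `|set_val z 0 i - x| < `|set_val z 0 i - set_val z 0 k| / 2.
  have nk : \forall x \near set_val z 0 i, forall k : 'I_3, k != i ->
      `|set_val z 0 i - x| < `|set_val z 0 i - set_val z 0 k| / 2.
    have FF := nbhs_filter (set_val z 0 i : C).
    apply: (@filter_forall C 'I_3 (fun k x => k != i ->
      `|set_val z 0 i - x| < `|set_val z 0 i - set_val z 0 k| / 2) _ FF) => k.
    have [->|ki] := eqVneq k i; first by apply: (@filterE _ _ FF) => x.
    have d0 : 0 < `|set_val z 0 i - set_val z 0 k| / 2.
      rewrite divr_gt0 ?normr_gt0 // subr_eq0; apply: contra ki => /eqP.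
      by move/(set_valX z) => ->.
    by apply/nbhs_ballP; exists (`|set_val z 0 i - set_val z 0 k| / 2) => // x xb _.
  have H : nbhs (set_val z 0 i : C) (P 0 i `&` [set x | forall k : 'I_3, k != i ->
      `|set_val z 0 i - x| < `|set_val z 0 i - set_val z 0 k| / 2]).
    exact: filterI (zP 0 i) nk.
  by case/nbhs_ballP: H => e e0 eP; exists e => // x /eP.
have /choice[e eP] : forall i, exists e : C, 0 < e /\ forall x,
    `|set_val z 0 i - x| < e -> P 0 i x /\
    forall k, k != i -> `|set_val z 0 i - x| < `|set_val z 0 i - set_val z 0 k| / 2.
  by move=> i; have [e e0 H] := near_i i; exists e.
have small : \forall y \near triangle_coord (set_val z), forall i,
    `|depressed_cubic y (set_val z 0 i)| < 27 * e i ^+ 3.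
  have FF := nbhs_filter (triangle_coord (set_val z) : C * (C * C)).
  apply: (@filter_forall (C * (C * C))%type 'I_3 (fun i y =>
    `|depressed_cubic y (set_val z 0 i)| < 27 * e i ^+ 3) _ FF) => i.
  set x := set_val z 0 i; set y0 := triangle_coord _ in FF *.
  have e0 : 0 < 27 * e i ^+ 3 by rewrite mulr_gt0 ?ltr0n // exprn_gt0 // (eP i).1.
  have c1 : continuous_at y0 (fun y : C * (C * C) => y.1) by exact: fst_cts.
  have c2 : continuous_at y0 (fun y : C * (C * C) => y.2) by exact: snd_cts.
  have c21 : continuous_at y0 (fun y : C * (C * C) => y.2.1) := for_comp c2 (@fst_cts C C y0.2).
  have c22 : continuous_at y0 (fun y : C * (C * C) => y.2.2) := for_comp c2 (@snd_cts C C y0.2).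
  have cc (a : C) : continuous_at y0 (fun _ : C * (C * C) => a) by exact: cst_continuous.
  have cd : continuous_at y0 (fun y : C * (C * C) => 3 * x - y.1) :=
    complexB_continuous (cc (3 * x)) c1.
  have cG : continuous_at y0 (fun y => depressed_cubic y x) :=
    complexB_continuous (complexB_continuous (complexX_continuous cd)
      (complexM_continuous (complexM_continuous (cc 3) c21) cd)) c22.
  move/cvgrPdist_lt: cG => /(_ _ e0).
  apply: filterS => y; rewrite /y0 depressed_cubicE /x.
  rewrite (_ : _ * _ * _ = 0) ?mulr0 ?sub0r ?normrN //.
  by case: (ord3P i) => ->; rewrite subrr !(mul0r, mulr0).
apply: filterS small => y small T' T'y.
rewrite -[T']reprK; move: T'y; rewrite /triangle_invariant; move: (repr T') => w wy.
have /choice[j jP] : forall i, exists j, `|set_val z 0 i - set_val w 0 j| < e i.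
  move=> i; apply: contrapT => /forallNP far.
  have [e0 _] := eP i.
  have {}far k : e i <= `|set_val z 0 i - set_val w 0 k|.
    by rewrite real_leNgt ?normr_real ?gtr0_real //; apply/negP; exact: far.
  have := small i; rewrite -wy depressed_cubicE normrM ger0_norm ?ler0n //.
  rewrite ltr_pM2l ?ltr0n // !normrM => /lt_geF/negP; apply.
  rewrite exprSr expr2; have e0' := ltW e0.
  by apply: ler_pM; rewrite ?mulr_ge0 //; apply: ler_pM.
have j_inj : injective j.
  move=> i i' jii'; apply/eqP; apply: contraT => ii'.
  have [_ /(_ _ (jP i)) [_ /(_ i')]] := eP i; rewrite eq_sym => /(_ ii') h1.
  have [_ /(_ _ (jP i')) [_ /(_ i ii')]] := eP i'; rewrite -jii' => h2.
  have := ler_distD (set_val w 0 (j i)) (set_val z 0 i) (set_val z 0 i').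
  rewrite [`|set_val w _ _ - _|]distrC; move/le_lt_trans => /(_ _ (ltrD h1 h2)).
  by rewrite [`|set_val z 0 i' - set_val z 0 i|]distrC -splitr ltxx.
have w'conf : conf (\row_i set_val w 0 (j i)).
  by move=> i i'; rewrite /= !mxE => /(set_valX w)/j_inj.
pose w' : conf := @exist _ (fun x => x \in conf) _ (mem_set w'conf).
have w'E : set_val w' = \row_i set_val w 0 (j i) by rewrite set_valE.
have -> : \pi_triangles w = \pi_triangles w'.
  by apply/unordered_confP; apply: (@conf_permP _ _ j) => i; rewrite w'E mxE.
apply/UN/PU => i0 i; rewrite w'E mxE ord1.
by have [_ /(_ _ (jP i)) []] := eP i.
Qed.

Lemma non_equilateral_trianglesP T :
  @non_equilateral_triangles R T <-> (triangle_invariant T).2.1 != 0.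
Proof.
have [z ->] : exists z, T = \pi_triangles z by exists (repr T); rewrite reprK.
rewrite triangle_invariant_pi; split=> [nT|/eqP q0 /equilateral_triangleP/equilateral_quad //].
by apply/eqP => q0; apply/nT/equilateral_triangleP/equilateral_quad.
Qed.

Lemma non_equilateral_triangles_neq0 : @non_equilateral_triangles R !=set0.
Proof.
have [|T Ty] := @triangle_invariant_surj (0, (1, 0)).
  by rewrite /nondegenerate /= expr0n expr1n mulr1 eq_sym pnatr_eq0.
by exists T; apply/non_equilateral_trianglesP; rewrite Ty /= oner_eq0.
Qed.

Lemma aspherical_triangles :
  aspherical R (@non_equilateral_triangles R) F2_rtimes_F1.
Proof.
have [T0 _] := non_equilateral_triangles_neq0.
have triangleP := non_equilateral_trianglesP.
(* The inverse of the coordinates, with default value [T0] outside their image; its continuity on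
   the image is [triangle_invariant_open]. *)
pose k y := xget T0 [set T | triangle_invariant T = y].
have kP y : nondegenerate y -> triangle_invariant (k y) = y.
  move=> /triangle_invariant_surj[T Ty].
  exact: (@xgetPex _ T0 [set T | triangle_invariant T = y] (ex_intro _ T Ty)).
apply: (@aspherical_homeo R triangles (C * (C * C))%type (@non_equilateral_triangles R)
  ([set: C] `*` @cubic_space R) triangle_invariant k F2_rtimes_F1).
- rewrite openE => T /triangleP T0'.
  have c2 : continuous_at T (fun T => (triangle_invariant T).2.1).
    apply: (@for_comp _ _ _ triangle_invariant (fun y : C * (C * C) => y.2.1)).
      exact: triangle_invariant_continuous.
    have c21 : continuous (fun y : C * (C * C) => y.2.1) :=
      continuous_o (@snd_cts C (C * C)%type) (@fst_cts C C).
    exact: c21.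
  by apply: filterS (near_neq0 c2 T0') => T' /triangleP.
- move=> T /triangleP T0'; split.
  + exact: triangle_invariant_continuous.
  + by split=> //; split=> //; exact: triangle_invariant_nondegenerate.
  + apply: triangle_invariant_inj; apply: kP.
    exact: triangle_invariant_nondegenerate.
- move=> y [_ [y0 y1]]; split.
  + move=> N kN; have := triangle_invariant_open kN; rewrite kP //.
    move=> yN.
    have oy : \forall y' \near y, cubic_space y'.2.
      have By : cubic_space y.2 := conj y0 y1.
      exact: (@near_cts _ _ _ y (@cubic_space R) (@snd_cts C (C * C)%type)
        (cubic_space_open By)).
    move: yN oy; apply: filterS2 => y' y'N [_ y'1]; apply: y'N; exact: kP.
  + by apply/triangleP; rewrite kP.
  + exact: kP.
exact/aspherical_complex_prod/aspherical_cubic.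
Qed.

End TriangleSpace.

(** * The complement of the hypersurface *)

Section HypersurfaceComplement.
Variable R : realType.
Local Notation C := R[i].

(* The complement of [0], [1] and the two primitive sixth roots of unity is   *)
(* straightened so that the four punctures become real: a shear separates     *)
(* their abscissas, then the graph of an interpolating cubic is subtracted.   *)
Definition punctures4 : 4.-tuple R := [tuple - 2^-1; 0; 1; 3 / 2].
Local Notation Y4 := (punctured punctures4).
Local Notation Cstar := (punctured (punctures1 R)).

Definition half_sqrt3 : R := Num.sqrt (3 / 4).
Local Notation h := half_sqrt3.
(** The shear sends the punctures to the points [(0, 0)], [(1, 0)], [(3/2, 1)] and [(-1/2, -1)];
    this is the cubic through them. *)
Definition interpolant (x : R) : R := 2 / 3 * x * (x - 1) * (2 * x - 1).
Definition straighten (z : C) : C :=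
  let x := Re z + h^-1 * Im z in x +i* (h^-1 * Im z - interpolant x).
Definition unstraighten (z : C) : C :=
  let y := Im z + interpolant (Re z) in (Re z - y) +i* (h * y).

Lemma punctures4_sorted : sorted <%R punctures4.
Proof. by rewrite /=; apply/and4P; split=> //; lra. Qed.

Lemma half_sqrt3_gt0 : 0 < h.
Proof. by rewrite sqrtr_gt0 divr_gt0 ?ltr0n. Qed.

Lemma half_sqrt3_sqr : h ^+ 2 = 3 / 4.
Proof. by rewrite sqr_sqrtr // divr_ge0 ?ler0n. Qed.

Lemma straightenK : cancel straighten unstraighten.
Proof.
case=> x y; rewrite /straighten /unstraighten /= subrK addrK.
by rewrite mulVKf // gt_eqF ?half_sqrt3_gt0.
Qed.

Lemma unstraightenK : cancel unstraighten straighten.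
Proof.
case=> x y; rewrite /straighten /unstraighten /= mulKf ?gt_eqF ?half_sqrt3_gt0 //.
by rewrite subrK addrK.
Qed.

Lemma interpolant_continuous : continuous interpolant.
Proof.
move=> x; apply: cvgM.
  apply: cvgM.
    by apply: cvgM; [exact: cvg_cst|exact: cvg_id].
  by apply: cvgB; [exact: cvg_id|exact: cvg_cst].
apply: cvgB; last exact: cvg_cst.
by apply: cvgM; [exact: cvg_cst|exact: cvg_id].
Qed.

Lemma straighten_continuous : continuous straighten.
Proof.
move=> z; have FF := nbhs_filter z.
have cI : continuous_at z (fun z : C => h^-1 * Im z).
  exact: (@cvgM R C (nbhs z) FF _ _ _ _ (@cst_continuous _ _ h^-1 z) (@Im_continuous R z)).
have cR : continuous_at z (fun z : C => Re z + h^-1 * Im z).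
  exact: (@cvgD R R^o C (nbhs z) FF _ _ _ _ (@Re_continuous R z) cI).
apply: complex_continuous; first exact: cR.
have cJ : continuous_at z (fun z : C => interpolant (Re z + h^-1 * Im z)).
  exact: (for_comp cR (@interpolant_continuous _)).
exact: (@cvgB R R^o C (nbhs z) FF _ _ _ _ cI cJ).
Qed.

Lemma unstraighten_continuous : continuous unstraighten.
Proof.
move=> z; have FF := nbhs_filter z.
have cJ : continuous_at z (fun z : C => interpolant (Re z)).
  exact: (for_comp (@Re_continuous R z) (@interpolant_continuous _)).
have cI : continuous_at z (fun z : C => Im z + interpolant (Re z)).
  exact: (@cvgD R R^o C (nbhs z) FF _ _ _ _ (@Im_continuous R z) cJ).
apply: complex_continuous.
  exact: (@cvgB R R^o C (nbhs z) FF _ _ _ _ (@Re_continuous R z) cI).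
exact: (@cvgM R C (nbhs z) FF _ _ _ _ (@cst_continuous _ _ h z) cI).
Qed.

Lemma straighten_punctured (t : C) : Y4 (straighten t) <->
  t * (t - 1) * (t ^+ 2 - t + 1) != 0.
Proof.
have Ih : t ^+ 2 - t + 1 = (t - (2^-1 +i* h)) * (t - (2^-1 +i* - h)).
  have E : (2^-1 +i* h) + (2^-1 +i* - h) = 1 :> C.
    by apply/eqP; rewrite eq_complex /= subrr eqxx andbT; apply/eqP; field.
  have E' : (2^-1 +i* h) * (2^-1 +i* - h) = 1 :> C.
    apply/eqP; rewrite eq_complex /=; apply/andP; split; apply/eqP; last by ring.
    by have := half_sqrt3_sqr; rewrite expr2 => hh; rewrite mulrN hh; field.
  transitivity (t ^+ 2 - ((2^-1 +i* h) + (2^-1 +i* - h)) * t + (2^-1 +i* h) * (2^-1 +i* - h)).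
    by rewrite E E' mul1r.
  by ring.
have image (x y : R) (w : C) : w = x +i* (h * y) ->
    (t - w == 0) = (straighten t == (x + y) +i* (y - interpolant (x + y))).
  have <- : straighten (x +i* (h * y)) = (x + y) +i* (y - interpolant (x + y)).
    by rewrite /straighten /= mulKf // gt_eqF // half_sqrt3_gt0.
  by move=> ->; rewrite subr_eq0 (inj_eq (can_inj straightenK)).
rewrite Ih !mulf_eq0 -[t == 0](congr1 (fun u => u == 0) (subr0 t)).
rewrite (image 0 0 0) ?(image 1 0 1) ?(image 2^-1 1 (2^-1 +i* h)) ?(image 2^-1 (-1) (2^-1 +i* - h));
  rewrite ?mulr0 ?mulr1 ?mulrN1 //.
have -> : (0 + 0) +i* (0 - interpolant (0 + 0)) = 0 +i* 0 :> C.
  by congr (_ +i* _); rewrite /interpolant; field.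
have -> : (1 + 0) +i* (0 - interpolant (1 + 0)) = 1 +i* 0 :> C.
  by congr (_ +i* _); rewrite /interpolant; field.
have -> : (2^-1 + 1) +i* (1 - interpolant (2^-1 + 1)) = (3 / 2) +i* 0 :> C.
  by congr (_ +i* _); rewrite /interpolant; field.
have -> : (2^-1 - 1) +i* (-1 - interpolant (2^-1 - 1)) = (- 2^-1) +i* 0 :> C.
  by congr (_ +i* _); rewrite /interpolant; field.
move: (straighten t) => [x y]; rewrite !eq_complex /punctured /= !inE.
rewrite [X in _ <-> is_true (~~ X)](_ : _ =
    (y == 0) && [|| x == - 2^-1, x == 0, x == 1 | x == 3 / 2]); last first.
  by case: (y == 0) (x == 0) (x == 1) (x == 3 / 2) (x == - 2^-1) => -[] [] [] [].
split=> [Yw|/negP Yw [y0 xP]].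
  by apply/negP => /andP[/eqP y0 xP]; exact: Yw.
by apply: Yw; rewrite y0 eqxx.
Qed.

Definition hypersurface_coord (z : 'rV[C]_3) : C * (C * C) :=
  (z 0 0, (straighten ((z 0 2 - z 0 0) / (z 0 1 - z 0 0)), z 0 1 - z 0 0)).

Definition hypersurface_point (y : C * (C * C)) : 'rV[C]_3 :=
  \row_j tnth [tuple y.1; y.1 + y.2.2; y.1 + y.2.2 * unstraighten y.2.1] j.

Lemma hypersurface_point_continuous : continuous hypersurface_point.
Proof.
apply: mx_continuous => i j y.
have c1 : continuous_at y (fun y : C * (C * C) => y.1) by exact: fst_cts.
have c2 : continuous_at y (fun y : C * (C * C) => y.2) by exact: snd_cts.
have c22 : continuous_at y (fun y : C * (C * C) => y.2.2) :=
  for_comp c2 (@snd_cts C C y.2).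
have cu : continuous_at y (fun y : C * (C * C) => unstraighten y.2.1) :=
  for_comp (for_comp c2 (@fst_cts C C y.2)) (@unstraighten_continuous y.2.1).
under [X in continuous_at _ X]eq_fun do rewrite mxE (tnth_nth 0).
case: (ord3P j) => -> /=; first exact: c1.
  exact: (complexD_continuous c1 c22).
exact: (complexD_continuous c1 (complexM_continuous c22 cu)).
Qed.

Lemma hypersurface_complementP (z : 'rV[C]_3) : (~` @hypersurface R) z <->
  z 0 1 - z 0 0 != 0 /\ Y4 (straighten ((z 0 2 - z 0 0) / (z 0 1 - z 0 0))).
Proof.
set a := z 0 1 - z 0 0; set b := z 0 2 - z 0 0.
have E : (z 0 0 - z 0 1) * (z 0 0 - z 0 2) * (z 0 1 - z 0 2) *
    (z 0 0 ^+ 2 + z 0 1 ^+ 2 + z 0 2 ^+ 2 - z 0 0 * z 0 1 - z 0 0 * z 0 2 - z 0 1 * z 0 2) =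
    a * b * (a - b) * (a ^+ 2 - a * b + b ^+ 2) by rewrite /a /b; ring.
rewrite straighten_punctured /hypersurface /= E.
have [a0|a0] := eqVneq a 0; first by rewrite a0 !mul0r; split=> [|[]].
(* The equation is homogeneous of degree five in [a] and [b], so [a] splits off and the ratio
   [b / a] remains. *)
have -> : a * b * (a - b) * (a ^+ 2 - a * b + b ^+ 2) =
    - a ^+ 5 * (b / a * (b / a - 1) * ((b / a) ^+ 2 - b / a + 1)) by field.
have a5 : - a ^+ 5 != 0 by rewrite oppr_eq0 expf_neq0.
split=> [H|[_ H] /eqP]; last by rewrite mulf_eq0 (negbTE a5) (negbTE H).
by split=> //; apply/eqP => H'; apply: H; rewrite H' mulr0.
Qed.

Lemma hypersurface_complement_neq0 : (~` @hypersurface R) !=set0.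
Proof.
(* The triple [0, 1, -1], with ratio [-1]. *)
exists (hypersurface_point (0, (straighten (-1), 1))); apply/hypersurface_complementP.
rewrite /hypersurface_point !mxE !(tnth_nth 0) /= straightenK.
rewrite !add0r !subr0 mul1r divr1 oner_eq0; split=> //; apply/straighten_punctured.
by rewrite (_ : _ * _ * _ = 6); [rewrite pnatr_eq0|ring].
Qed.

Lemma aspherical_hypersurface_complement :
  aspherical R (~` @hypersurface R) (Free 4 * Free 1)%type.
Proof.
have cz i : continuous (fun z : 'rV[C]_3 => z 0 i) by exact: mx_coord_continuous.
have cB i j : continuous (fun z : 'rV[C]_3 => z 0 i - z 0 j).
  by move=> z; exact: (complexB_continuous (cz i z) (cz j z)).
apply: (@aspherical_homeo R 'rV[C]_3 (C * (C * C))%type _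
  ([set: C] `*` (Y4 `*` Cstar)) hypersurface_coord hypersurface_point).
- rewrite openE => z nz.
  have cM i j : continuous_at z (fun z : 'rV[C]_3 => z 0 i * z 0 j) :=
    complexM_continuous (cz i z) (cz j z).
  have c2 i : continuous_at z (fun z : 'rV[C]_3 => z 0 i ^+ 2) := complexX_continuous (cz i z).
  have := complexM_continuous (complexM_continuous (complexM_continuous
    (cB 0 1 z) (cB 0 2 z)) (cB 1 2 z))
    (complexB_continuous (complexB_continuous (complexB_continuous
    (complexD_continuous (complexD_continuous (c2 0) (c2 1)) (c2 2)) (cM 0 1)) (cM 0 2)) (cM 1 2)).
  by move/near_neq0 => H; apply: filterS (H _) => [z' /eqP //|]; exact/eqP.
- move=> z /hypersurface_complementP[a0 Yt]; split.
  + apply: for_pair; first exact: cz.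
    apply: for_pair; last exact: cB.
    apply: (@for_comp _ _ _ (fun z : 'rV[C]_3 => (z 0 2 - z 0 0) / (z 0 1 - z 0 0))).
      exact: (complexM_continuous (cB 2 0 z) (@complexV_continuous _ _
        (fun z : 'rV[C]_3 => z 0 1 - z 0 0) z a0 (cB 1 0 z))).
    exact: straighten_continuous.
  + by split=> //; split=> //; exact/punctured1P.
  + apply/rowP => j; rewrite mxE (tnth_nth 0) /= straightenK.
    case: (ord3P j) => -> //=; first by rewrite addrC subrK.
    by rewrite mulrC mulfVK // addrC subrK.
- move=> y [_ [Yy /punctured1P y0]].
  have E0 : hypersurface_point y 0 0 = y.1 by rewrite mxE (tnth_nth 0).
  have E1 : hypersurface_point y 0 1 = y.1 + y.2.2 by rewrite mxE (tnth_nth 0).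
  have E2 : hypersurface_point y 0 2 = y.1 + y.2.2 * unstraighten y.2.1 by rewrite mxE (tnth_nth 0).
  have Ea : hypersurface_point y 0 1 - hypersurface_point y 0 0 = y.2.2.
    by rewrite E0 E1 addrC addKr.
  have Et : (hypersurface_point y 0 2 - hypersurface_point y 0 0) / y.2.2 = unstraighten y.2.1.
    by rewrite E0 E2 [y.1 + _]addrC addrK mulrC mulKf.
  split.
  + exact: hypersurface_point_continuous.
  + by apply/hypersurface_complementP; rewrite Ea Et unstraightenK.
  + by rewrite /hypersurface_coord Ea Et E0 unstraightenK; case: (y) => ? [].
apply: aspherical_complex_prod; apply: aspherical_prod.
  exact: (aspherical_punctured ord0 punctures4_sorted).
exact: (aspherical_punctured ord0 (punctures1_sorted R)).
Qed.

End HypersurfaceComplement.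

Theorem corollary1p5 (R : realType) :
  K1_space R (set_type (@non_equilateral_triangles R)) F2_rtimes_F1 /\
  K1_space R (set_type (~` @hypersurface R)) (Free 4 * Free 1)%type.
Proof.
split; apply: aspherical_K1.
- exact: non_equilateral_triangles_neq0.
- exact: aspherical_triangles.
- exact: hypersurface_complement_neq0.
- exact: aspherical_hypersurface_complement.
Qed.
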